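(* Let $n \geq 3$ be an odd integer and set $m = (n-1)/2$. Let $H_1 = U(n)$ and $H_2 = Sp(m) \times SO(2n-2m)$. Embed $H_1$ into $U(2n)$ via the representation $st \oplus st^*$, i.e. $A \mapsto \mathrm{diag}(A, \bar{A})$ acting on $\mathbb{C}^n \oplus \mathbb{C}^n = \mathbb{C}^{2n}$, where $st$ is the standard representation of $U(n)$ and $st^*$ its contragredient. Embed $H_2$ into $U(2n)$ via $st' \otimes id \oplus id \otimes st''$, i.e. $(B, C) \mapsto \mathrm{diag}(B, C)$ acting on $\mathbb{C}^{2m} \oplus \mathbb{C}^{2n-2m} = \mathbb{C}^{2n}$, where $st'$ is the standard representation of $Sp(m) \subset U(2m)$ and $st''$ is the standard representation of $SO(2n-2m)$ (real orthogonal matrices acting $\mathbb{C}$-linearly on $\mathbb{C}^{2n-2m}$). Let $H_1$ and $H_2$ act isometrically on the round unit sphere $S^{4n-1} \subset \mathbb{C}^{2n}$ through these embeddings. Then the orbit spaces $S^{4n-1}/H_1$ and $S^{4n-1}/H_2$ are isospectral (their invariant spectra coincide) yet non-isometric.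
   Context: For a compact Riemannian manifold $M$ and a compact group $H$ of isometries of $M$, let $C^\infty(M)^H$ denote the smooth functions on $M$ that are constant on $H$-orbits. The $H$-invariant spectrum of $M/H$ is the spectrum (eigenvalues with multiplicities) of the Laplacian of $M$ restricted to $C^\infty(M)^H$. Two orbit spaces $M/H_1$, $M/H_2$ are called isospectral if their $H_1$-invariant and $H_2$-invariant spectra coincide. Orbit spaces carry the quotient metric (distance between orbits) and the smooth structure whose smooth functions $f$ are those with $\pi^* f \in C^\infty(M)^H$; a smooth SRF isometry is an isometry of metric spaces that is smooth with smooth inverse with respect to these structures (a map $\phi$ is smooth if it pulls back smooth functions to smooth functions). *)

(* Defs.v *)
From HB Require Import structures.
From mathcomp Require Import all_boot all_order all_algebra.
From mathcomp Require Import all_classical all_reals.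
From mathcomp Require Import topology normedtype derive trigo.
From mathcomp Require Import complex.
Set Implicit Arguments. Unset Strict Implicit. Unset Printing Implicit Defensive.
Import Order.TTheory GRing.Theory Num.Theory.
Import numFieldNormedType.Exports.
Local Open Scope classical_set_scope.
Local Open Scope ring_scope.

Section OrbitSpaces.
Variable R : realType.
Local Notation C := (R[i]).

Definition cRe (z : C) : R := let: Complex a _ := z in a.
Definition cIm (z : C) : R := let: Complex _ b := z in b.
Definition cconj (z : C) : C := @Complex R (cRe z) (- cIm z).

Definition unitary k : set 'M[C]_k :=
  [set A : 'M[C]_k | A *m (map_mx cconj A)^T = 1%:M].

Definition Jmx p : 'M[C]_(p + p) := block_mx 0 1%:M (- 1%:M) 0.
Definition symplectic p : set 'M[C]_(p + p) :=
  [set A : 'M[C]_(p + p) | unitary A /\ A^T *m Jmx p *m A = Jmx p].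

Definition special_orthogonal q : set 'M[C]_q :=
  [set A : 'M[C]_q | (forall i j, cIm (A i j) = 0) /\ A *m A^T = 1%:M /\ \det A = 1].

Definition H1 n : set 'M[C]_(n + n) :=
  [set block_mx A 0 0 (map_mx cconj A) | A in @unitary n].

Definition H2 p q : set 'M[C]_(p + p + q) :=
  [set M : 'M[C]_(p + p + q) | exists (B : 'M[C]_(p + p)) (Cm : 'M[C]_q), symplectic B /\ special_orthogonal Cm /\
                        M = block_mx B 0 0 Cm].

Definition cplx k (x : 'rV[R]_(k + k)) : 'rV[C]_k :=
  \row_j @Complex R (x 0 (lshift k j)) (x 0 (rshift k j)).
Definition realify k (z : 'rV[C]_k) : 'rV[R]_(k + k) :=
  row_mx (\row_j cRe (z 0 j)) (\row_j cIm (z 0 j)).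
Definition act k (A : 'M[C]_k) (x : 'rV[R]_(k + k)) : 'rV[R]_(k + k) :=
  realify (cplx x *m A^T).

Definition dotR N (x y : 'rV[R]_N) : R := \sum_(i < N) x 0 i * y 0 i.
Definition sphere N : set 'rV[R]_N := [set x : 'rV[R]_N | dotR x x = 1].
Definition normalize N (x : 'rV[R]_N) : 'rV[R]_N := (Num.sqrt (dotR x x))^-1 *: x.
Definition gdist N (x y : 'rV[R]_N) : R := acos (dotR x y).

Definition odist k (H : set 'M[C]_k) (x y : 'rV[R]_(k + k)) : R :=
  inf [set gdist x (act h y) | h in H].

(* S/H1 and S/H2 are isometric metric spaces (orbit spaces with quotient metric).
   An isometry of orbit spaces is encoded by a lift f between the spheres which
   preserves orbit distances and hits every orbit. *)
Definition orbit_isometric k1 k2 (G1 : set 'M[C]_k1) (G2 : set 'M[C]_k2) : Prop :=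
  exists f : 'rV[R]_(k1 + k1) -> 'rV[R]_(k2 + k2),
    (forall x, sphere x -> sphere (f x)) /\
    (forall x y, sphere x -> sphere y -> odist G2 (f x) (f y) = odist G1 x y) /\
    (forall y, sphere y -> exists x, sphere x /\ odist G2 (f x) y = 0).

Definition iterD N (vs : seq 'rV[R]_N) (F : 'rV[R]_N -> R) : 'rV[R]_N -> R :=
  foldr (fun v G => 'D_v G) F vs.
Definition smooth_on N (U : set 'rV[R]_N) (F : 'rV[R]_N -> R) : Prop :=
  forall (vs : seq 'rV[R]_N) x, U x -> differentiable (iterD vs F) x.
Definition ebasis N (i : 'I_N) : 'rV[R]_N := delta_mx 0 i.
Definition lapl N (F : 'rV[R]_N -> R) (x : 'rV[R]_N) : R :=
  - \sum_(i < N) 'D_(ebasis i) ('D_(ebasis i) F) x.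

(* A function on S^(N-1) is represented by its 0-homogeneous extension to
   R^N \ {0} (set to 0 at the origin). It is smooth on the sphere iff the
   extension is smooth on R^N \ {0}, and the Laplace-Beltrami operator of the
   round sphere applied to it equals the Euclidean Laplacian of the extension
   restricted to the sphere. *)
Definition sphere_fun N (F : 'rV[R]_N -> R) : Prop :=
  F 0 = 0 /\ forall x, x != 0 -> F x = F (normalize x).

Definition H_invariant k (H : set 'M[C]_k) (F : 'rV[R]_(k + k) -> R) : Prop :=
  forall h x, H h -> sphere x -> F (act h x) = F x.

Definition inv_eigenspace k (H : set 'M[C]_k) (lam : R) : set ('rV[R]_(k + k) -> R) :=
  [set F | sphere_fun F /\ smooth_on (~` [set 0]) F /\ H_invariant H F /\
           forall x, sphere x -> lapl F x = lam * F x].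

Definition lin_iso (V W : Type) (E1 : set (V -> R)) (E2 : set (W -> R)) : Prop :=
  exists phi : (V -> R) -> (W -> R),
    (forall f, E1 f -> E2 (phi f)) /\
    (forall a f g, E1 f -> E1 g ->
        phi (fun x => a * f x + g x) = (fun y => a * phi f y + phi g y)) /\
    (forall f g, E1 f -> E1 g -> phi f = phi g -> f = g) /\
    (forall g, E2 g -> exists f, E1 f /\ phi f = g).

Definition isospectral k1 k2 (G1 : set 'M[C]_k1) (G2 : set 'M[C]_k2) : Prop :=
  forall lam : R, lin_iso (inv_eigenspace G1 lam) (inv_eigenspace G2 lam).

End OrbitSpaces.

(* Main.v *)
(* If [F] is an eigenfunction, a suitable [r^s F] is harmonic, homogeneous of degree
   [s] and smooth off the origin.  Derivatives lower the degree, and the maximum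
   principle kills a harmonic function whose degree is negative but larger than
   [2 - N]; hence [r^s F] is a polynomial.  So the invariant spectrum is read off the
   invariant harmonic polynomials.  Both groups have no invariants of odd degree, and
   those of even degree form a polynomial algebra on four quadratics, one of which can
   be taken to be [|x|^2]: for [U(n)] the Gram matrix of [z] and [conj w], for
   [Sp(m) * SO(q)] the number [|u|^2] and the Gram matrix of the real and imaginary
   parts of [v].  Modulo [|x|^2], the invariant harmonics of degree [2 l] become the
   forms of degree [l] in three variables, whichever the group.

   In the second orbit space there are three points at mutual distance [pi / 2]: the
   orbits of a unit vector [u], of a real [v] and of an imaginary [v].  In the first
   one there are none, since their preimages would yield three orthogonal nonzero
   vectors in the plane [C^2]. *)

Require Import Defs.
From HB Require Import structures.
From mathcomp Require Import all_boot all_order all_algebra.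
From mathcomp Require Import all_classical all_reals.
From mathcomp Require Import topology normedtype landau derive trigo.
From mathcomp Require Import complex.
From mathcomp Require Import perm interval_inference exp ring lra.
Set Implicit Arguments. Unset Strict Implicit. Unset Printing Implicit Defensive.
Import Order.TTheory GRing.Theory Num.Theory.
Import numFieldNormedType.Exports.
Local Open Scope classical_set_scope.
Local Open Scope ring_scope.

(** * Weighted polynomials *)

(** The hardest step is that the four quadratics generate all invariants; it is done without
    averaging over the group. Every orbit meets a linear slice with four real coordinates.
    Multiplied by a square root of one invariant [y i], itself a slice coordinate, these become
    polynomials in the invariants, some only after squaring; sign changes realised by the group make
    the latter occur to even powers. So [y i ^ l * P] is a polynomial in the invariants when [P] has
    degree [2 l]. An involution compatible with the action gives the same with a second invariant as
    denominator. As the first one can grow while the others stay fixed, neither denominator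
    survives.

    Polynomials are functions with a recorded degree, and identities between them are checked along
    lines and curves, where roots in one variable can be counted. The degree [s] of [r^s F] is not
    known to be an integer beforehand, hence real powers and positive homogeneity. The eigenspaces
    are matched by a relation, sharing a leading form modulo [|x|^2], so no dimension is
    computed. *)

Section GradedPolynomials.
Variable R : realType.

(* Degree [d] part of the algebra of functions on [X] generated by the [e i],
   each [e i] being given the weight [wt i]. *)
Inductive gpoly (X I : Type) (e : I -> X -> R) (wt : I -> nat) :
    nat -> (X -> R) -> Prop :=
| gpoly_one : gpoly e wt 0 (fun=> 1)
| gpoly_zero d : gpoly e wt d (fun=> 0)
| gpoly_lin d a F G : gpoly e wt d F -> gpoly e wt d G ->
    gpoly e wt d (fun x => a * F x + G x)
| gpoly_mulgen d i F : gpoly e wt d F ->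
    gpoly e wt (wt i + d) (fun x => e i x * F x).

Section Closure.
Variables (X I : Type) (e : I -> X -> R) (wt : I -> nat).
Implicit Types F G : X -> R.

Lemma gpoly_eq d d' F G : d = d' -> F =1 G -> gpoly e wt d F -> gpoly e wt d' G.
Proof. by move=> <- /funext <-. Qed.

Lemma gpolyZ d a F : gpoly e wt d F -> gpoly e wt d (fun x => a * F x).
Proof.
move=> gF; apply: gpoly_eq (gpoly_lin a gF (gpoly_zero _ _ d)) => // x.
by rewrite addr0.
Qed.

Lemma gpolyD d F G : gpoly e wt d F -> gpoly e wt d G ->
  gpoly e wt d (fun x => F x + G x).
Proof.
by move=> gF gG; apply: gpoly_eq (gpoly_lin 1 gF gG) => // x; rewrite mul1r.
Qed.

Lemma gpolyB d F G : gpoly e wt d F -> gpoly e wt d G ->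
  gpoly e wt d (fun x => F x - G x).
Proof.
move=> gF gG; apply: gpoly_eq (gpoly_lin (-1) gG gF) => // x.
by rewrite mulN1r addrC.
Qed.

Lemma gpoly_cst c : gpoly e wt 0 (fun=> c).
Proof.
by apply: gpoly_eq (gpolyZ c (gpoly_one _ _)) => // x; rewrite mulr1.
Qed.

Lemma gpoly_gen i : gpoly e wt (wt i) (e i).
Proof.
apply: gpoly_eq (gpoly_mulgen i (gpoly_one _ _)); first by rewrite addn0.
by move=> x; rewrite mulr1.
Qed.

Lemma gpoly_sum d (J : Type) (r : seq J) (P : pred J) (F : J -> X -> R) :
  (forall j, P j -> gpoly e wt d (F j)) ->
  gpoly e wt d (fun x => \sum_(j <- r | P j) F j x).
Proof.
move=> gF; elim: r => [|j r IH].
  by apply: gpoly_eq (gpoly_zero _ _ d) => // x; rewrite big_nil.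
case Pj : (P j); last by apply: gpoly_eq IH => // x; rewrite big_cons Pj.
by apply: gpoly_eq (gpolyD (gF j Pj) IH) => // x; rewrite big_cons Pj.
Qed.

Lemma gpolyM d d' F G : gpoly e wt d F -> gpoly e wt d' G ->
  gpoly e wt (d + d') (fun x => F x * G x).
Proof.
move=> gF gG; elim: gF => {d F} [|d|d a F F' _ IH _ IH'|d i F _ IH].
- by apply: gpoly_eq gG => // x; rewrite mul1r.
- by apply: gpoly_eq (gpoly_zero _ _ _) => // x; rewrite mul0r.
- by apply: gpoly_eq (gpoly_lin a IH IH') => // x; rewrite mulrDl mulrA.
- by apply: gpoly_eq (gpoly_mulgen i IH); [rewrite addnA|move=> x; rewrite mulrA].
Qed.

Lemma gpolyX d n F : gpoly e wt d F -> gpoly e wt (n * d) (fun x => F x ^+ n).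
Proof.
move=> gF; elim: n => [|n IH].
  by apply: gpoly_eq (gpoly_one _ _) => // x; rewrite expr0.
by apply: gpoly_eq (gpolyM gF IH); [rewrite mulSn|move=> x; rewrite exprS].
Qed.

End Closure.

Section Change.
Variables (X I : Type) (e : I -> X -> R) (wt : I -> nat).
Implicit Types F G : X -> R.

Lemma gpoly_subst (J : Type) (f : J -> X -> R) (wt' : J -> nat) d F :
  (forall i, gpoly f wt' (wt i) (e i)) -> gpoly e wt d F -> gpoly f wt' d F.
Proof.
move=> ef gF; elim: gF => {d F} [|d|d a F F' _ IH _ IH'|d i F _ IH].
- exact: gpoly_one.
- exact: gpoly_zero.
- exact: gpoly_lin.
- exact: gpolyM.
Qed.

Lemma gpoly_comp (Y : Type) (phi : Y -> X) d F : gpoly e wt d F ->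
  gpoly (fun i y => e i (phi y)) wt d (fun y => F (phi y)).
Proof.
elim=> {d F} [|d|d a F F' _ IH _ IH'|d i F _ IH].
- exact: gpoly_one.
- exact: gpoly_zero.
- exact: gpoly_lin.
- exact: (@gpoly_mulgen _ _ (fun i y => e i (phi y))).
Qed.

(** Chooses a polynomial in free variables that represents [F]; it is not unique when the generators
    are dependent. Other values can then be put in place of the generators. *)
Lemma gpoly_lift d F : gpoly e wt d F ->
  exists2 P, gpoly (fun i (v : I -> R) => v i) wt d P &
    forall x, F x = P (e ^~ x).
Proof.
elim=> {d F} [|d|d a F F' _ [P gP FP] _ [P' gP' FP']|d i F _ [P gP FP]].
- by exists (fun=> 1) => //; exact: gpoly_one.
- by exists (fun=> 0) => //; exact: gpoly_zero.
- exists (fun v => a * P v + P' v); first exact: gpoly_lin.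
  by move=> x; rewrite FP FP'.
- exists (fun v => v i * P v); last by move=> x; rewrite FP.
  exact: (@gpoly_mulgen _ _ (fun i v => v i)).
Qed.

Lemma gpoly_scale c x x' d F : gpoly e wt d F ->
  (forall i, e i x' = c ^+ wt i * e i x) -> F x' = c ^+ d * F x.
Proof.
move=> + ex; elim=> {d F} [|d|d a F F' _ IH _ IH'|d i F _ IH].
- by rewrite expr0 mulr1.
- by rewrite mulr0.
- by rewrite IH IH'; ring.
- by rewrite ex IH exprD; ring.
Qed.

Lemma gpoly_ext x x' d F : gpoly e wt d F ->
  (forall i, e i x' = e i x) -> F x' = F x.
Proof.
move=> gF ex; rewrite (@gpoly_scale 1 x x' d F) ?expr1n ?mul1r// => i.
by rewrite expr1n mul1r.
Qed.

(** Reduces identities in several variables to identities in [{poly R}], where root counting is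
    available. *)
Lemma gpoly_curve (gamma : R -> X) d F :
  (forall i, exists q : {poly R}, forall s, e i (gamma s) = q.[s]) ->
  gpoly e wt d F -> exists q : {poly R}, forall s, F (gamma s) = q.[s].
Proof.
move=> eg; elim=> {d F} [|d|d a F F' _ [q Fq] _ [q' Fq']|d i F _ [q Fq]].
- by exists 1 => s; rewrite hornerC.
- by exists 0 => s; rewrite hornerC.
- by exists (a *: q + q') => s; rewrite hornerD hornerZ Fq Fq'.
- by have [p ep] := eg i; exists (p * q) => s; rewrite hornerM ep Fq.
Qed.

End Change.

(** Degree [d - 1], where degree -1 contains only the zero function; truncated subtraction would
    admit constants there. *)
Definition gpoly_pred (X I : Type) (e : I -> X -> R) (wt : I -> nat) d F :=
  if d is d'.+1 then gpoly e wt d' F else F = fun=> 0.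

Lemma gpoly_pred_zero (X I : Type) (e : I -> X -> R) (wt : I -> nat) d :
  gpoly_pred e wt d (fun=> 0).
Proof. by case: d => //= d; exact: gpoly_zero. Qed.

Lemma gpoly_pred_lin (X I : Type) (e : I -> X -> R) (wt : I -> nat) d (a : R)
    (F G : X -> R) : gpoly_pred e wt d F -> gpoly_pred e wt d G ->
  gpoly_pred e wt d (fun x => a * F x + G x).
Proof.
case: d => [|d] /=; last exact: gpoly_lin.
by move=> -> ->; apply/funext => x; rewrite mulr0 addr0.
Qed.

Section Distinguished.
Variables (X : Type) (I : eqType) (e : I -> X -> R) (wt : I -> nat) (i0 : I).
Hypothesis wt0 : wt i0 = 1%N.

Let e0 i x := if i == i0 then 0 else e i x.

(** Sorts by powers of the generator [e i0]. In [e0] that generator is replaced by 0, so the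
    coefficients depend on the other generators only. *)
Lemma gpoly_expand d F : gpoly e wt d F ->
  exists2 E : nat -> X -> R, forall i, (i <= d)%N -> gpoly e0 wt (d - i) (E i) &
    forall x, F x = \sum_(i < d.+1) e i0 x ^+ i * E i x.
Proof.
elim=> {d F} [|d|d a F F' _ [E gE FE] _ [E' gE' FE']|d i F _ [E gE FE]].
- exists (fun=> fun=> 1) => [i|x]; last by rewrite big_ord1 expr0 mul1r.
  by rewrite leqn0 => /eqP ->; exact: gpoly_one.
- exists (fun=> fun=> 0) => [i _|x]; first exact: gpoly_zero.
  by rewrite big1// => i _; rewrite mulr0.
- exists (fun i x => a * E i x + E' i x) => [i id|x].
    by apply: gpoly_lin; [exact: gE|exact: gE'].
  rewrite FE FE' mulr_sumr -big_split/=; apply: eq_bigr => i _; ring.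
- have [->|ii0] := eqVneq i i0.
    exists (fun j => if j is k.+1 then E k else fun=> 0) => [[_|k]|x].
    + exact: gpoly_zero.
    + by rewrite wt0 add1n ltnS subSS => /gE.
    + rewrite FE wt0 add1n [RHS]big_ord_recl/= mulr0 add0r mulr_sumr.
      by apply: eq_bigr => j _; rewrite exprS mulrA.
  (* The degree [wt i + d] leaves room for more powers of [e i0] than [E] is controlled for, so the
     coefficients beyond [d] are set to 0. *)
  exists (fun j x => if (j <= d)%N then e i x * E j x else 0) => [j jd|x].
    case: (leqP j d) => [jd'|_]; last exact: gpoly_zero.
    rewrite -addnBA//; apply: gpoly_eq (gpoly_mulgen i (gE j jd')) => // x.
    by rewrite /e0 (negbTE ii0).
  rewrite FE -(big_mkord xpredT (fun j => e i0 x ^+ j * E j x)) mulr_sumr.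
  rewrite -(big_mkord xpredT (fun j => e i0 x ^+ j *
    (if (j <= d)%N then e i x * E j x else 0))).
  rewrite [RHS](@big_cat_nat _ _ _ d.+1)//= ?ltnS ?leq_addl//.
  rewrite [X in _ = _ + X]big_nat_cond [X in _ = _ + X]big1 ?addr0.
    apply: eq_big_nat => j; rewrite ltnS => /andP[_ ->]; ring.
  by move=> j; rewrite andbT => /andP[dj _]; rewrite leqNgt dj mulr0.
Qed.

Lemma gpoly_expand0 d F : gpoly e wt d F ->
  exists2 G, gpoly e0 wt d G & exists2 H, gpoly_pred e wt d H &
    forall x, F x = G x + e i0 x * H x.
Proof.
have e0e i : gpoly e wt (wt i) (e0 i).
  have [->|ii0] := eqVneq i i0.
    by apply: gpoly_eq (gpoly_zero _ _ _) => // x; rewrite /e0 eqxx.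
  by apply: gpoly_eq (gpoly_gen e wt i) => // x; rewrite /e0 (negbTE ii0).
move=> /gpoly_expand[E gE FE]; exists (E 0%N).
  by apply: gpoly_eq (gE 0%N _); rewrite ?subn0.
exists (fun x => \sum_(i < d) e i0 x ^+ i * E i.+1 x).
  case: d gE {FE} => [|d] gE /=; first by apply/funext => x; rewrite big_ord0.
  apply: gpoly_sum => -[i /= id] _.
  apply: (@gpoly_eq _ _ _ _ (i * wt i0 + (d - i))) (_) => //.
    by rewrite wt0 muln1 subnKC.
  apply: gpolyM; first by apply: gpolyX; exact: gpoly_gen.
  by apply: gpoly_subst (gE i.+1 id).
move=> x; rewrite FE big_ord_recl expr0 mul1r mulr_sumr.
by congr (_ + _); apply: eq_bigr => i _; rewrite exprS mulrA.
Qed.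

Variable flip : X -> X.
Hypothesis flip0 : forall x, e i0 (flip x) = - e i0 x.
Hypothesis flip_id : forall i x, i != i0 -> e i (flip x) = e i x.

Let e2 i x := if i == i0 then e i0 x ^+ 2 else e i x.
Let wt2 i := if i == i0 then 2 else wt i.

(** Evenness is not inherited by the subterms of [F], so the induction carries the even part [E] and
    the odd part stripped of its factor [e i0], namely [W]. Both involve [e i0] through its square
    only, and multiplication by [e i0] exchanges their roles. *)
Lemma gpoly_even d F : gpoly e wt d F -> (forall x, F (flip x) = F x) ->
  gpoly e2 wt2 d F.
Proof.
have dec : gpoly e wt d F -> exists E W, [/\ gpoly e2 wt2 d E,
    gpoly_pred e2 wt2 d W, forall x, F x + F (flip x) = 2 * E x &
    forall x, F x - F (flip x) = 2 * e i0 x * W x].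
  elim=> {d F} [|d|d a F F' _ [E [W [gE gO FE FO]]] _ [E' [W' [gE' gO' FE' FO']]]
               |d i F _ [E [W [gE gO FE FO]]]].
  - exists (fun=> 1), (fun=> 0); split => //; first exact: gpoly_one.
      by move=> x; rewrite mulr1.
    by move=> x; rewrite mulr0 subrr.
  - exists (fun=> 0), (fun=> 0); split.
    + exact: gpoly_zero.
    + by case: d => //= d; exact: gpoly_zero.
    + by move=> x; rewrite mulr0 addr0.
    + by move=> x; rewrite mulr0 subrr.
  - exists (fun x => a * E x + E' x), (fun x => a * W x + W' x); split.
    + exact: gpoly_lin.
    + case: d gO gO' {gE gE'} => [/= -> ->|d /=]; last exact: gpoly_lin.
      by apply/funext => x; rewrite mulr0 addr0.
    + by move=> x; have := FE x; have := FE' x; nra.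
    + move=> x; have := FO x; have := FO' x => h1 h2.
      have -> : 2 * e i0 x * (a * W x + W' x) =
        a * (2 * e i0 x * W x) + 2 * e i0 x * W' x by ring.
      by rewrite -h1 -h2; ring.
  - have [->|ii0] := eqVneq i i0.
      exists (fun x => e i0 x ^+ 2 * W x), E; split.
      + case: d gE gO => [_ /= ->|d gE /= gO].
          by apply: gpoly_eq (gpoly_zero _ _ _) => // x; rewrite mulr0.
        apply: gpoly_eq (gpoly_mulgen i0 gO); first by rewrite /wt2 eqxx wt0.
        by move=> x; rewrite /e2 eqxx.
      + by rewrite wt0.
      + by move=> x; rewrite flip0 mulNr -mulrBr FO; ring.
      + by move=> x; rewrite flip0 mulNr opprK -mulrDr FE; ring.
    have gi G k : gpoly e2 wt2 k G ->
        gpoly e2 wt2 (wt i + k) (fun x => e i x * G x).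
      move=> gG; apply: gpoly_eq (gpoly_mulgen i gG).
        by rewrite /wt2 (negbTE ii0).
      by move=> x; rewrite /e2 (negbTE ii0).
    exists (fun x => e i x * E x), (fun x => e i x * W x); split.
    + exact: gi.
    + case: d gE gO => [_ /= ->|d _ /= /gi]; last by rewrite addnS.
      have -> : (fun x : X => e i x * 0) = fun=> 0.
        by apply/funext => x; rewrite mulr0.
      by case: (wt i + 0)%N => [|k] //=; exact: gpoly_zero.
    + by move=> x; rewrite flip_id// -mulrDr FE; ring.
    + by move=> x; rewrite flip_id// -mulrBr FO; ring.
move=> /dec[E [W [gE _ FE _]]] Fflip; apply: gpoly_eq gE => // x.
by have := FE x; rewrite Fflip; lra.
Qed.

End Distinguished.

Lemma poly_eq_ge (p q : {poly R}) a0 :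
  (forall a, a0 <= a -> p.[a] = q.[a]) -> p = q.
Proof.
move=> pq; apply/eqP; rewrite -subr_eq0; apply: contraT => pq0.
pose rs := [seq a0 + i%:R | i <- iota 0 (size (p - q))].
have := @max_poly_roots _ (p - q) rs pq0.
rewrite size_map size_iota ltnn => -> //.
- apply/allP => _ /mapP[i _ ->]; rewrite rootE hornerD hornerN pq ?subrr//.
  by rewrite lerDl.
- rewrite map_inj_uniq ?iota_uniq// => i j /addrI /eqP.
  by rewrite eqr_nat => /eqP.
Qed.

End GradedPolynomials.

(** * Homogeneous polynomials and the removal of denominators *)

Section HomogeneousPolynomials.
Variable R : realType.

Definition hpoly N : nat -> ('rV[R]_N -> R) -> Prop :=
  gpoly (fun (i : 'I_N) (x : 'rV[R]_N) => x 0 i) (fun=> 1%N).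

Section Domain.
Variable N : nat.
Implicit Types (F G : 'rV[R]_N -> R) (x y : 'rV[R]_N).

Lemma hpoly_line d F x y : hpoly d F ->
  exists q : {poly R}, forall s, F (x + s *: y) = q.[s].
Proof.
move=> gF; apply: (gpoly_curve (gamma := fun s => x + s *: y)) gF => i.
exists ((x 0 i)%:P + y 0 i *: 'X) => s.
by rewrite !mxE hornerD hornerZ hornerC hornerX mulrC.
Qed.

Lemma hpolyZ d F c x : hpoly d F -> F (c *: x) = c ^+ d * F x.
Proof. by move=> gF; apply: gpoly_scale gF _ => i; rewrite mxE expr1. Qed.

(** On the line from [x0] to [x] both factors become elements of the integral domain [{poly R}], and
    the first is nonzero because of its value at [x0]. *)
Lemma hpoly_domain d d' F G x0 : hpoly d F -> hpoly d' G ->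
  (forall x, F x * G x = 0) -> F x0 != 0 -> forall x, G x = 0.
Proof.
move=> gF gG FG0 Fx0 x.
have [p Fp] := hpoly_line x0 (x - x0) gF.
have [q Gq] := hpoly_line x0 (x - x0) gG.
have : p * q = 0.
  apply: (@poly_eq_ge _ _ _ 0) => a _.
  by rewrite hornerM -Fp -Gq FG0 hornerC.
move/eqP; rewrite mulf_eq0 => /orP[/eqP p0|/eqP q0].
  by move: Fx0; rewrite -[x0]addr0 -[X in x0 + X](scale0r (x - x0)) Fp p0 horner0 eqxx.
by rewrite -[x](subrKC x0) -[X in x0 + X]scale1r Gq q0 horner0.
Qed.

End Domain.

Section Denominators.
Variables (X : Type) (I : eqType) (e : I -> X -> R) (i0 i1 : I).
Let one : I -> nat := fun=> 1%N.
Let A := e i0.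
Let B := e i1.

(* [E / A^l] and [E' / B^l] agree and [A], [B] are independent, so neither has a
   denominator. *)
Lemma gpoly_denominators l (P E E' : X -> R) :
  i1 != i0 -> gpoly e one (2 * l) E -> gpoly e one (2 * l) E' ->
  (forall x, 0 < A x -> A x ^+ l * P x = E x) ->
  (forall x, 0 < B x -> B x ^+ l * P x = E' x) ->
  (forall x a, 0 < A x -> 0 < B x -> A x <= a ->
    exists2 x', A x' = a & forall j, j != i0 -> e j x' = e j x) ->
  exists2 G, gpoly e one l G & forall x, 0 < A x -> 0 < B x -> P x = G x.
Proof.
move=> i10 gE gE' PE PE' full.
have [// |c gc Ec] := gpoly_expand (i0 := i0) _ gE.
have [// |c' gc' Ec'] := gpoly_expand (i0 := i0) _ gE'.
set e0 := (fun i x => if i == i0 then 0 else e i x) in gc gc'.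
(* Freeze the other generators at [x] and let [A] run over a half-line, as [full] allows. Then
   [A^l E' = B^l E] is an identity in one variable whose left side is divisible by ['X^l], so the
   low coefficients of [E] vanish. *)
have c0 x i : 0 < A x -> 0 < B x -> (i < l)%N -> c i x = 0.
  move=> Ax Bx il.
  pose q := \sum_(i < (2 * l).+1) c i x *: 'X^i.
  pose q' := \sum_(i < (2 * l).+1) c' i x *: 'X^i.
  have : 'X^l * q' = (B x ^+ l)%:P * q.
    apply: (@poly_eq_ge _ _ _ (A x)) => a Aa.
    have [x' Ax' x'x] := full x a Ax Bx Aa.
    have a0 : 0 < a by rewrite (lt_le_trans Ax).
    have e0x j : e0 j x = e0 j x'.
      by rewrite /e0; case: eqVneq => // /x'x ->.
    have Bx' : B x' = B x by rewrite /B x'x.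
    have -> : ('X^l * q').[a] = a ^+ l * E' x'.
      rewrite hornerM hornerXn horner_sum Ec'; congr (_ * _).
      apply: eq_bigr => j _; rewrite hornerZ hornerXn mulrC -Ax'; congr (_ * _).
      have jl : (j <= 2 * l)%N by rewrite -ltnS.
      exact: gpoly_ext (gc' j jl) e0x.
    have -> : ((B x ^+ l)%:P * q).[a] = B x ^+ l * E x'.
      rewrite hornerM hornerC horner_sum Ec; congr (_ * _).
      apply: eq_bigr => j _; rewrite hornerZ hornerXn mulrC -Ax'; congr (_ * _).
      have jl : (j <= 2 * l)%N by rewrite -ltnS.
      exact: gpoly_ext (gc j jl) e0x.
    rewrite -PE ?Ax'// -PE' ?Bx'//; ring.
  move=> /(congr1 (fun p : {poly R} => p`_i)).
  rewrite coefXnM il coefCM /q coef_sum.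
  have i2l : (i < (2 * l).+1)%N by rewrite ltnS ltnW// (leq_trans il)// leq_pmull.
  rewrite (bigD1 (Ordinal i2l))//= coefZ coefXn eqxx mulr1 big1 ?addr0; last first.
    move=> j ji; rewrite coefZ coefXn; case: eqVneq => [ij|]; last by rewrite mulr0.
    by move: ji; rewrite -val_eqE/= ij eqxx.
  by move/esym/eqP; rewrite mulf_eq0 expf_eq0 (gt_eqF Bx) andbF/= => /eqP.
(* This is [E] divided by [A^l]. *)
exists (fun x => \sum_(i < l.+1) A x ^+ i * c (l + i)%N x).
  apply: gpoly_sum => -[i /= il] _.
  apply: (@gpoly_eq _ _ _ _ _ (i * 1 + (2 * l - (l + i)))%N) (_) => //.
    by rewrite muln1 mul2n -addnn subnDl subnKC.
  apply: gpolyM; first by apply: gpolyX; exact: (gpoly_gen e one i0).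
  apply: gpoly_subst (gc (l + i)%N _) => [j|]; last first.
    by rewrite mul2n -addnn leq_add2l.
  rewrite /e0; have [_|_] := eqVneq j i0; last exact: gpoly_gen.
  exact: gpoly_zero.
move=> x Ax Bx; apply: (@mulfI _ (A x ^+ l)); first by rewrite expf_neq0// gt_eqF.
rewrite PE// Ec -(big_mkord xpredT (fun i => e i0 x ^+ i * c i x)).
rewrite (@big_cat_nat _ _ _ l)//=; last by rewrite ltnW// ltnS leq_pmull.
rewrite big_nat_cond big1 ?add0r; last first.
  by move=> i; rewrite andbT => /andP[_ /c0 ->//]; rewrite mulr0.
rewrite -{1}[l]add0n big_addn mulr_sumr.
have -> : ((2 * l).+1 - l = l.+1)%N by rewrite mul2n -addnn -addnS addKn.
rewrite big_mkord; apply: eq_bigr => i _.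
by rewrite addnC exprD mulrA.
Qed.

End Denominators.
End HomogeneousPolynomials.

(** * Functions smooth off the origin *)

Section Calculus.
Variable R : realType.

Lemma differentiable_near_eq (V : normedModType R) (F G : V -> R) (x : V) :
  (\forall y \near x, F y = G y) -> differentiable F x -> differentiable G x.
Proof.
move=> FG dF.
(* [G - F] vanishes near [x], so it has differential 0 there, and adding it to [F] gives [G]. *)
suff dH : differentiable (G - F) x.
  by have := differentiableD dF dH; rewrite addrC subrK.
pose H := G - F.
have H0 : \forall h \near (0 : V), H (h + x) = 0.
  have FGx : \near x, F x = G x by [].
  rewrite (near_shift 0 x) /= in FGx.
  near=> h; rewrite /H !fctE; apply/eqP; rewrite subr_eq0 eq_sym; apply/eqP.
  by near: h; move: FGx; apply: filterS => h /=; rewrite subr0.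
suff Hs : H \o shift x = cst (H x) + (0 : V -> R) +o_ 0 id.
  have dH0 : 'd H x = 0 :> (V -> R).
    by apply/diff_unique => //; exact: cst_continuous.
  apply/diff_locallyP; rewrite dH0.
  by split => //; exact: cst_continuous.
have Hx : H x = 0 by move/nbhs_singleton: H0; rewrite add0r.
apply/eqaddoE; rewrite Hx funeqE => h /=; rewrite addr0 -[LHS]add0r.
congr (_ + _); rewrite littleoE//.
move=> _/posnumP[eps]; near=> k; rewrite /= (near H0 k)// normr0.
by rewrite mulr_ge0.
Unshelve. all: by end_near. Qed.

Lemma derive_line (V : normedModType R) (F : V -> R) (x v : V) :
  'D_v F x = 'D_1 (fun h : R => F (h *: v + x)) 0.
Proof.
rewrite /derive; set g1 := fun h => h^-1 *: _; set g2 := fun h => h^-1 *: _.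
suff -> : g1 = g2 by [].
apply/funext => h; rewrite /g1 /g2 /=.
by rewrite addr0 scale0r add0r [_%:A]mulr1.
Qed.

Lemma derive_linear_comp (V : normedModType R) (F : V -> R) (L : V -> V) (x v : V) :
  (forall a y z, L (a *: y + z) = a *: L y + L z) ->
  'D_v (fun y => F (L y)) x = 'D_(L v) F (L x).
Proof.
move=> linL; rewrite /derive; set g1 := fun h => h^-1 *: _; set g2 := fun h => h^-1 *: _.
suff -> : g1 = g2 by [].
by apply/funext => h; rewrite /g1 /g2 /= linL.
Qed.

Lemma derive_lin (V : normedModType R) (a : R) (F G : V -> R) (x v : V) :
  derivable F x v -> derivable G x v ->
  'D_v (fun y => a * F y + G y) x = a * 'D_v F x + 'D_v G x.
Proof.
move=> dF dG; have := deriveD (@derivableZ _ _ _ F a x v dF) dG.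
by rewrite (deriveZ a dF).
Qed.

Lemma derive_mul (V : normedModType R) (F G : V -> R) (x v : V) :
  derivable F x v -> derivable G x v ->
  'D_v (fun y => F y * G y) x = 'D_v F x * G x + F x * 'D_v G x.
Proof.
move=> dF dG; rewrite -[LHS]/('D_v (F * G) x) (deriveM dF dG).
rewrite -[_ *: _]/(_ * _) -[X in _ + X = _]/(_ * _) addrC.
by rewrite [X in X + _ = _]mulrC.
Qed.

Section RowVectors.
Variable N : nat.
Local Notation V := 'rV[R]_N.
Implicit Types (F G : V -> R) (x y v w : V).

Lemma derive_dirZ F x v a : differentiable F x -> 'D_(a *: v) F x = a * 'D_v F x.
Proof. by move=> dF; rewrite !deriveE// linearZ. Qed.

Lemma derive_dir_sum F x (I : finType) (v : I -> V) (a : I -> R) :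
  differentiable F x -> 'D_(\sum_i a i *: v i) F x = \sum_i a i * 'D_(v i) F x.
Proof.
move=> dF; rewrite deriveE// linear_sum; apply: eq_bigr => i _.
by rewrite linearZ deriveE.
Qed.

Lemma row_ebasis x : x = \sum_i x 0 i *: ebasis R i.
Proof. exact: row_sum_delta. Qed.

Lemma derive_ebasis F x v : differentiable F x ->
  'D_v F x = \sum_i v 0 i * 'D_(ebasis R i) F x.
Proof. by move=> dF; rewrite {1}(row_ebasis v) derive_dir_sum. Qed.

Lemma near_neq0 x : x != 0 -> \forall y \near x, y != 0.
Proof.
move=> x0; have : open (~` [set (0 : V)]).
  by apply: closed_openC; apply: accessible_closed_set1; apply: hausdorff_accessible; exact: norm_hausdorff.
rewrite openE => /(_ x) /= h; have /h : x <> 0 by apply/eqP.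
by rewrite /interior; apply: filterS => y /eqP.
Qed.

Lemma derive_eqU F G x v : (forall y, y != 0 -> F y = G y) -> x != 0 ->
  'D_v F x = 'D_v G x.
Proof.
move=> FG x0; apply: near_eq_derive; near=> y; apply: FG.
by near: y; exact: near_neq0.
Unshelve. all: by end_near. Qed.

Lemma differentiable_eqU F G x : (forall y, y != 0 -> F y = G y) -> x != 0 ->
  differentiable F x -> differentiable G x.
Proof.
move=> FG x0; apply: differentiable_near_eq; near=> y; apply: FG.
by near: y; exact: near_neq0.
Unshelve. all: by end_near. Qed.

Definition psmooth F := smooth_on (~` [set 0]) F.

(** Counts the order and peels off the innermost derivative, instead of listing directions:
    induction on the order then applies to both terms of the product rule. *)
Fixpoint pCn n F : Prop := (forall x, x != 0 -> differentiable F x) /\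
  (if n is m.+1 then forall v, pCn m ('D_v F) else True).

Lemma iterD_rcons vs v F : Defs.iterD (rcons vs v) F = Defs.iterD vs ('D_v F).
Proof. by rewrite /Defs.iterD foldr_rcons. Qed.

Lemma psmoothP F : psmooth F <-> forall n, pCn n F.
Proof.
split=> [sF n|cF vs x /eqP x0].
  elim: n F sF => [|n IH] F sF; split=> //=.
  - by move=> x /eqP x0; exact: (sF [::]).
  - by move=> x /eqP x0; exact: (sF [::]).
  - move=> v; apply: IH => vs x x0; rewrite -iterD_rcons; exact: sF.
have : pCn (size vs) F by [].
elim/last_ind: vs F {cF} => [|vs v IH] F; first by case=> + _; exact.
by rewrite size_rcons iterD_rcons => -[_] /(_ v)/IH.
Qed.

Lemma psmooth_diff F x : psmooth F -> x != 0 -> differentiable F x.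
Proof. by move=> sF /eqP x0; exact: (sF [::]). Qed.

Lemma psmooth_der F x v : psmooth F -> x != 0 -> derivable F x v.
Proof. by move=> sF x0; apply/diff_derivable/psmooth_diff. Qed.

Lemma psmoothD1 F v : psmooth F -> psmooth ('D_v F).
Proof. by move=> sF vs x x0; rewrite -iterD_rcons; exact: sF. Qed.

Lemma pCn_eq n F G : (forall y, y != 0 -> F y = G y) -> pCn n F -> pCn n G.
Proof.
elim: n F G => [|n IH] F G FG [dF cF]; split => //=.
- by move=> x x0; apply: differentiable_eqU (dF x x0).
- by move=> x x0; apply: differentiable_eqU (dF x x0).
- by move=> v; apply: IH (cF v) => y y0; exact: derive_eqU.
Qed.

Lemma psmooth_eq F G : (forall y, y != 0 -> F y = G y) -> psmooth F -> psmooth G.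
Proof. by move=> FG /psmoothP cF; apply/psmoothP => n; exact: pCn_eq (cF n). Qed.

Lemma pCnW n F : pCn n.+1 F -> pCn n F.
Proof.
elim: n F => [|n IH] F [dF cF]; split=> // v; exact/IH/cF.
Qed.

Lemma pCn_diff n F x : pCn n F -> x != 0 -> differentiable F x.
Proof. by case: n => [|n] [+ _]; exact. Qed.

Lemma pCn_lin n a F G : pCn n F -> pCn n G -> pCn n (fun x => a * F x + G x).
Proof.
elim: n F G => [|n IH] F G cF cG.
  split=> // x x0; apply: differentiableD; last exact: pCn_diff cG x0.
  by apply: differentiableZ; exact: pCn_diff cF x0.
have dFG x : x != 0 -> differentiable (fun x => a * F x + G x) x.
  move=> x0; apply: differentiableD; last exact: pCn_diff cG x0.
  by apply: differentiableZ; exact: pCn_diff cF x0.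
split=> // v; apply: pCn_eq (IH _ _ (cF.2 v) (cG.2 v)) => y y0.
have dF := @diff_derivable R _ R _ _ v (pCn_diff cF y0).
have dG := @diff_derivable R _ R _ _ v (pCn_diff cG y0).
by rewrite [RHS](derive_lin a dF dG).
Qed.

Lemma pCnM n F G : pCn n F -> pCn n G -> pCn n (fun x => F x * G x).
Proof.
elim: n F G => [|n IH] F G cF cG.
  by split=> // x x0; apply: differentiableM; [exact: pCn_diff cF x0|exact: pCn_diff cG x0].
have dFG x : x != 0 -> differentiable (fun x => F x * G x) x.
  by move=> x0; apply: differentiableM; [exact: pCn_diff cF x0|exact: pCn_diff cG x0].
split=> // v.
apply: pCn_eq (pCn_lin 1 (IH _ _ (pCnW cF) (cG.2 v)) (IH _ _ (pCnW cG) (cF.2 v))).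
move=> y y0.
have dF := @diff_derivable R _ R _ _ v (pCn_diff cF y0).
have dG := @diff_derivable R _ R _ _ v (pCn_diff cG y0).
by rewrite mul1r [RHS](derive_mul dF dG) addrC [X in X + _ = _]mulrC.
Qed.

Lemma psmooth_lin a F G : psmooth F -> psmooth G -> psmooth (fun x => a * F x + G x).
Proof. by move=> /psmoothP cF /psmoothP cG; apply/psmoothP => n; exact: pCn_lin. Qed.

Lemma psmoothM F G : psmooth F -> psmooth G -> psmooth (fun x => F x * G x).
Proof. by move=> /psmoothP cF /psmoothP cG; apply/psmoothP => n; exact: pCnM. Qed.

Lemma psmooth_cst c : psmooth (fun=> c).
Proof.
apply/psmoothP => n; elim: n c => [|n IH] c.
  by split=> // x _; exact: differentiable_cst.
split=> [x _|v]; first exact: differentiable_cst.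
by apply: pCn_eq (IH 0) => y _; rewrite derive_cst.
Qed.

Lemma psmoothZ a F : psmooth F -> psmooth (fun x => a * F x).
Proof. by move=> sF; apply: psmoothM => //; exact: psmooth_cst. Qed.

Lemma psmooth_sum (I : finType) (F : I -> V -> R) :
  (forall i, psmooth (F i)) -> psmooth (fun x => \sum_i F i x).
Proof.
move=> sF; elim: (index_enum I) => [|i r IH].
  by apply: psmooth_eq (psmooth_cst 0) => y _; rewrite big_nil.
apply: psmooth_eq (psmooth_lin 1 (sF i) IH) => y _.
by rewrite big_cons mul1r.
Qed.

Lemma pderiveD F G x v : psmooth F -> psmooth G -> x != 0 ->
  'D_v (fun y => F y + G y) x = 'D_v F x + 'D_v G x.
Proof.
move=> sF sG x0; have := @derive_lin _ 1 _ _ _ _ (psmooth_der (v := v) sF x0) (psmooth_der (v := v) sG x0).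
by rewrite mul1r => <-; congr ('D_v _ x); apply/funext => y; rewrite mul1r.
Qed.

Lemma pderiveM F G x v : psmooth F -> psmooth G -> x != 0 ->
  'D_v (fun y => F y * G y) x = 'D_v F x * G x + F x * 'D_v G x.
Proof.
by move=> sF sG x0; apply: derive_mul; exact: psmooth_der.
Qed.

Lemma pderiveZ a F x v : psmooth F -> x != 0 ->
  'D_v (fun y => a * F y) x = a * 'D_v F x.
Proof.
move=> sF x0; have := @derive_lin _ a _ _ _ _ (psmooth_der (v := v) sF x0) (derivable_cst 0 x v).
by rewrite derive_cst addr0 => <-; congr ('D_v _ x); apply/funext => y; rewrite addr0.
Qed.

Lemma pderive_sum (I : finType) (F : I -> V -> R) x v :
  (forall i, psmooth (F i)) -> x != 0 ->
  'D_v (fun y => \sum_i F i y) x = \sum_i 'D_v (F i) x.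
Proof.
move=> sF x0; elim: (index_enum I) => [|i r IH].
  under eq_fun do rewrite big_nil.
  by rewrite derive_cst big_nil.
under eq_fun do rewrite big_cons.
rewrite big_cons -IH pderiveD//; clear IH; elim: r => [|j r IH].
  by apply: psmooth_eq (psmooth_cst 0) => y _; rewrite big_nil.
apply: psmooth_eq (psmooth_lin 1 (sF j) IH) => y _.
by rewrite big_cons mul1r.
Qed.

Lemma coord_derive i x v : 'D_v (fun y => y 0 i) x = v 0 i.
Proof.
have lin_i : linear (fun y : V => y 0 i) by move=> a y z; rewrite !mxE.
pose Ai := GRing.isLinear.Build _ _ _ _ _ lin_i.
pose Li : {linear V -> R} := HB.pack (fun y : V => y 0 i) Ai.
have di := @differentiable_coord R 1 N x 0 i.
rewrite deriveE//.
have ci : continuous Li by move=> y; exact: coord_continuous.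
by rewrite (@diff_lin _ _ _ Li).
Qed.

Lemma hpoly_diff d F x : hpoly d F -> differentiable F x.
Proof.
elim=> {d F} [|d|d a F F' _ IH _ IH'|d i F _ IH].
- exact: differentiable_cst.
- exact: differentiable_cst.
- by apply: differentiableD => //; exact: differentiableZ.
- by apply: differentiableM => //; exact: differentiable_coord.
Qed.

Definition hpoly_pred d F :=
  gpoly_pred (fun (i : 'I_N) x => x 0 i) (fun=> 1%N) d F.

Lemma hpoly_derive d F v : hpoly d F -> hpoly_pred d ('D_v F).
Proof.
elim=> {d F} [|d|d a F F' gF IH gF' IH'|d i F gF IH].
- by apply/funext => x; exact: derive_cst.
- have -> : 'D_v (fun=> 0) = (fun=> 0) :> (V -> R).
    by apply/funext => x; exact: derive_cst.
  by case: d => //= d; exact: gpoly_zero.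
- have -> : 'D_v (fun y => a * F y + F' y) = (fun x => a * 'D_v F x + 'D_v F' x).
    apply/funext => x; have dF := @diff_derivable R _ R _ _ v (hpoly_diff x gF).
    have dF' := @diff_derivable R _ R _ _ v (hpoly_diff x gF').
    exact: (derive_lin a dF dF').
  case: d gF gF' IH IH' => [|d] _ _ /=; last by move=> ? ?; exact: gpoly_lin.
  move=> DF0 DF'0; apply/funext => x.
  have -> : 'D_v F x = 0 by exact: (congr1 (@^~ x) DF0).
  have -> : 'D_v F' x = 0 by exact: (congr1 (@^~ x) DF'0).
  by rewrite mulr0 addr0.
- have -> : 'D_v (fun y => y 0 i * F y) = (fun x => v 0 i * F x + x 0 i * 'D_v F x).
    apply/funext => x; have dF := @diff_derivable R _ R _ _ v (hpoly_diff x gF).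
    have di := @diff_derivable R _ R _ _ v (@differentiable_coord R 1 N x 0 i).
    by rewrite (derive_mul di dF) coord_derive.
  apply: gpoly_lin => //; case: d gF IH => [_ /= DF0|d _ /=].
    rewrite (_ : (fun x => _) = fun=> 0); first exact: gpoly_zero.
    apply/funext => x; rewrite -[RHS](mulr0 (x 0 i)).
    exact: (congr1 (fun h => x 0 i * h x) DF0).
  exact: (gpoly_mulgen (e := fun (i : 'I_N) (x : V) => x 0 i)).
Qed.

Lemma hpoly_psmooth d F : hpoly d F -> psmooth F.
Proof.
move=> gF; apply/psmoothP => n; elim: n d F gF => [|n IH] d F gF.
  by split=> // x _; exact: hpoly_diff gF.
split=> [x _|v]; first exact: hpoly_diff gF.
have := hpoly_derive v gF.
case: d gF => [_ /= DF0|d _ /=]; last exact: IH.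
by apply: (IH 0%N); rewrite DF0; exact: gpoly_cst.
Qed.

End RowVectors.
End Calculus.

(** * Positively homogeneous functions, powers of the norm, and the Laplacian *)

Section Radial.
Variables (R : realType) (N : nat).
Local Notation V := 'rV[R]_N.
Implicit Types (F G u : V -> R) (x y v w : V) (s sigma : R).

Definition phom s F := forall c x, 0 < c -> x != 0 -> F (c *: x) = c `^ s * F x.

(** Opposite in sign to [lapl]. *)
Definition lap F x := \sum_(i < N) 'D_(ebasis R i) ('D_(ebasis R i) F) x.

(** The power [|x|^s]. *)
Definition rad s x := dotR x x `^ (s / 2).

Lemma dotRC x y : dotR x y = dotR y x.
Proof. by apply: eq_bigr => i _; rewrite mulrC. Qed.

Lemma dotR_linl a x y z : dotR (a *: x + y) z = a * dotR x z + dotR y z.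
Proof.
by rewrite mulr_sumr -big_split; apply: eq_bigr => i _; rewrite /= !mxE mulrDl mulrA.
Qed.

Lemma dotRZl a x y : dotR (a *: x) y = a * dotR x y.
Proof. by rewrite mulr_sumr; apply: eq_bigr => i _; rewrite mxE mulrA. Qed.

Lemma dotRZZ a x : dotR (a *: x) (a *: x) = a ^+ 2 * dotR x x.
Proof. by rewrite dotRZl dotRC dotRZl; ring. Qed.

Lemma dotR_ge0 x : 0 <= dotR x x.
Proof. by apply: sumr_ge0 => i _; rewrite -expr2 sqr_ge0. Qed.

Lemma dotR_eq0 x : (dotR x x == 0) = (x == 0).
Proof.
apply/idP/eqP => [|->]; last by rewrite /dotR big1// => i _; rewrite mxE mul0r.
rewrite psumr_eq0 => [/allP x0|i _]; last by rewrite -expr2 sqr_ge0.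
apply/rowP => i; have := x0 i (mem_index_enum i); rewrite -expr2 sqrf_eq0 => /eqP ->.
by rewrite mxE.
Qed.

Lemma dotR_gt0 x : (0 < dotR x x) = (x != 0).
Proof. by rewrite lt0r dotR_eq0 dotR_ge0 andbT. Qed.

Lemma dotR_ebasis x i : dotR x (ebasis R i) = x 0 i.
Proof.
rewrite /dotR (bigD1 i)//= mxE !eqxx mulr1 big1 ?addr0// => j ji.
by rewrite mxE (negbTE ji) andbF mulr0.
Qed.

Lemma hpoly_dotR v : hpoly 1 (fun x => dotR x v).
Proof.
apply: gpoly_sum => i _.
apply: gpoly_eq (gpolyZ (v 0 i) (gpoly_gen _ _ i)) => // x.
by rewrite mulrC.
Qed.

Lemma hpoly_sqr : hpoly 2 (fun x => dotR x x).
Proof.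
apply: gpoly_sum => i _.
exact: gpoly_mulgen (gpoly_gen _ _ i).
Qed.

Lemma rad_gt0 s x : x != 0 -> 0 < rad s x.
Proof. by move=> x0; rewrite powR_gt0// dotR_gt0. Qed.

Lemma rad2 x : rad 2 x = dotR x x.
Proof. by rewrite /rad divff// powRr1// dotR_ge0. Qed.

Lemma radD s s' x : x != 0 -> rad (s + s') x = rad s x * rad s' x.
Proof.
by move=> x0; rewrite /rad mulrDl powRD// dotR_eq0 x0 implybT.
Qed.

Lemma rad0 x : rad 0 x = 1.
Proof. by rewrite /rad mul0r powRr0. Qed.

Lemma rad_sphere s x : dotR x x = 1 -> rad s x = 1.
Proof. by rewrite /rad => ->; rewrite powR1. Qed.

Lemma phom_rad s : phom s (rad s).
Proof.
move=> c x c0 x0; rewrite /rad dotRZZ powRM ?sqr_ge0// ?dotR_ge0//.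
congr (_ * _); rewrite -powR_mulrn ?ltW// -powRrM; congr (_ `^ _).
by rewrite mulrC divfK.
Qed.

Lemma phomM s s' F G : phom s F -> phom s' G -> phom (s + s') (fun x => F x * G x).
Proof.
move=> hF hG c x c0 x0; rewrite hF// hG// powRD ?(gt_eqF c0) ?implybT//.
by rewrite mulrACA.
Qed.

Lemma hpoly_phom d F : hpoly d F -> phom d%:R F.
Proof. by move=> hF c x c0 _; rewrite (hpolyZ c x hF) powR_mulrn// ltW. Qed.

Lemma scale_neq0 (c : R) x : 0 < c -> x != 0 -> c *: x != 0.
Proof. by move=> c0 x0; rewrite scaler_eq0 negb_or gt_eqF. Qed.

Lemma rad_diff s x : x != 0 -> differentiable (rad s) x.
Proof.
move=> x0; apply: (@differentiable_comp R _ _ _ (fun x => dotR x x) (fun a => a `^ (s / 2))).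
  exact: hpoly_diff hpoly_sqr.
apply/derivable1_diffP.
by have [] := @is_derive1_powR R (s / 2) (dotR x x) _; rewrite ?dotR_gt0.
Qed.

Lemma rad_derive s x v : x != 0 -> 'D_v (rad s) x = s * dotR x v * rad (s - 2) x.
Proof.
move=> x0; rewrite derive_line.
(* [p] is [|x + h v|^2] as a polynomial in [h]. *)
pose p : {poly R} := (dotR x x)%:P + (2 * dotR x v) *: 'X + dotR v v *: 'X^2.
have -> : (fun h : R => rad s (h *: v + x)) = (fun a => a `^ (s / 2)) \o horner p.
  apply/funext => h; rewrite /rad /=; congr (_ `^ _).
  rewrite /p !hornerD !hornerZ hornerC hornerX hornerXn dotR_linl.
  rewrite dotRC dotR_linl [dotR x (_ + _)]dotRC dotR_linl [dotR v x]dotRC; ring.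
have p0 : p.[0] = dotR x x.
  by rewrite /p !hornerD !hornerZ hornerC hornerX hornerXn expr0n/= !mulr0 !addr0.
have px0 : 0 < p.[0] by rewrite p0 dotR_gt0.
have dpow := is_derive1_powR (s / 2) px0.
rewrite -derive1E derive1_comp; [|exact: derivable_horner|by case: dpow].
rewrite -derivE derive1E; case: dpow => _ ->; rewrite p0.
have -> : p^`().[0] = 2 * dotR x v.
  rewrite /p !derivD !derivZ derivC derivX derivXn /= add0r.
  by rewrite hornerD !hornerZ hornerC mulr1 hornerMn hornerX mul0rn mulr0 addr0.
rewrite /rad; have -> : (s - 2) / 2 = s / 2 - 1 by rewrite mulrBl divff.
by field.
Qed.

Lemma rad_psmooth s : psmooth (rad s).
Proof.
apply/psmoothP => n; elim: n s => [|n IH] s.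
  by split=> // x; exact: rad_diff.
split=> [x|v]; first exact: rad_diff.
apply: (@pCn_eq _ _ _ (fun x => (s * dotR x v) * rad (s - 2) x)).
  by move=> y y0; rewrite rad_derive.
apply: pCnM => //; move: n {IH}; apply/psmoothP.
exact/psmoothZ/hpoly_psmooth/hpoly_dotR.
Qed.

(** Differentiate [F ((1 + h) x) = (1 + h)^s F x] at [h = 0]; the identity holds as long as [1 + h]
    is positive, hence near 0. *)
Lemma euler s F x : phom s F -> psmooth F -> x != 0 ->
  \sum_i x 0 i * 'D_(ebasis R i) F x = s * F x.
Proof.
move=> hF sF x0; rewrite -(derive_ebasis _ (psmooth_diff sF x0)) derive_line.
have shift1 : (\forall h \near (0 : R), 0 < 1 + h).
  have : (-1 : R) < 0 by rewrite oppr_lt0.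
  by move=> /lt_nbhsr; apply: filterS => h; rewrite -subr_gt0 opprK addrC.
have -> : 'D_1 (fun h : R => F (h *: x + x)) 0 =
    'D_1 ((fun a => F x * a `^ s) \o horner (1 + 'X)) (0 : R).
  apply: near_eq_derive; near=> h => /=.
  rewrite hornerD hornerX hornerC -{2}[x]scale1r -scalerDl addrC hF 1?mulrC//.
  by near: h; exact: shift1.
have p0 : (1 + 'X : {poly R}).[0] = 1 by rewrite hornerD hornerX hornerC addr0.
have dpow : is_derive (1 : R) 1 (fun a => a `^ s) (s * 1 `^ (s - 1)).
  exact: is_derive1_powR.
have [dp vp] := dpow.
rewrite -derive1E derive1_comp; [|exact: derivable_horner|]; last first.
  by rewrite p0; exact: (derivableM (derivable_cst (F x) (1 : R) 1) dp).
rewrite -derivE derivD derivX derivC add0r hornerC mulr1 p0 derive1E.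
rewrite (derive_mul (derivable_cst (F x) (1 : R) 1) dp) derive_cst mul0r add0r vp.
by rewrite powR1 mulr1 mulrC.
Unshelve. all: by end_near. Qed.

Lemma phom_derive s F v : phom s F -> psmooth F -> phom (s - 1) ('D_v F).
Proof.
move=> hF sF c x c0 x0.
have dcx := psmooth_diff sF (scale_neq0 c0 x0).
have e1 : 'D_v (fun y => F (c *: y)) x = c * 'D_v F (c *: x).
  rewrite (@derive_linear_comp _ _ F (fun y => c *: y)) ?derive_dirZ// => a y z.
  by rewrite scalerDr !scalerA mulrC.
have e2 : 'D_v (fun y => F (c *: y)) x = c `^ s * 'D_v F x.
  rewrite -(pderiveZ _ _ sF x0); apply: derive_eqU => // y y0; exact: hF.
apply: (mulfI (lt0r_neq0 c0)); rewrite -e1 e2 mulrA; congr (_ * _).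
by rewrite powRB ?(gt_eqF c0) ?implybT// powRr1 ?ltW// mulrC divfK// gt_eqF.
Qed.

Lemma lap_eqU F G x : (forall y, y != 0 -> F y = G y) -> x != 0 -> lap F x = lap G x.
Proof.
move=> FG x0; apply: eq_bigr => i _; apply: derive_eqU => // y y0.
exact: derive_eqU.
Qed.

Lemma lap_lin a F G x : psmooth F -> psmooth G -> x != 0 ->
  lap (fun y => a * F y + G y) x = a * lap F x + lap G x.
Proof.
move=> sF sG x0; rewrite /lap mulr_sumr -big_split; apply: eq_bigr => i _ /=.
set e := ebasis R i.
have d1 y : y != 0 -> 'D_e (fun y => a * F y + G y) y = a * 'D_e F y + 'D_e G y.
  by move=> y0; apply: derive_lin; exact: psmooth_der.
rewrite (derive_eqU _ d1 x0); apply: derive_lin.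
  exact/psmooth_der/x0/psmoothD1.
exact/psmooth_der/x0/psmoothD1.
Qed.

Lemma lap_phom s F : phom s F -> psmooth F -> phom (s - 2) (lap F).
Proof.
move=> hF sF c x c0 x0; rewrite /lap mulr_sumr; apply: eq_bigr => i _.
have -> : s - 2 = s - 1 - 1 by lra.
by rewrite (phom_derive (ebasis R i) (phom_derive (ebasis R i) hF sF) (psmoothD1 _ sF)).
Qed.

Lemma derive_radM s u x v : psmooth u -> x != 0 ->
  'D_v (fun y => rad s y * u y) x =
  s * (dotR x v * (rad (s - 2) x * u x)) + rad s x * 'D_v u x.
Proof.
move=> su x0; rewrite (pderiveM _ (@rad_psmooth s) su x0) rad_derive//.
by rewrite !mulrA.
Qed.

(** The cross terms add up to Euler's sum. The constant is the source of the eigenvalues: it is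
    [s (s + N - 2)] for [sigma = 0] and [- sigma (sigma + N - 2)] for [s = - sigma]. *)
Lemma lap_radM s sigma u x : psmooth u -> phom sigma u -> x != 0 ->
  lap (fun y => rad s y * u y) x =
  rad s x * lap u x + s * (s + N%:R - 2 + 2 * sigma) * (rad (s - 2) x * u x).
Proof.
move=> su hu x0.
have rM s' : psmooth (fun y => rad s' y * u y).
  by apply: psmoothM => //; exact: rad_psmooth.
have dM i : 'D_(ebasis R i) ('D_(ebasis R i) (fun y => rad s y * u y)) x =
    s * (rad (s - 2) x * u x) + s * (s - 2) * (x 0 i * x 0 i) * (rad (s - 4) x * u x)
    + 2 * s * rad (s - 2) x * (x 0 i * 'D_(ebasis R i) u x)
    + rad s x * 'D_(ebasis R i) ('D_(ebasis R i) u) x.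
  set e := ebasis R i.
  have d1 y : y != 0 -> 'D_e (fun y => rad s y * u y) y =
      s * (dotR y e * (rad (s - 2) y * u y)) + rad s y * 'D_e u y.
    exact: derive_radM.
  rewrite (derive_eqU _ d1 x0).
  have sdot : psmooth (fun y => dotR y e) by exact/hpoly_psmooth/hpoly_dotR.
  rewrite pderiveD//; last first.
  - by apply: psmoothM; [exact: rad_psmooth|exact: psmoothD1].
  - by apply: psmoothZ; exact: psmoothM.
  rewrite pderiveZ//; last exact: psmoothM.
  rewrite pderiveM// (@derive_radM _ _ _ _ su x0) (@derive_radM _ _ _ _ (psmoothD1 e su) x0).
  have -> : 'D_e (fun y => dotR y e) x = 1.
    rewrite (_ : (fun y => dotR y e) = fun y => y 0 i).
      by rewrite coord_derive mxE !eqxx.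
    by apply/funext => y; rewrite dotR_ebasis.
  rewrite dotR_ebasis; have -> : s - 2 - 2 = s - 4 by lra.
  ring.
rewrite [LHS](eq_bigr _ (fun i _ => dM i)) {dM} !big_split/=.
rewrite -[X in _ + _ + _ + X]mulr_sumr -/(lap u x).
rewrite -[X in _ + _ + X + _]mulr_sumr (euler hu su x0).
rewrite -[X in _ + X + _ + _]mulr_suml -[X in _ + X * _ + _ + _]mulr_sumr.
rewrite -/(dotR x x) sumr_const card_ord.
rewrite -[X in X + _ + _ + _]mulr_natl.
have -> : rad (s - 2) x = dotR x x * rad (s - 4) x.
  by rewrite -rad2 -radD//; congr (rad _ _); lra.
ring.
Qed.

End Radial.

(** * Mean values along lines and the symmetry of second derivatives *)

Section Schwarz.
Variables (R : realType) (N : nat).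
Local Notation V := 'rV[R]_N.
Implicit Types (F G u : V -> R) (x y v w z : V) (s : R).

Lemma is_derive_line F v z s : differentiable F (s *: v + z) ->
  is_derive s 1 (fun a : R => F (a *: v + z)) ('D_v F (s *: v + z)).
Proof.
move=> dF; have /derivableP[dv _] := @diff_derivable R _ R _ _ v dF.
have e1 : (fun h : R => h^-1 *: (((fun a => F (a *: v + z)) \o shift s) (h *: 1) -
      F (s *: v + z))) =
    (fun h : R => h^-1 *: ((F \o shift (s *: v + z)) (h *: v) - F (s *: v + z))).
  by apply/funext => h /=; rewrite [_%:A]mulr1 scalerDl addrA.
by split; rewrite /derivable /derive e1.
Qed.

Lemma line_mvt F v z (h : R) : 0 < h ->
  (forall s, 0 <= s <= h -> differentiable F (s *: v + z)) ->
  exists2 xi : R, 0 < xi < h & F (h *: v + z) - F z = 'D_v F (xi *: v + z) * h.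
Proof.
move=> h0 dF.
pose f a := F (a *: v + z).
have der s : s \in `[0, h] -> is_derive s 1 f ('D_v F (s *: v + z)).
  by rewrite in_itv /= => /dF; exact: is_derive_line.
have der' s : s \in `]0, h[ -> is_derive s 1 f ('D_v F (s *: v + z)).
  by rewrite in_itv/= => /andP[s0 sh]; apply: der; rewrite in_itv/= !ltW.
have cf : {within `[0, h], continuous f}.
  by apply: derivable_within_continuous => s /der[].
have [xi xih] := MVT h0 der' cf.
rewrite subr0 /f scale0r add0r => ->; exists xi => //.
Qed.

Lemma derive_shift_arg F v x c : 'D_v (fun y => F (c + y)) x = 'D_v F (c + x).
Proof.
rewrite /derive; set g1 := fun h => h^-1 *: _; set g2 := fun h => h^-1 *: _.
suff -> : g1 = g2 by [].
by apply/funext => h; rewrite /g1 /g2 /= addrCA.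
Qed.

Lemma differentiable_shift_arg F x c : differentiable F (c + x) ->
  differentiable (fun y => F (c + y)) x.
Proof.
move=> dF; apply: (@differentiable_comp R _ _ _ (fun y => c + y) F) => //.
Qed.

Lemma near_plane (P : V -> Prop) x v w : (\forall y \near x, P y) ->
  exists2 d : R, 0 < d & forall s t : R, 0 <= s <= d -> 0 <= t <= d -> P (s *: v + (t *: w + x)).
Proof.
move=> /nbhs_ballP[e /= e0 eP].
have D0 : 0 < `|v| + `|w| + 1 by rewrite ltr_wpDl// addr_ge0.
(* The added 1 keeps the denominator positive when [v = w = 0] and makes the final inequality
   strict. *)
exists (e / (`|v| + `|w| + 1)); first exact: divr_gt0.
move=> s t /andP[s0 sd] /andP[t0 td]; apply: eP.
rewrite -ball_normE /= addrA opprD addrCA subrr addr0 normrN.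
apply: (le_lt_trans (ler_normD _ _)); rewrite !normrZ !ger0_norm//.
apply: (@le_lt_trans _ _ (e / (`|v| + `|w| + 1) * (`|v| + `|w|))).
  by rewrite mulrDr lerD// ler_wpM2r.
by rewrite mulrAC ltr_pdivrMr// ltr_pM2l// ltrDl.
Qed.

(** Mean value theorem along [v] for the increment of [F] by [d w], then along [w] for ['D_v F]. *)
Lemma second_difference F x v w (d : R) : 0 < d ->
  (forall s t : R, 0 <= s <= d -> 0 <= t <= d -> s *: v + (t *: w + x) != 0) ->
  psmooth F ->
  exists s t : R, [/\ 0 <= s <= d, 0 <= t <= d &
    F (d *: w + (d *: v + x)) - F (d *: v + x) - (F (d *: w + x) - F x) =
    'D_w ('D_v F) (s *: v + (t *: w + x)) * d * d].
Proof.
move=> d0 U sF.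
have d0d : 0 <= (0 : R) <= d by apply/andP; split=> //; exact: ltW.
have ddd : 0 <= d <= d by apply/andP; split=> //; exact: ltW.
pose G y := F (d *: w + y) - F y.
have dsh s : 0 <= s <= d -> differentiable F (s *: v + x).
  move=> sd; apply: psmooth_diff => //.
  by have := U s 0 sd d0d; rewrite scale0r add0r.
have dsh' s : 0 <= s <= d -> differentiable (fun y => F (d *: w + y)) (s *: v + x).
  move=> sd; apply: differentiable_shift_arg; apply: psmooth_diff => //.
  by rewrite addrCA; exact: U.
have dG s : 0 <= s <= d -> differentiable G (s *: v + x).
  by move=> sd; apply: differentiableB; [exact: dsh'|exact: dsh].
have [s sd Gs] := line_mvt d0 dG.
have {}sd : 0 <= s <= d by move/andP: sd => [/ltW-> /ltW->].
have DG : 'D_v G (s *: v + x) =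
    'D_v F (d *: w + (s *: v + x)) - 'D_v F (s *: v + x).
  rewrite -(derive_shift_arg F v (s *: v + x) (d *: w)).
  exact: (deriveB (@diff_derivable R _ R _ _ v (dsh' s sd))
    (@diff_derivable R _ R _ _ v (dsh s sd))).
have [|t td Ft] := @line_mvt ('D_v F) w (s *: v + x) d d0.
  by move=> t td; apply: psmooth_diff; [exact: psmoothD1|rewrite addrCA; exact: U].
exists s, t; split => //; first by move/andP: td => [/ltW-> /ltW->].
by rewrite -[LHS]/(G (d *: v + x) - G x) Gs DG Ft addrCA.
Qed.

(** The second difference is symmetric in [v] and [w], so the two mixed derivatives agree at a pair
    of points arbitrarily close to [x]; continuity does the rest. *)
Lemma psmooth_schwarz F x v w : psmooth F -> x != 0 ->
  'D_v ('D_w F) x = 'D_w ('D_v F) x.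
Proof.
move=> sF x0; apply/eqP; rewrite -subr_eq0 -normr_le0; apply/ler_addgt0Pr => e e0.
rewrite add0r.
have e20 : 0 < e / 2 by rewrite divr_gt0.
have c1 : {for x, continuous ('D_v ('D_w F))}.
  by apply: differentiable_continuous; apply: psmooth_diff => //; do 2 apply: psmoothD1.
have c2 : {for x, continuous ('D_w ('D_v F))}.
  by apply: differentiable_continuous; apply: psmooth_diff => //; do 2 apply: psmoothD1.
have n1 : \forall y \near x, `|'D_v ('D_w F) x - 'D_v ('D_w F) y| < e / 2.
  by move/cvgrPdist_lt : c1 => /(_ _ e20).
have n2 : \forall y \near x, `|'D_w ('D_v F) x - 'D_w ('D_v F) y| < e / 2.
  by move/cvgrPdist_lt : c2 => /(_ _ e20).
have [d d0 dP] := near_plane v w (filterI (near_neq0 x0) (filterI n1 n2)).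
have [s [t [sd td F1]]] : exists s t, [/\ 0 <= s <= d, 0 <= t <= d &
    F (d *: w + (d *: v + x)) - F (d *: v + x) - (F (d *: w + x) - F x) =
    'D_w ('D_v F) (s *: v + (t *: w + x)) * d * d].
  by apply: second_difference => // s t sd td; have [] := dP s t sd td.
have [t' [s' [td' sd' F2]]] : exists t s, [/\ 0 <= t <= d, 0 <= s <= d &
    F (d *: v + (d *: w + x)) - F (d *: w + x) - (F (d *: v + x) - F x) =
    'D_v ('D_w F) (t *: w + (s *: v + x)) * d * d].
  by apply: second_difference => // a b ad bd; rewrite addrCA; have [] := dP b a bd ad.
have eqD : 'D_w ('D_v F) (s *: v + (t *: w + x)) = 'D_v ('D_w F) (t' *: w + (s' *: v + x)).
  apply: (mulIf (lt0r_neq0 d0)); apply: (mulIf (lt0r_neq0 d0)).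
  have swap : d *: w + (d *: v + x) = d *: v + (d *: w + x) by exact: addrCA.
  apply: (etrans (esym F1)); apply: (etrans _ F2).
  rewrite swap.
  move: (F (_ + _)) (F (d *: v + x)) (F (d *: w + x)) (F x) => f1 f2 f3 f4.
  ring.
have [_ [_ b2]] := dP s t sd td.
have [_ [b1 _]] := dP s' t' sd' td'.
rewrite addrCA -eqD in b1.
move: ('D_v ('D_w F) x) ('D_w ('D_v F) x) ('D_w ('D_v F) _) b1 b2 => a b c b1 b2.
have h := ler_distD c a b; rewrite [`|c - b|]distrC in h.
apply: (le_trans h); rewrite (splitr e); apply: lerD; exact: ltW.
Qed.

End Schwarz.

(** * Harmonic functions *)

Section Harmonic.
Variables (R : realType) (N : nat).
Local Notation V := 'rV[R]_N.
Implicit Types (F G u : V -> R) (x y v w z : V) (s : R).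

(** If the second derivative were positive, it would be so on a segment around [x]. Mean values on
    the two halves give a nonnegative slope behind [x] and a nonpositive one ahead of it, but the
    slope increases. *)
Lemma derive2_max F x v : psmooth F -> x != 0 ->
  (forall y, y != 0 -> F y <= F x) -> 'D_v ('D_v F) x <= 0.
Proof.
move=> sF x0 Fmax; rewrite leNgt; apply/negP => D2.
have cD2 : {for x, continuous ('D_v ('D_v F))}.
  by apply: differentiable_continuous; apply: psmooth_diff => //; do 2 apply: psmoothD1.
have nD2 : \forall y \near x, 0 < 'D_v ('D_v F) y.
  have := cvgr_gt ('D_v ('D_v F) x) cD2 _ D2; exact.
(* With the directions [v] and [- v] the quadrant of [near_plane] degenerates to a segment on both
   sides of [x]. *)
have [d d0 dP] := near_plane v (- v) (filterI (near_neq0 x0) nD2).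
have h0 : 0 < d / 2 by rewrite divr_gt0.
have hd : d / 2 + d / 2 = d by rewrite -splitr.
have d0d : 0 <= (0 : R) <= d by apply/andP; split=> //; exact: ltW.
have ptN (s t : R) : 0 <= s <= d -> 0 <= t <= d -> s *: v + (t *: - v + x) != 0.
  by move=> sd td; have [] := dP s t sd td.
have in_d (a : R) : 0 <= a <= d / 2 -> 0 <= a <= d.
  by move=> /andP[-> ah]/=; rewrite (le_trans ah)// -{2}hd lerDl ltW.
have pt1 s : 0 <= s <= d / 2 -> s *: v + x != 0.
  by move=> /in_d sd; have := ptN s 0 sd d0d; rewrite scale0r add0r.
have pt2 s : 0 <= s <= d / 2 -> s *: - v + x != 0.
  by move=> /in_d sd; have := ptN 0 s d0d sd; rewrite scale0r add0r.
have hh : 0 <= d / 2 <= d / 2 by apply/andP; split=> //; exact: ltW.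
have [|a /andP[a0 ah] Fa] := @line_mvt R N F v x (d / 2) h0.
  by move=> s sh; apply: psmooth_diff => //; exact: pt1.
have [|b /andP[b0 bh] Fb] := @line_mvt R N F (- v) x (d / 2) h0.
  by move=> s sh; apply: psmooth_diff => //; exact: pt2.
have Da : 'D_v F (a *: v + x) <= 0.
  by rewrite -(pmulr_lle0 _ h0) -Fa subr_le0 Fmax// pt1.
have Db : 0 <= 'D_v F (b *: - v + x).
  have bh' : 0 <= b <= d / 2 by rewrite (ltW b0) (ltW bh).
  have dFb := psmooth_diff sF (pt2 b bh').
  have : 'D_(- v) F (b *: - v + x) <= 0.
    by rewrite -(pmulr_lle0 _ h0) -Fb subr_le0 Fmax// pt2.
  have := @derive_dirZ R N F _ v (-1) dFb.
  by rewrite scaleN1r mulN1r => ->; rewrite oppr_le0.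
have ab0 : 0 < a + b by rewrite addr_gt0.
have sum_d s : 0 <= s <= a + b -> 0 <= s <= d.
  move=> /andP[-> sab]/=; rewrite (le_trans sab)// -hd; apply: lerD; exact: ltW.
have bd : 0 <= b <= d by apply: in_d; rewrite (ltW b0) (ltW bh).
have [|c /andP[c0 cab] Dc] := @line_mvt R N ('D_v F) v (b *: - v + x) (a + b) ab0.
  move=> s sab; apply: psmooth_diff; first exact: psmoothD1.
  by apply: ptN => //; exact: sum_d.
have cd : 0 <= c <= d by apply: sum_d; rewrite (ltW c0) (ltW cab).
have [_ D2c] := dP c b cd bd.
have eab : (a + b) *: v + (b *: - v + x) = a *: v + x.
  by rewrite scalerDl scalerN addrA addrK.
have : 0 < 'D_v F ((a + b) *: v + (b *: - v + x)) - 'D_v F (b *: - v + x).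
  by rewrite Dc mulr_gt0.
rewrite eab subr_gt0 => /lt_le_trans/(_ Da).
by rewrite ltNge Db.
Qed.

Lemma sphere_compact : compact (@sphere R N).
Proof.
apply: (@subclosed_compact _ _ [set v : V | forall i, (v ord0 i) \in `[-1 : R, 1]]).
- apply: (@preimage_closed _ _ (fun x : V => dotR x x) [set (1 : R)]) => //.
  by move=> x _; apply: differentiable_continuous; exact: hpoly_diff (hpoly_sqr _ _).
- by apply: (@rV_compact _ _ (fun=> `[(-1 : R), 1]%classic)) => i; exact: segment_compact.
- move=> x Sx i; rewrite /= in_itv /= -ler_norml -(@ler_sqr _ _ 1) ?nnegrE//.
  rewrite expr1n real_normK ?num_real// -Sx /dotR (bigD1 i)//= -expr2 lerDl.
  by apply: sumr_ge0 => j _; rewrite -expr2 sqr_ge0.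
Qed.

Lemma phom0_sphere F y : phom 0 F -> y != 0 -> F y = F (normalize y).
Proof.
move=> hF y0; rewrite /normalize hF ?powRr0 ?mul1r// invr_gt0 sqrtr_gt0 dotR_gt0//.
Qed.

Lemma sphere_normalize y : y != 0 -> sphere (normalize y).
Proof.
move=> y0; rewrite /sphere /= /normalize dotRZZ exprVn sqr_sqrtr ?dotR_ge0//.
by rewrite mulVf// dotR_eq0.
Qed.

Lemma sphere_neq0 y : sphere y -> y != 0.
Proof.
by rewrite /sphere /= => Sy; rewrite -dotR_eq0 Sy oner_eq0.
Qed.

(* Maximum principle: at its maximum over the sphere, [F] has a nonpositive
   Laplacian. *)
Lemma phom0_lap_le0 mu F x : psmooth F -> phom 0 F -> 0 < mu ->
  (forall y, sphere y -> lap F y = mu * F y) -> x != 0 -> F x <= 0.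
Proof.
move=> sF pF mu0 lF x0.
have [||p] := @EVT_max_rV R N F (@sphere R N) _ sphere_compact.
- by exists (normalize x); exact: sphere_normalize.
- apply: continuous_in_subspaceT => y; rewrite inE => Sy.
  by apply: differentiable_continuous; apply: psmooth_diff => //; exact: sphere_neq0.
rewrite inE => Sp Fp; have p0 := sphere_neq0 Sp.
(* Degree 0 turns a maximum over the sphere into one over the punctured space, where every direction
   may be tested. *)
have Fmax y : y != 0 -> F y <= F p.
  move=> y0; rewrite (phom0_sphere pF y0); apply: Fp; rewrite inE.
  exact: sphere_normalize.
apply: (le_trans (Fmax x x0)); rewrite -(pmulr_rle0 _ mu0) -lF//.
by apply: sumr_le0 => i _; exact: derive2_max.
Qed.

(** [r^(-s) u] has degree 0, and on the sphere its Laplacian is [- s (s + N - 2)] times itself, a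
    positive multiple, so the maximum principle applies. *)
Lemma harmonic_neg_le0 s u x : psmooth u -> (forall y, y != 0 -> lap u y = 0) ->
  phom s u -> s * (s + N%:R - 2) < 0 -> x != 0 -> u x <= 0.
Proof.
move=> su hu pu sN x0; pose F y := rad (- s) y * u y.
have sF : psmooth F by apply: psmoothM => //; exact: rad_psmooth.
have pF : phom 0 F.
  by have := phomM (@phom_rad R N (- s)) pu; rewrite addNr.
have : F x <= 0.
  apply: (phom0_lap_le0 (mu := - (s * (s + N%:R - 2))) sF pF _ _ x0).
    by rewrite oppr_gt0.
  move=> p Sp; have p0 := sphere_neq0 Sp.
  rewrite (lap_radM _ su pu p0) hu// /F !rad_sphere//; ring.
by rewrite pmulr_rle0// rad_gt0.
Qed.

Lemma harmonic_neg_eq0 s u x : psmooth u -> (forall y, y != 0 -> lap u y = 0) ->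
  phom s u -> s * (s + N%:R - 2) < 0 -> x != 0 -> u x = 0.
Proof.
move=> su hu pu sN x0; apply/eqP; rewrite eq_le (harmonic_neg_le0 su hu pu sN x0)/=.
rewrite -oppr_le0 -mulN1r.
apply: (@harmonic_neg_le0 s (fun y => -1 * u y) x _ _ _ sN x0).
- exact: psmoothZ.
- move=> y y0.
  have := lap_lin (-1) su (@psmooth_cst R N 0) y0.
  have -> : lap (fun _ : V => 0) y = 0.
    by rewrite /lap big1// => i _; under eq_fun do rewrite derive_cst; rewrite derive_cst.
  rewrite hu// mulr0 addr0 => <-; apply: lap_eqU => // z _.
  by rewrite addr0.
- by move=> c y c0 y0; rewrite pu// mulrCA.
Qed.

Lemma psmooth_segment F x y : psmooth F -> (forall v z, z != 0 -> 'D_v F z = 0) ->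
  (forall s, 0 <= s <= 1 -> s *: (y - x) + x != 0) -> F x = F y.
Proof.
move=> sF DF0 seg.
have [|xi /andP[xi0 xi1]] := @line_mvt R N F (y - x) x 1 ltr01.
  by move=> s s1; apply: psmooth_diff => //; exact: seg.
rewrite DF0 ?mul0r; last by apply: seg; rewrite !ltW.
by rewrite scale1r subrK => /eqP; rewrite subr_eq0 => /eqP.
Qed.

(** If the segment from [x] to [y] meets the origin, the path goes through a basis vector [e_j]
    instead, where [j] differs from a coordinate [i] in which [x] and [y] are nonzero. *)
Lemma psmooth_const F x y : (1 < N)%N -> psmooth F ->
  (forall v z, z != 0 -> 'D_v F z = 0) -> x != 0 -> y != 0 -> F x = F y.
Proof.
move=> N1 sF DF0 x0 y0.
have [seg|] := pselect (forall s, 0 <= s <= 1 -> s *: (y - x) + x != 0).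
  exact: psmooth_segment.
move=> /existsNP[s /not_implyP[/andP[s0 s1] /negP]]; rewrite negbK => /eqP sxy.
have [i xi] : exists i, x 0 i != 0.
  by apply/existsP; apply: contraR x0 => /existsPn x0; apply/eqP/rowP => j; rewrite mxE; apply/eqP; have := x0 j; rewrite negbK.
have yi : y 0 i != 0.
  apply: contra y0 => /eqP yi; have := congr1 (fun z : V => z 0 i) sxy.
  rewrite !mxE yi sub0r mulrN -{2}[x 0 i]mul1r addrC -mulrBl => /eqP.
  rewrite mulf_eq0 (negbTE xi) orbF subr_eq0 => /eqP s1'.
  by move: sxy; rewrite -s1' scale1r subrK => ->.
have [j ji] : exists j : 'I_N, j != i.
  have [i0|i0] := eqVneq (val i) 0%N.
    by exists (Ordinal N1); rewrite -val_eqE/= i0.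
  by exists (Ordinal (ltnW N1)); rewrite -val_eqE/= eq_sym.
have seg z : z 0 i != 0 -> F z = F (ebasis R j).
  move=> zi; apply: psmooth_segment => // t t01; apply/eqP => tz.
  have := congr1 (fun z : V => z 0 i) tz; rewrite !mxE eq_sym (negbTE ji) andbF sub0r.
  rewrite mulrN -{2}[z 0 i]mul1r addrC -mulrBl => /eqP.
  rewrite mulf_eq0 (negbTE zi) orbF subr_eq0 => /eqP t1.
  have := congr1 (fun z : V => z 0 j) tz; rewrite -t1 scale1r subrK !mxE !eqxx.
  by move/eqP; rewrite oner_eq0.
by rewrite seg// seg.
Qed.

Lemma lap_derive0 u v : psmooth u -> (forall y, y != 0 -> lap u y = 0) ->
  forall y, y != 0 -> lap ('D_v u) y = 0.
Proof.
move=> su hu y y0; rewrite /lap.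
transitivity ('D_v (lap u) y); last first.
  by rewrite (derive_eqU _ hu y0) derive_cst.
pose H i := 'D_(ebasis R i) ('D_(ebasis R i) u).
have sH i : psmooth (H i) by do 2 apply: psmoothD1.
rewrite [RHS](@pderive_sum R N _ H y v sH y0); apply: eq_bigr => i _.
have S := @psmooth_schwarz R N _ y v (ebasis R i) (psmoothD1 (ebasis R i) su) y0.
have T := @derive_eqU R N _ _ y (ebasis R i)
  (fun z nz => @psmooth_schwarz R N u z (ebasis R i) v su nz) y0.
exact: (etrans T (esym S)).
Qed.

(* Differentiating lowers the degree of a homogeneous harmonic function until it
   becomes negative; Euler's identity then climbs back up. *)
Lemma harmonic_polynomial (j : nat) s u : (3 < N)%N ->
  psmooth u -> (forall y, y != 0 -> lap u y = 0) -> phom s u -> -1 <= s < j%:R ->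
  (exists d P, [/\ s = d%:R, hpoly d P & forall x, x != 0 -> u x = P x]) \/
  (forall x, x != 0 -> u x = 0).
Proof.
move=> N3; have N4 : 4 <= N%:R :> R by rewrite ler_nat.
(* For [N >= 4] and [s' >= -1] the factor [s' + N - 2] is positive. A derivative of a function of
   degree at least 0 has degree at least -1, so the recursion stops inside this range. *)
have neg s' : -1 <= s' -> s' < 0 -> s' * (s' + N%:R - 2) < 0.
  by move=> s1 s0; rewrite nmulr_rlt0//; lra.
elim: j s u => [|j IH] s u su hu pu /andP[s1 sj].
  by right=> x x0; apply: harmonic_neg_eq0 pu _ x0 => //; exact: neg.
have [s0|s0|s0] := ltgtP s 0.
- by right=> x x0; apply: harmonic_neg_eq0 pu _ x0 => //; exact: neg.
- have Di i := IH (s - 1) ('D_(ebasis R i) u) (psmoothD1 _ su) (lap_derive0 _ su hu)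
    (phom_derive _ pu su).
  have s1j : -1 <= s - 1 < j%:R.
    by rewrite -natr1 in sj; apply/andP; split; lra.
  have Eu x : x != 0 -> u x = s^-1 * \sum_i x 0 i * 'D_(ebasis R i) u x.
    by move=> x0; rewrite (euler pu su x0) mulKf// gt_eqF.
  have [[d sd]|nd] := pselect (exists d : nat, s - 1 = d%:R).
    have /choice[P PD] : forall i, exists P, hpoly d P /\
        forall x, x != 0 -> 'D_(ebasis R i) u x = P x.
      move=> i; have [[d' [P [sd' gP uP]]]|D0] := Di i s1j.
        exists P; split => //; move: sd'; rewrite sd => /eqP; rewrite eqr_nat.
        by move=> /eqP ->.
      by exists (fun=> 0); split => //; exact: gpoly_zero.
    left; exists d.+1, (fun x => s^-1 * \sum_i x 0 i * P i x); split.
    + by rewrite -natr1 -sd subrK.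
    + apply: gpolyZ; apply: gpoly_sum => i _.
      exact: (gpoly_mulgen (e := fun (i : 'I_N) (x : V) => x 0 i)) (PD i).1.
    + move=> x x0; rewrite Eu//; congr (_ * _); apply: eq_bigr => i _.
      by rewrite (PD i).2.
  (* When [s - 1] is not a natural number, every partial derivative vanishes by induction, and
     Euler's identity kills [u]. This is how integrality of the degree comes out. *)
  right=> x x0; rewrite Eu// big1 ?mulr0// => i _.
  have [[d' [P [sd' _ _]]]|->//] := Di i s1j; last by rewrite mulr0.
  by case: nd; exists d'.
(* In degree 0 the derivatives have degree -1, hence vanish, and [u] is constant. *)
- have Dv0 v z : z != 0 -> 'D_v u z = 0.
    move=> z0; apply: (@harmonic_neg_eq0 (s - 1) ('D_v u) z _ _ _ _ z0).
    + exact: (psmoothD1 v su).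
    + exact: (@lap_derive0 u v su hu).
    + exact: (@phom_derive R N s u v pu su).
    + by apply: neg; rewrite s0; lra.
  left; exists 0%N, (fun=> u (ebasis R (Ordinal (ltnW (ltnW (ltnW N3)))))); split.
  + by rewrite s0.
  + exact: gpoly_cst.
  + move=> x x0; apply: psmooth_const => //; first by rewrite (ltn_trans _ N3).
    by rewrite -dotR_eq0 dotR_ebasis mxE !eqxx oner_eq0.
Qed.

End Harmonic.

(** * Invariant harmonic polynomials modulo the squared norm *)

Section HarmonicDecomposition.
Variables (R : realType) (N : nat).
Local Notation V := 'rV[R]_N.
Implicit Types (F G u h P : V -> R) (x y v w z : V) (L : V -> V).

Definition orth_map L := (forall a y z, L (a *: y + z) = a *: L y + L z) /\
  (forall x y, dotR (L x) (L y) = dotR x y).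

Lemma orth_map0 L : orth_map L -> L 0 = 0.
Proof.
move=> [linL _]; have := linL 1 0 0; rewrite !scale1r addr0 => /eqP.
by rewrite -subr_eq subrr eq_sym => /eqP.
Qed.

Lemma orth_mapZ L a x : orth_map L -> L (a *: x) = a *: L x.
Proof. by move=> oL; rewrite -[a *: x]addr0 oL.1 (orth_map0 oL) addr0. Qed.

Lemma orth_map_neq0 L x : orth_map L -> x != 0 -> L x != 0.
Proof. by move=> [_ dL]; rewrite -!dotR_eq0 dL. Qed.

Lemma orth_map_normalize L x : orth_map L -> normalize (L x) = L (normalize x).
Proof. by move=> oL; rewrite /normalize oL.2 orth_mapZ. Qed.

Lemma dotR_mx x y : (x *m y^T) 0 0 = dotR x y.
Proof. by rewrite mxE; apply: eq_bigr => i _; rewrite mxE. Qed.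

(** The images of the basis are the orthonormal rows of a square matrix, so its columns are
    orthonormal too. *)
Lemma orth_map_cols L j l : orth_map L ->
  \sum_i L (ebasis R i) 0 j * L (ebasis R i) 0 l = (j == l)%:R.
Proof.
move=> [_ dL]; pose M : 'M[R]_N := \matrix_(i, j) L (ebasis R i) 0 j.
have : M *m M^T = 1%:M.
  apply/matrixP => a b; rewrite mxE [RHS]mxE.
  transitivity (dotR (L (ebasis R a)) (L (ebasis R b))).
    by apply: eq_bigr => i _; rewrite !mxE.
  by rewrite dL dotR_ebasis mxE eqxx /= eq_sym.
move=> /mulmx1C /matrixP/(_ j l); rewrite mxE [in RHS]mxE => <-.
by apply: eq_bigr => i _; rewrite !mxE.
Qed.

Lemma orth_map_trace L (K : 'I_N -> 'I_N -> R) : orth_map L ->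
  \sum_i \sum_j \sum_l (L (ebasis R i) 0 j * L (ebasis R i) 0 l) * K j l =
  \sum_j K j j.
Proof.
move=> oL; rewrite exchange_big; apply: eq_bigr => j _.
have e l : \sum_i (L (ebasis R i) 0 j * L (ebasis R i) 0 l) * K j l =
    (j == l)%:R * K j l by rewrite -mulr_suml (orth_map_cols _ _ oL).
rewrite exchange_big (eq_bigr _ (fun l _ => e l)) (bigD1 j)//= eqxx mul1r.
by rewrite big1 ?addr0// => l lj; rewrite eq_sym (negbTE lj) mul0r.
Qed.

(** The Laplacian is the trace of the Hessian, which is the same in every orthonormal basis. *)
Lemma lap_orth L F x : orth_map L -> psmooth F -> x != 0 ->
  lap (fun y => F (L y)) x = lap F (L x).
Proof.
move=> oL sF x0; have Lx0 := orth_map_neq0 oL x0.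
pose f i := L (ebasis R i); pose D i := 'D_(ebasis R i) F.
have sD i : psmooth (D i) by exact: psmoothD1.
have DD i : 'D_(ebasis R i) ('D_(ebasis R i) (fun y => F (L y))) x =
    \sum_j \sum_l (f i 0 j * f i 0 l) * 'D_(ebasis R l) (D j) (L x).
  have e1 : 'D_(ebasis R i) (fun y => F (L y)) = fun y => 'D_(f i) F (L y).
    by apply/funext => y; exact: (derive_linear_comp F y (ebasis R i) oL.1).
  rewrite e1 (derive_linear_comp ('D_(f i) F) x (ebasis R i) oL.1) -/(f i).
  have e2 y : y != 0 -> 'D_(f i) F y = \sum_j f i 0 j * D j y.
    by move=> y0; exact: (derive_ebasis _ (psmooth_diff sF y0)).
  have sZ j : psmooth (fun y => f i 0 j * D j y) by exact: psmoothZ.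
  rewrite (derive_eqU _ e2 Lx0) (pderive_sum _ sZ Lx0); apply: eq_bigr => j _.
  rewrite (pderiveZ _ _ (sD j) Lx0) (derive_ebasis _ (psmooth_diff (sD j) Lx0)).
  by rewrite mulr_sumr; apply: eq_bigr => l _; rewrite mulrA.
rewrite [LHS](eq_bigr _ (fun i _ => DD i)) {DD}.
exact: (orth_map_trace (fun j l => 'D_(ebasis R l) (D j) (L x)) oL).
Qed.

Lemma lap_hpoly d P : hpoly d P -> hpoly (d - 2) (lap P).
Proof.
move=> gP; apply: gpoly_sum => i _; have := hpoly_derive (ebasis R i) gP.
case: d gP => [_ /= D0|[_ /= gD|d _ /= gD]].
- rewrite (_ : 'D__ _ = fun=> 0); first exact: gpoly_zero.
  by rewrite D0; apply/funext => x; rewrite derive_cst.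
- have /= D0 := hpoly_derive (ebasis R i) gD.
  by rewrite (_ : 'D__ _ = fun=> 0); [exact: gpoly_zero|exact: D0].
- by rewrite !subSS subn0; have := hpoly_derive (ebasis R i) gD.
Qed.

Lemma lap_hpoly0 d P x : (d < 2)%N -> hpoly d P -> lap P x = 0.
Proof.
move=> d2 gP; rewrite /lap big1// => i _; have := hpoly_derive (ebasis R i) gP.
case: d d2 gP => [_ _ /= D0|[_ _ /= gD|//]].
  by rewrite D0 derive_cst.
exact: (congr1 (fun f => f x) (hpoly_derive (ebasis R i) gD)).
Qed.

Lemma lap_sqrM d h x : hpoly d h -> x != 0 ->
  lap (fun y => dotR y y * h y) x =
  dotR x x * lap h x + 2 * (N%:R + 2 * d%:R) * h x.
Proof.
move=> gh x0; have := lap_radM 2 (hpoly_psmooth gh) (hpoly_phom gh) x0.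
rewrite subrr rad0 mul1r rad2.
have -> : 2 + N%:R - 2 + 2 * d%:R = N%:R + 2 * d%:R :> R by ring.
move=> <-; by apply: lap_eqU => // y _; rewrite rad2.
Qed.

Section Invariant.
Variable S : set (V -> V).
Hypothesis S_orth : forall L, S L -> orth_map L.

Definition invariant F := forall L x, S L -> F (L x) = F x.

Lemma lap_invariant d h : hpoly d h -> invariant h -> invariant (lap h).
Proof.
move=> gh ih L x SL; have oL := S_orth SL.
have [->|x0] := eqVneq x 0; first by rewrite (orth_map0 oL).
rewrite -(lap_orth oL (hpoly_psmooth gh) x0); apply: lap_eqU => // y _; exact: ih.
Qed.

Lemma sqr_invariant : invariant (fun x => dotR x x).
Proof. by move=> L x /S_orth[_ ->]. Qed.

(** Put [g = lap h]. Applying [lap] to the equation gives [|x|^2 lap g + (c + 2 (N + 2 (d - 2))) g =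
    lap e], of the same shape in degree [d - 2] with a constant still positive. Solve it for [g]
    first and set [h = (e - |x|^2 g) / c]. *)
Lemma sqr_lap_solve d (c : R) e : 0 < c -> hpoly d e -> invariant e ->
  exists h, [/\ hpoly d h, invariant h &
    forall x, x != 0 -> dotR x x * lap h x + c * h x = e x].
Proof.
elim/ltn_ind: d c e => d IH c e c0 ge ie; have cn0 := lt0r_neq0 c0.
have ice : invariant (fun x => c^-1 * e x) by move=> L x SL; rewrite ie.
have [d2|d2] := ltnP d 2.
  exists (fun x => c^-1 * e x); split=> //; first exact: gpolyZ.
  move=> x x0; rewrite (lap_hpoly0 _ d2) ?mulr0 ?add0r ?mulVKf//.
  exact: gpolyZ.
have dd : (d - 2 < d)%N by rewrite ltn_subrL (leq_trans _ d2).
have c'0 : 0 < c + 2 * (N%:R + 2 * (d - 2)%:R) by rewrite ltr_wpDr.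
have [g [gg ig Eg]] := IH _ dd _ (lap e) c'0 (lap_hpoly ge) (lap_invariant ge ie).
exists (fun x => c^-1 * (e x - dotR x x * g x)); split.
- apply: gpolyZ; apply: gpolyB => //; rewrite -(subnKC d2).
  by apply: gpolyM => //; exact: hpoly_sqr.
- by move=> L x SL; rewrite ie// ig// (sqr_invariant _ SL).
- move=> x x0.
  have sg : psmooth (fun y => dotR y y * g y).
    by apply: psmoothM; [exact: hpoly_psmooth (hpoly_sqr _ _)|exact: hpoly_psmooth gg].
  have -> : lap (fun x => c^-1 * (e x - dotR x x * g x)) x =
      c^-1 * (lap e x - lap (fun y => dotR y y * g y) x).
    have := lap_lin (- c^-1) sg (psmoothZ c^-1 (hpoly_psmooth ge)) x0.
    have -> : lap (fun y => c^-1 * e y) x = c^-1 * lap e x.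
      have := lap_lin c^-1 (hpoly_psmooth ge) (@psmooth_cst R N 0) x0.
      rewrite (@lap_hpoly0 0 (fun=> 0))//; last exact: gpoly_zero.
      by rewrite addr0 => <-; apply: lap_eqU => // y _; rewrite addr0.
    rewrite addrC mulNr -mulrBr => <-; apply: lap_eqU => // y _.
    ring.
  rewrite (lap_sqrM gg x0) -(Eg x x0); field; exact: cn0.
Qed.

(** The recursion of [sqr_lap_solve] again: [lap h] solves the homogeneous equation in degree
    [d - 2], so it vanishes, and [c h = 0] remains. *)
Lemma sqr_lap_inj d (c : R) h : 0 < c -> hpoly d h ->
  (forall x, x != 0 -> dotR x x * lap h x + c * h x = 0) ->
  forall x, x != 0 -> h x = 0.
Proof.
elim/ltn_ind: d c h => d IH c h c0 gh hh; have cn0 := lt0r_neq0 c0.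
suff l0 x : x != 0 -> lap h x = 0.
  move=> x x0; have := hh x x0; rewrite l0// mulr0 add0r => /eqP.
  by rewrite mulf_eq0 (negbTE cn0) => /eqP.
have [d2|d2] := ltnP d 2; first by rewrite (lap_hpoly0 _ d2).
have dd : (d - 2 < d)%N by rewrite ltn_subrL (leq_trans _ d2).
have gl := lap_hpoly gh.
have c'0 : 0 < c + 2 * (N%:R + 2 * (d - 2)%:R) by rewrite ltr_wpDr.
move: x; apply: (IH _ dd _ (lap h) c'0 gl) => x x0.
have sl : psmooth (fun y => dotR y y * lap h y).
  by apply: psmoothM; [exact: hpoly_psmooth (hpoly_sqr _ _)|exact: hpoly_psmooth gl].
have := lap_lin c (hpoly_psmooth gh) sl x0.
rewrite (lap_sqrM gl x0).
have -> : lap (fun y => c * h y + dotR y y * lap h y) x = 0.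
  apply: (etrans _ (@lap_hpoly0 0 (fun=> 0) x isT (gpoly_zero _ _ 0))).
  by apply: lap_eqU => // y y0; rewrite addrC hh.
move=> E; rewrite [RHS]E; move: (lap (lap h) x) (lap h x) => a b; ring.
Qed.

Lemma sqrM_harmonic_eq0 d h : (0 < N)%N -> hpoly d h ->
  (forall x, x != 0 -> lap (fun y => dotR y y * h y) x = 0) ->
  forall x, x != 0 -> h x = 0.
Proof.
move=> N0 gh lh; apply: (@sqr_lap_inj d (2 * (N%:R + 2 * d%:R))) => // [|x x0].
  by rewrite mulr_gt0// ltr_wpDr// ltr0n.
by rewrite -lap_sqrM// lh.
Qed.

(** Take [h] with [lap (|x|^2 h) = lap f]; by [lap_sqrM] this is the equation of [sqr_lap_solve]
    with [c = 2 (N + 2 d)]. *)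
Lemma harmonic_reduction d f : (0 < N)%N -> hpoly d.+2 f -> invariant f ->
  exists h, [/\ hpoly d h, invariant h &
    forall x, x != 0 -> lap (fun y => f y - dotR y y * h y) x = 0].
Proof.
move=> N0 gf jf; have c0 : 0 < 2 * (N%:R + 2 * d%:R) :> R.
  by rewrite mulr_gt0// ltr_wpDr// ltr0n.
have glf := lap_hpoly gf; rewrite !subSS subn0 in glf.
have [h [gh ih Eh]] := sqr_lap_solve c0 glf (lap_invariant gf jf).
exists h; split => // x x0.
have sh : psmooth (fun y => dotR y y * h y).
  by apply: psmoothM; [exact: hpoly_psmooth (hpoly_sqr _ _)|exact: hpoly_psmooth gh].
have := lap_lin (-1) sh (hpoly_psmooth gf) x0.
rewrite (lap_sqrM gh x0) (Eh x x0) mulN1r addNr => <-; apply: lap_eqU => // y _.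
by rewrite mulN1r addrC.
Qed.

End Invariant.
End HarmonicDecomposition.

(** * Isomorphisms from linear relations *)

Section LinearRelation.
Variables (R : realType) (V W : Type).
Variables (E1 : set (V -> R)) (E2 : set (W -> R)).

(** A linear relation with trivial kernels that is total on both sides is the graph of an
    isomorphism. Linearity makes trivial kernels enough: subtract two partners of the same
    function. *)
Lemma lin_iso_rel (r : (V -> R) -> (W -> R) -> Prop) :
  (forall f, E1 f -> exists2 g, E2 g & r f g) ->
  (forall g, E2 g -> exists2 f, E1 f & r f g) ->
  (forall a f f' g g', r f g -> r f' g' ->
     r (fun x => a * f x + f' x) (fun y => a * g y + g' y)) ->
  (forall f, r f (fun=> 0) -> f = fun=> 0) ->
  (forall g, r (fun=> 0) g -> g = fun=> 0) ->
  (forall a f f', E1 f -> E1 f' -> E1 (fun x => a * f x + f' x)) ->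
  (forall a g g', E2 g -> E2 g' -> E2 (fun x => a * g x + g' x)) ->
  lin_iso E1 E2.
Proof.
move=> r1 r2 rlin rl rr E1lin E2lin.
have /choice[phi phiP] : forall f, exists g, E1 f -> E2 g /\ r f g.
  move=> f; have [/r1[g]|nf] := pselect (E1 f); first by exists g.
  by exists (fun=> 0).
have sub0 (X : Type) (a b : X -> R) : (fun x => -1 * a x + b x) = (fun=> 0) -> a = b.
  move=> ab; apply/funext => x; have := congr1 (fun h => h x) ab => /= /eqP.
  by rewrite mulN1r addrC subr_eq0 => /eqP.
have rinj f g g' : r f g -> r f g' -> g = g'.
  move=> rg rg'; apply: (sub0); apply: rr.
  have := rlin (-1) _ _ _ _ rg rg'.
  by under eq_fun do rewrite mulN1r addNr.
have linj f f' g : r f g -> r f' g -> f = f'.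
  move=> rg rg'; apply: (sub0); apply: rl.
  have := rlin (-1) _ _ _ _ rg rg'.
  by under [X in r _ X -> _]eq_fun do rewrite mulN1r addNr.
exists phi; split=> [f /phiP[]//|]; split.
  move=> a f f' Ef Ef'; have [_ rf] := phiP _ Ef; have [_ rf'] := phiP _ Ef'.
  have [_ rff] := phiP _ (E1lin a _ _ Ef Ef').
  exact: rinj rff (rlin a _ _ _ _ rf rf').
split=> [f f' /phiP[_ rf] /phiP[_ rf'] ff'|g Eg].
  by rewrite -ff' in rf'; exact: linj rf rf'.
have [f Ef rfg] := r2 g Eg; exists f; split=> //.
by have [_ rf] := phiP _ Ef; exact: rinj rf rfg.
Qed.

End LinearRelation.

(** * Eigenfunctions and isospectrality *)

Section Eigenfunctions.
Variables (R : realType) (k : nat) (H : set 'M[R[i]]_k).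
Local Notation N := (k + k)%N.
Local Notation V := 'rV[R]_(k + k).
Implicit Types (F u h P : V -> R) (x y : V) (lam s : R).

Definition actions : set (V -> V) := [set act A | A in H].

Hypothesis actH : forall L, actions L -> orth_map L.

Lemma sphere_fun_phom F : sphere_fun F -> phom 0 F.
Proof.
move=> [_ nF] c x c0 x0; rewrite powRr0 mul1r (nF x)// nF ?scale_neq0//.
congr F; rewrite /normalize dotRZZ sqrtrM ?sqr_ge0// sqrtr_sqr gtr0_norm//.
by rewrite scalerA invfM mulrAC mulVf ?mul1r// gt_eqF.
Qed.

Lemma inv_eigenspace_lin lam a F G : inv_eigenspace H lam F -> inv_eigenspace H lam G ->
  inv_eigenspace H lam (fun x => a * F x + G x).
Proof.
move=> [[F0 nF] [sF [iF lF]]] [[G0 nG] [sG [iG lG]]]; split; last split; last split.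
- by split=> [|x x0]; [rewrite F0 G0 mulr0 addr0|rewrite nF// nG].
- exact: psmooth_lin.
- by move=> A x HA Sx; rewrite iF// iG.
- move=> x Sx; have x0 := sphere_neq0 Sx.
  apply: (etrans (congr1 -%R (lap_lin a sF sG x0))); rewrite opprD.
  have eF : - lap F x = lam * F x by exact: lF.
  have eG : - lap G x = lam * G x by exact: lG.
  rewrite eG -mulrN eF; ring.
Qed.

(** The eigenvalue equation is given on the sphere only; it spreads to the punctured space because
    [lap F] has degree -2. *)
Lemma eigen_lap lam F x : inv_eigenspace H lam F -> x != 0 ->
  lap F x = - lam * (rad (- 2) x * F x).
Proof.
move=> [nF [sF [_ lF]]] x0; have pF := sphere_fun_phom nF.
have r0 : 0 < Num.sqrt (dotR x x) by rewrite sqrtr_gt0 dotR_gt0.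
have ex : x = Num.sqrt (dotR x x) *: normalize x.
  by rewrite /normalize scalerA divff ?scale1r// gt_eqF.
have Sn := sphere_normalize x0; have n0 := sphere_neq0 Sn.
have eF : - lap F (normalize x) = lam * F (normalize x) by exact: lF.
rewrite {1}ex (lap_phom pF sF r0 n0) -[lap F _]opprK eF.
rewrite -(nF.2 x x0) sub0r /rad -powR12_sqrt ?dotR_ge0// -powRrM.
have -> : 2^-1 * - 2 = - 2 / 2 :> R by rewrite mulrC.
ring.
Qed.

Lemma eigen_harmonic s F x : inv_eigenspace H (s * (s + N%:R - 2)) F -> x != 0 ->
  lap (fun y => rad s y * F y) x = 0.
Proof.
move=> EF x0; have [nF [sF _]] := EF.
rewrite (lap_radM s sF (sphere_fun_phom nF) x0) (eigen_lap EF x0).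
rewrite [rad (s - 2) x]radD//; move: (rad _ x) (rad _ x) (F x) => a b c; ring.
Qed.

(** [lap_radM] with [sigma = d] and [s = - d]. The value 0 at the origin is the convention of
    [sphere_fun]. *)
Lemma harmonic_eigen d u : hpoly d u -> (forall x, x != 0 -> lap u x = 0) ->
  invariant actions u ->
  inv_eigenspace H (d%:R * (d%:R + N%:R - 2))
    (fun x => if x == 0 then 0 else rad (- d%:R) x * u x).
Proof.
move=> gu lu ju; set F := fun x => _; pose G x := rad (- d%:R) x * u x.
have FG x : x != 0 -> F x = G x by rewrite /F => /negbTE ->.
have sG : psmooth G by apply: psmoothM; [exact: rad_psmooth|exact: hpoly_psmooth gu].
have pG : phom 0 G.
  by have := phomM (@phom_rad R N (- d%:R)) (hpoly_phom gu); rewrite addNr.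
split; last split; last split.
- split=> [|x x0]; first by rewrite /F eqxx.
  have n0 := sphere_neq0 (sphere_normalize x0).
  by rewrite (FG x x0) (FG _ n0) (phom0_sphere pG x0).
- by apply: psmooth_eq sG => x x0; rewrite FG.
- move=> A x HA Sx; have SA : actions (act A) by exists A.
  have x0 := sphere_neq0 Sx; have oA := actH SA.
  rewrite !FG//; last exact: orth_map_neq0.
  by rewrite /G ju// /rad oA.2.
- move=> x Sx; have x0 := sphere_neq0 Sx.
  apply: (etrans (congr1 -%R (lap_eqU FG x0))); rewrite FG//.
  rewrite (lap_radM _ (hpoly_psmooth gu) (hpoly_phom gu) x0) lu// /G.
  rewrite !rad_sphere//; move: (u x) => c; ring.
Qed.

Lemma eigen_polynomial lam F : (3 < N)%N -> inv_eigenspace H lam F ->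
  F = (fun=> 0) \/ exists d P, [/\ lam = d%:R * (d%:R + N%:R - 2), hpoly d P,
    invariant actions P & forall x, x != 0 -> P x = rad d%:R x * F x].
Proof.
move=> N3 EF; have [nF [sF [iF lF]]] := EF; have pF := sphere_fun_phom nF.
have N4 : 4 <= N%:R :> R by rewrite ler_nat.
have zero : (forall x, x != 0 -> F x = 0) -> F = fun=> 0.
  by move=> F0; apply/funext => x; have [->|/F0//] := eqVneq x 0; exact: nF.1.
have [lam0|lam0] := ltP lam 0.
  (* In the sign convention of [lap] a negative [lam] is a positive factor, so the maximum principle
     applies to [F] and to [- F]. *)
  left; apply: zero => x x0; apply/eqP; rewrite eq_le; apply/andP; split.
    apply: (phom0_lap_le0 (mu := - lam) sF pF _ _ x0); first by rewrite oppr_gt0.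
    by move=> y Sy; rewrite mulNr -(lF y Sy); exact: (esym (opprK _)).
  rewrite -oppr_le0 -mulN1r.
  have sF' : psmooth (fun y => -1 * F y) by exact: psmoothZ.
  have pF' : phom 0 (fun y => -1 * F y).
    by move=> c y c0 y0; rewrite pF// mulrCA.
  apply: (phom0_lap_le0 (mu := - lam) sF' pF' _ _ x0); first by rewrite oppr_gt0.
  move=> y Sy; have y0 := sphere_neq0 Sy.
  have [_ [_ [_ lF']]] := inv_eigenspace_lin (-2) EF EF.
  (* [- F] written in the form [a F + G] that [inv_eigenspace_lin] covers. *)
  have FF : (fun y => -2 * F y + F y) = (fun y => -1 * F y).
    by apply/funext => z; ring.
  rewrite FF in lF'.
  have -> : - lam * (-1 * F y) = - (lam * (-2 * F y + F y)) by ring.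
  by rewrite -(lF' y Sy); exact: (esym (opprK _)).
(* [D] is the discriminant of [s (s + N - 2) = lam], and [s] its nonnegative root, which makes
   [r^s F] harmonic. *)
pose D := (N%:R - 2) ^+ 2 + 4 * lam : R.
pose s := (Num.sqrt D - (N%:R - 2)) / 2 : R.
have D0 : 0 <= D by rewrite addr_ge0 ?sqr_ge0// mulr_ge0.
have sD : Num.sqrt D ^+ 2 = D by rewrite sqr_sqrtr.
have s0 : 0 <= s.
  rewrite divr_ge0// subr_ge0 -(@ler_sqr R) ?nnegrE ?sqrtr_ge0 ?subr_ge0//; last by lra.
  by rewrite sD lerDl mulr_ge0.
have lams : lam = s * (s + N%:R - 2).
  have -> : s * (s + N%:R - 2) = (Num.sqrt D ^+ 2 - (N%:R - 2) ^+ 2) / 4.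
    by rewrite /s; field.
  by rewrite sD /D; field.
pose u x := rad s x * F x.
have su : psmooth u by apply: psmoothM => //; exact: rad_psmooth.
have pu : phom s u by have := phomM (@phom_rad R N s) pF; rewrite addr0.
have lu x : x != 0 -> lap u x = 0.
  by move=> x0; apply: eigen_harmonic => //; rewrite -lams.
have [j sj] : exists j : nat, s < j%:R.
  by exists (Num.bound s); exact: archi_boundP.
have sj1 : -1 <= s < j%:R by rewrite sj andbT (le_trans _ s0)// lerN10.
have [[d [P [sd gP uP]]]|u0] := harmonic_polynomial N3 su lu pu sj1; last first.
  left; apply: zero => x x0; have /eqP := u0 x x0.
  by rewrite mulf_eq0 (gt_eqF (rad_gt0 s x0)) => /eqP.
right; exists d, P; split=> //; first by rewrite -sd.
- move=> _ x [A HA <-]; have SA : actions (act A) by exists A.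
  have oA := actH SA.
  have [->|x0] := eqVneq x 0; first by rewrite (orth_map0 oA).
  have Ax0 := orth_map_neq0 oA x0.
  rewrite -!uP// /u /rad oA.2; congr (_ * _).
  rewrite (nF.2 x x0) (nF.2 _ Ax0) (orth_map_normalize _ oA).
  by apply: iF => //; exact: sphere_normalize.
- by move=> x x0; rewrite -uP// /u sd.
Qed.

End Eigenfunctions.

(** * From a description of the invariants to isospectrality *)

Section InvariantModel.
Variable R : realType.

(** [option bool] serves as an index set with three elements; the outer [None] is the index of
    [|x|^2], the generator that gets singled out. *)
Definition with_norm k (p : option bool -> 'rV[R]_(k + k) -> R) (o : option (option bool)) :
    'rV[R]_(k + k) -> R :=
  if o is Some a then p a else fun x => dotR x x.

(* The invariants of [H] are the polynomials in [|x|^2] and three further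
   quadratic invariants [p a], and these take all values once [|x|^2] is large. *)
Record invariant_model k (H : set 'M[R[i]]_k) (p : option bool -> 'rV[R]_(k + k) -> R) :
  Prop := InvariantModel {
    model_orth : forall L, actions H L -> orth_map L;
    model_hpoly : forall a, hpoly 2 (p a);
    model_inv : forall a, invariant (actions H) (p a);
    model_odd : forall d P, odd d -> hpoly d P -> invariant (actions H) P ->
      forall x, P x = 0;
    model_even : forall l P, hpoly (2 * l) P -> invariant (actions H) P ->
      gpoly (with_norm p) (fun=> 1%N) l P;
    model_full : forall v : option bool -> R, exists T, forall t, T <= t ->
      exists2 x, dotR x x = t & forall a, p a x = v a
  }.

Definition hpoly3 l (g : (option bool -> R) -> R) :=
  gpoly (fun a (v : option bool -> R) => v a) (fun=> 1%N) l g.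

Section OneGroup.
Variables (k : nat) (H : set 'M[R[i]]_k) (p : option bool -> 'rV[R]_(k + k) -> R).
Local Notation N := (k + k)%N.
Local Notation V := 'rV[R]_(k + k).
Hypothesis M : invariant_model H p.
Hypothesis N3 : (3 < N)%N.
Implicit Types (F P u h : V -> R) (x : V) (g : (option bool -> R) -> R).

(** The eigenvalue of spherical harmonics of degree [2 l]. *)
Definition level l : R := (2 * l)%:R * ((2 * l)%:R + N%:R - 2).

(* [F] is the eigenfunction whose harmonic polynomial is congruent to [g o p]
   modulo [|x|^2]. *)
Definition symbol l F g := [/\ hpoly3 l g, inv_eigenspace H (level l) F &
  exists2 h, gpoly_pred (with_norm p) (fun=> 1%N) l h &
    forall x, x != 0 -> rad (2 * l)%:R x * F x =
      g (fun a => p a x) + dotR x x * h x].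

Let N0 : (0 < N)%N. Proof. exact: leq_trans N3. Qed.

Lemma with_norm_hpoly o : hpoly 2 (with_norm p o).
Proof. by case: o => [a|]; [exact: (model_hpoly M)|exact: hpoly_sqr]. Qed.

Lemma gpoly_with_norm_hpoly l h : gpoly (with_norm p) (fun=> 1%N) l h -> hpoly (2 * l) h.
Proof.
elim=> {l h} [|l|l a F G _ IH _ IH'|l o F _ IH].
- exact: gpoly_one.
- exact: gpoly_zero.
- exact: gpoly_lin.
- by rewrite mulnDr muln1; apply: gpolyM => //; exact: with_norm_hpoly.
Qed.

Lemma hpoly3_comp l g : hpoly3 l g -> gpoly (with_norm p) (fun=> 1%N) l (fun x => g (fun a => p a x)).
Proof.
move=> gg; apply: gpoly_subst (gpoly_comp (fun x a => p a x) gg) => a.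
exact: (gpoly_gen (with_norm p) (fun=> 1%N) (Some a)).
Qed.

Lemma gpoly_with_norm_inv l h : gpoly (with_norm p) (fun=> 1%N) l h ->
  invariant (actions H) h.
Proof.
move=> gh L x SL; apply: gpoly_ext gh _ => -[a|] /=.
  exact: (model_inv M).
exact: (model_orth M SL).2.
Qed.

Lemma symbol_total l g : hpoly3 l g -> exists F, symbol l F g.
Proof.
move=> gg; have gp := hpoly3_comp gg; have ip := gpoly_with_norm_inv gp.
have hp := gpoly_with_norm_hpoly gp.
have [h gh lh] : exists2 h, gpoly_pred (with_norm p) (fun=> 1%N) l h &
    forall x, x != 0 -> lap (fun y => g (fun a => p a y) - dotR y y * h y) x = 0.
  (* Constants are harmonic as they stand; from degree 2 on a multiple of [|x|^2] is subtracted. *)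
  case: l gg gp hp => [|l] gg gp hp.
    exists (fun=> 0) => // x x0; apply: (lap_hpoly0 (d := 0)) => //.
    by apply: gpoly_eq hp => // y; rewrite mulr0 subr0.
  rewrite mulnS in hp.
  have [h [gh ih Eh]] := harmonic_reduction (model_orth M) N0 hp ip.
  by exists h => //=; exact: (model_even M).
pose u x := g (fun a => p a x) - dotR x x * h x.
have gu : gpoly (with_norm p) (fun=> 1%N) l u.
  apply: gpolyB => //; case: l {gg gp hp} gh => [/= ->|l /=].
    by apply: gpoly_eq (gpoly_zero _ _ 0) => // x; rewrite mulr0.
  exact: (gpoly_mulgen (e := with_norm p) None).
have Eu := harmonic_eigen (model_orth M) (gpoly_with_norm_hpoly gu) lh
  (gpoly_with_norm_inv gu).
eexists; split; [exact: gg|exact: Eu|].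
exists (fun x => -1 * h x + 0); first by apply: gpoly_pred_lin => //; exact: gpoly_pred_zero.
move=> x x0; rewrite (negbTE x0) mulrA -radD// subrr rad0 mul1r.
by rewrite addr0 mulN1r mulrN.
Qed.

Lemma symbol_onto l F : inv_eigenspace H (level l) F -> exists g, symbol l F g.
Proof.
move=> EF; have [F0|[d [P [ld gP iP PF]]]] := eigen_polynomial (model_orth M) N3 EF.
  exists (fun=> 0); split=> //; first exact: gpoly_zero.
  exists (fun=> 0); first exact: gpoly_pred_zero.
  by move=> x _; rewrite F0 !mulr0 addr0.
have d2l : d = (2 * l)%N.
  (* [a (a + c - 2)] is injective in [a >= 0] when [c > 2], so the eigenvalue determines the
     degree. *)
  have key (a b c : R) : 0 <= a -> 0 <= b -> 2 < c ->
      a * (a + c - 2) = b * (b + c - 2) -> b = a.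
    move=> a0 b0 c2 ab; have /eqP : (b - a) * (b + a + (c - 2)) = 0 by nra.
    by rewrite mulf_eq0 => /orP[|] /eqP; lra.
  apply/eqP; rewrite -(eqr_nat R); apply/eqP; apply: key ld => //.
  by rewrite ltr_nat (ltn_trans _ N3).
rewrite d2l in gP PF.
have [G gG [h gh PE]] := gpoly_expand0 (i0 := None) erefl (model_even M gP iP).
have [Q gQ GQ] := gpoly_lift gG.
(* Reduction modulo [|x|^2]: the variable standing for the norm is set to 0. *)
pose ext (v : option bool -> R) (o : option (option bool)) : R := if o is Some a then v a else 0.
exists (fun v => Q (ext v)); split=> //.
- apply: gpoly_subst (gpoly_comp ext gQ) => -[a|] /=.
    exact: (gpoly_gen (fun a (v : option bool -> R) => v a) (fun=> 1%N) a).
  exact: gpoly_zero.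
- exists h => // x x0; rewrite -PF// PE GQ; congr (_ + _).
  by congr Q; apply/funext => -[a|].
Qed.

Lemma symbol_lin l a F F' g g' : symbol l F g -> symbol l F' g' ->
  symbol l (fun x => a * F x + F' x) (fun v => a * g v + g' v).
Proof.
move=> [gg EF [h gh hE]] [gg' EF' [h' gh' hE']]; split.
- exact: gpoly_lin.
- exact: inv_eigenspace_lin.
- exists (fun x => a * h x + h' x); first exact: gpoly_pred_lin.
  by move=> x x0; rewrite mulrDr mulrCA hE// hE'//; ring.
Qed.

(** By [model_full] the [p a] can be held at [v] while [t = |x|^2] runs over a half-line. There
    [g v + t q(t) = 0] for a polynomial [q], and the constant coefficient is [g v]. *)
Lemma symbol_inj0 l g : symbol l (fun=> 0) g -> g = fun=> 0.
Proof.
move=> [_ _ [h gh hE]]; apply/funext => v.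
have [T Tx] := model_full M v.
have [q hq] : exists q : {poly R}, forall x, (forall a, p a x = v a) -> h x = q.[dotR x x].
  case: l gh {hE} => [/= ->|l /= gh]; first by exists 0 => x _; rewrite horner0.
  have [Q gQ hQ] := gpoly_lift gh.
  pose curve (t : R) (o : option (option bool)) : R := if o is Some a then v a else t.
  have [|q Qq] := gpoly_curve (gamma := curve) _ gQ.
    by case=> [a|] /=; [exists (v a)%:P => s; rewrite hornerC|exists 'X => s; rewrite hornerX].
  exists q => x xv; rewrite hQ -Qq; congr Q.
  by apply/funext => -[a|] /=.
have : (g v)%:P + 'X * q = 0.
  apply: (@poly_eq_ge _ _ _ (Num.max T 1)) => t; rewrite ge_max => /andP[/Tx[x xt xv] t1].
  have x0 : x != 0 by rewrite -dotR_eq0 xt gt_eqF// (lt_le_trans _ t1).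
  have := hE x x0; rewrite mulr0 (hq x xv) xt.
  have -> : (fun a => p a x) = v by apply/funext.
  by rewrite hornerD hornerC hornerM hornerX horner0 => <-.
move=> /(congr1 (fun q : {poly R} => q`_0)).
by rewrite coefD coefC coefXM /= addr0 coef0.
Qed.

(** The polynomial of [F] is then harmonic and a multiple of [|x|^2], hence zero. *)
Lemma symbol_inj l F : symbol l F (fun=> 0) -> F = fun=> 0.
Proof.
move=> [_ EF [h gh hE]]; have [nF _] := EF.
have h0 x : x != 0 -> h x = 0.
  case: l gh EF hE => [/= ->//|l /= gh EF hE].
  move: x; apply: (sqrM_harmonic_eq0 N0 (gpoly_with_norm_hpoly gh)) => x x0.
  rewrite -(eigen_harmonic EF x0); apply: lap_eqU => // y y0.
  by rewrite hE// add0r.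
apply/funext => x; have [->|x0] := eqVneq x 0; first exact: nF.1.
have /eqP := hE x x0; rewrite h0// mulr0 addr0 mulf_eq0.
by rewrite (gt_eqF (rad_gt0 _ x0)) => /eqP.
Qed.

Lemma eigenspace_off_level lam F : (forall l, lam != level l) ->
  inv_eigenspace H lam F -> F = fun=> 0.
Proof.
move=> nl EF; have [//|[d [P [ld gP iP PF]]]] := eigen_polynomial (model_orth M) N3 EF.
have [od|ed] := boolP (odd d).
  apply/funext => x; have [->|x0] := eqVneq x 0; first exact: EF.1.1.
  have /esym/eqP := PF x x0; rewrite (model_odd M od gP iP) mulf_eq0.
  by rewrite (gt_eqF (rad_gt0 _ x0)) => /eqP.
have := nl d./2; rewrite /level mul2n even_halfK//.
by rewrite -ld eqxx.
Qed.

Lemma zero_eigenspace lam : inv_eigenspace H lam (fun=> 0).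
Proof.
split=> //; split; first exact: psmooth_cst.
split=> // x _; rewrite mulr0; have l0 : lap (fun=> 0) x = 0 :> R.
  by apply: (lap_hpoly0 (d := 0)) => //; exact: gpoly_zero.
by apply: (etrans (congr1 -%R l0)); rewrite oppr0.
Qed.

End OneGroup.

Lemma isospectral_models k1 k2 (G1 : set 'M[R[i]]_k1) (G2 : set 'M[R[i]]_k2) p1 p2 :
  invariant_model G1 p1 -> invariant_model G2 p2 -> k1 = k2 -> (1 < k1)%N ->
  isospectral G1 G2.
Proof.
move=> M1 M2 k12 k11 lam.
have N1 : (3 < k1 + k1)%N by case: k1 k11 {G1 p1 M1 k12} => [|[|k]] // _; rewrite !addSn !addnS.
have N2 : (3 < k2 + k2)%N by rewrite -k12.
have [[l ll]|nl] := pselect (exists l, lam = level k1 l); last first.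
  have nl1 l : lam != level k1 l by apply/eqP => ll; apply: nl; exists l.
  have nl2 l : lam != level k2 l by rewrite -k12.
  (* Off the levels both eigenspaces are zero. *)
  apply: (@lin_iso_rel _ _ _ _ _ (fun f g => inv_eigenspace G1 lam f /\ inv_eigenspace G2 lam g)).
  - by move=> f Ef; exists (fun=> 0); [|split => //]; exact: zero_eigenspace.
  - by move=> f Ef; exists (fun=> 0); [|split => //]; exact: zero_eigenspace.
  - by move=> a f f' g g' [? ?] [? ?]; split; exact: inv_eigenspace_lin.
  - by move=> f [Ef _]; exact: (eigenspace_off_level M1 N1 nl1).
  - by move=> f [_ Ef]; exact: (eigenspace_off_level M2 N2 nl2).
  - by move=> a f f'; exact: inv_eigenspace_lin.
  - by move=> a f f'; exact: inv_eigenspace_lin.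
have ll2 : lam = level k2 l by rewrite -k12.
(* The levels depend on the group only through the dimension, so eigenfunctions of the two groups
   are matched when they share a symbol [g]. *)
apply: (@lin_iso_rel _ _ _ _ _ (fun f f' => exists2 g, symbol G1 p1 l f g & symbol G2 p2 l f' g)).
- move=> f; rewrite {1}ll => /(symbol_onto M1 N1)[g sg]; have [gg _ _] := sg.
  have [f' sf'] := symbol_total M2 N2 gg; exists f'; last by exists g.
  by rewrite ll2; case: sf'.
- move=> f; rewrite {1}ll2 => /(symbol_onto M2 N2)[g sg]; have [gg _ _] := sg.
  have [f' sf'] := symbol_total M1 N1 gg; exists f'; last by exists g.
  by rewrite ll; case: sf'.
- move=> a f f' h h' [g s1 s2] [g' s1' s2'].
  by exists (fun v => a * g v + g' v); exact: symbol_lin.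
- move=> f [g s1 /(symbol_inj0 M2) g0]; rewrite g0 in s1.
  exact: (symbol_inj M1 N1 s1).
- move=> f [g /(symbol_inj0 M1) g0 s1]; rewrite g0 in s1.
  exact: (symbol_inj M2 N2 s1).
- by move=> a f f'; exact: inv_eigenspace_lin.
- by move=> a f f'; exact: inv_eigenspace_lin.
Qed.

End InvariantModel.

(** * Invariants of the two groups *)

Section FirstFundamentalTheorem.
Variables (R : realType) (N : nat) (S : set ('rV[R]_N -> 'rV[R]_N)).
Local Notation V := 'rV[R]_N.
Variables (I : eqType) (y : I -> V -> R) (i0 i1 : I).
Let one (J : Type) : J -> nat := fun=> 1%N.
Implicit Types (P : V -> R) (x : V).

Hypothesis y_hpoly : forall i, hpoly 2 (y i).

(** Comparing points through invariant functions lets successive moves be chained without showing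
    that [S] is closed under composition. *)
Definition same_orbit x x' := forall P, invariant S P -> P x = P x'.

Definition has_denominator i := forall l P, hpoly (2 * l) P -> invariant S P ->
  exists2 E, gpoly y (@one I) (2 * l) E & forall x, 0 < y i x -> y i x ^+ l * P x = E x.

(* Along a section of the action through the points [sec v], multiplying by
   [r = sqrt (y i)] turns the coordinates [v] into polynomials [D j] in the
   invariants, up to square roots that occur to even powers only. *)
Lemma section_denominator (J : Type) (sec : (J -> R) -> V) (e : J -> (J -> R) -> R)
    (wt : J -> nat) (D : J -> V -> R) i :
  (forall (c : R) v, sec (fun j => c * v j) = c *: sec v) ->
  (forall d P, hpoly d P -> invariant S P -> gpoly e wt d (fun v => P (sec v))) ->
  (forall j, gpoly y (@one I) (wt j) (D j)) ->
  (forall x, 0 < y i x -> exists r v, [/\ r ^+ 2 = y i x, same_orbit x (sec v) &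
     forall j, e j (fun j => r * v j) = D j x]) ->
  has_denominator i.
Proof.
move=> secZ sec_even gD cover l P gP iP.
have [Q gQ QE] := gpoly_lift (sec_even _ P gP iP).
exists (fun x => Q (fun j => D j x)).
  exact: gpoly_subst gD (gpoly_comp (fun x j => D j x) gQ).
move=> x /cover[r [v [r2 xv rD]]].
(* In degree [2 l] the factor [y i x ^+ l = r ^+ (2 * l)] is exactly what scaling the slice point by
   [r] produces. *)
rewrite (xv P iP) -r2 -exprM -(hpolyZ r (sec v) gP) -secZ QE.
by congr Q; apply/funext.
Qed.

(** The involution permutes the invariants and preserves invariance of functions, so the second
    denominator comes without a second slice. *)
Lemma swap_denominator (iota : V -> V) :
  (forall x, iota (iota x) = x) ->
  (forall d P, hpoly d P -> hpoly d (fun x => P (iota x))) ->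
  (forall P, invariant S P -> invariant S (fun x => P (iota x))) ->
  (forall x, y i1 (iota x) = y i0 x) ->
  (forall j, exists j', forall x, y j (iota x) = y j' x) ->
  has_denominator i0 -> has_denominator i1.
Proof.
move=> iotaK giota jiota yi1 yi den l P gP iP.
have [E gE EP] := den l _ (giota _ _ gP) (jiota _ iP).
exists (fun x => E (iota x)).
  apply: gpoly_subst (gpoly_comp iota gE) => j.
  have [j' yj] := yi j; apply: gpoly_eq (gpoly_gen y (@one I) j') => // x.
move=> x yx; have yx' : y i0 (iota x) = y i1 x by rewrite -yi1 iotaK.
by rewrite -EP yx'// iotaK.
Qed.

Lemma fft l P : i1 != i0 -> has_denominator i0 -> has_denominator i1 ->
  (forall x, 0 <= y i0 x) -> (forall x, 0 <= y i1 x) ->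
  (exists x, 0 < y i0 x /\ 0 < y i1 x) ->
  (forall x a, 0 < y i0 x -> 0 < y i1 x -> y i0 x <= a ->
    exists2 x', y i0 x' = a & forall j, j != i0 -> y j x' = y j x) ->
  hpoly (2 * l) P -> invariant S P -> gpoly y (@one I) l P.
Proof.
move=> i10 den0 den1 y0 y1 [x0 [x00 x01]] full gP iP.
have [E gE EP] := den0 l P gP iP; have [E' gE' EP'] := den1 l P gP iP.
have [G gG PG] := gpoly_denominators i10 gE gE' EP EP' full.
have hG : hpoly (2 * l) G.
  elim: {G PG} (l) (G) / gG => [|d|d a F F' _ IH _ IH'|d i F _ IH].
  - exact: gpoly_one.
  - exact: gpoly_zero.
  - exact: gpoly_lin.
  - by rewrite /one mulnDr muln1; apply: gpolyM; first exact: y_hpoly.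
apply: gpoly_eq gG => // x; apply/eqP; rewrite -subr_eq0 -oppr_eq0 opprB; apply/eqP.
(* [P] and [G] agree only where both invariants are positive. Multiplied by the product of these two
   the difference vanishes everywhere, and the product is not the zero polynomial. *)
move: x; apply: (@hpoly_domain R N _ _ (fun x => y i0 x * y i1 x) _ x0).
- by apply: gpolyM; exact: y_hpoly.
- exact: gpolyB gP hG.
- move=> x; have := y0 x; have := y1 x; rewrite !le_eqVlt.
  case/predU1P => [<-|B0]; first by rewrite mulr0 mul0r.
  case/predU1P => [<-|A0]; first by rewrite !mul0r.
  by rewrite PG// subrr mulr0.
- by rewrite mulf_neq0// gt_eqF.
Qed.

End FirstFundamentalTheorem.

(** * Real orthogonal matrices bringing vectors into normal position *)

Section RealOrthogonal.
Variables (R : realType) (d : nat).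
Implicit Types (a b c v : 'rV[R]_d) (Q : 'M[R]_d).
Local Notation e := (@ebasis R d).

Definition orthm Q := Q *m Q^T = 1%:M.

Lemma orthmM Q Q' : orthm Q -> orthm Q' -> orthm (Q *m Q').
Proof. by move=> oQ oQ'; rewrite /orthm trmx_mul mulmxA -(mulmxA Q) oQ' mulmx1. Qed.

Lemma orthm_tr Q : orthm Q -> orthm Q^T.
Proof. by move=> /mulmx1C; rewrite /orthm trmxK. Qed.

Lemma dotR_orthm Q a b : orthm Q -> dotR (a *m Q) (b *m Q) = dotR a b.
Proof. by move=> oQ; rewrite -!dotR_mx trmx_mul mulmxA -(mulmxA a) oQ mulmx1. Qed.

Lemma row_mul_dot a b c : a *m (b^T *m c) = dotR a b *: c.
Proof. by rewrite mulmxA [a *m b^T]mx11_scalar dotR_mx mul_scalar_mx. Qed.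

Definition reflection v : 'M[R]_d := 1%:M - (2 / dotR v v) *: (v^T *m v).

Lemma reflection_mul v c : c *m reflection v = c - (2 * dotR c v / dotR v v) *: v.
Proof.
rewrite mulmxBr mulmx1 -scalemxAr row_mul_dot scalerA.
by rewrite mulrAC.
Qed.

Lemma reflection_tr v : (reflection v)^T = reflection v.
Proof. by rewrite linearB /= linearZ /= trmx_mul trmxK trmx1. Qed.

Lemma orthm_reflection v : v != 0 -> orthm (reflection v).
Proof.
rewrite -dotR_eq0 /orthm reflection_tr => v0; apply/row_matrixP => i.
rewrite !rowE mulmxA mulmx1; set c := delta_mx _ _.
rewrite !reflection_mul; set K := _ / _.
have -> : dotR (c - K *: v) v = - dotR c v.
  by rewrite addrC -scaleNr dotR_linl /K; field.
by rewrite mulrN mulNr scaleNr opprK subrK.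
Qed.

Lemma reflection_fix v c : dotR c v = 0 -> c *m reflection v = c.
Proof. by move=> cv; rewrite reflection_mul cv mulr0 mul0r scale0r subr0. Qed.

(** For [a != b] of equal norm, the reflection along [a - b] carries [a] to [b] and fixes what is
    orthogonal to both. *)
Lemma orthm_transport a b : dotR a a = dotR b b -> exists Q, [/\ orthm Q, a *m Q = b &
  forall c, dotR c a = 0 -> dotR c b = 0 -> c *m Q = c].
Proof.
move=> ab; have [->|nab] := eqVneq a b.
  by exists 1%:M; split; rewrite /orthm ?trmx1 ?mulmx1// => c _ _; rewrite mulmx1.
have v0 : a - b != 0 by rewrite subr_eq0.
have dB x y z : dotR x (y - z) = dotR x y - dotR x z :> R.
  by rewrite dotRC -[y - z]addrC -scaleN1r dotR_linl !(dotRC _ x); ring.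
have vv : dotR (a - b) (a - b) = 2 * dotR a (a - b).
  rewrite !dB !(dotRC (a - b)) !dB ab (dotRC b a); ring.
exists (reflection (a - b)); split.
- exact: orthm_reflection.
- have av0 : dotR a (a - b) != 0.
    by move: v0; rewrite -dotR_eq0 vv mulf_eq0 negb_or => /andP[].
  have two0 : 2 != 0 :> R by rewrite pnatr_eq0.
  by rewrite reflection_mul vv (divff (mulf_neq0 two0 av0)) scale1r opprB addrC subrK.
- by move=> c ca cb; rewrite reflection_fix// dB ca cb subrr.
Qed.

Lemma dotR_eb i : dotR (e i) (e i) = 1.
Proof. by rewrite dotR_ebasis mxE !eqxx. Qed.

Lemma dotR_ebb i j : i != j -> dotR (e i) (e j) = 0.
Proof. by move=> ij; rewrite dotR_ebasis mxE eq_sym (negbTE ij) andbF. Qed.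

Lemma orthm_to_axis a i : exists Q, [/\ orthm Q,
  a *m Q = Num.sqrt (dotR a a) *: e i &
  forall c, dotR c a = 0 -> c 0 i = 0 -> c *m Q = c].
Proof.
have [|Q [oQ aQ fQ]] := @orthm_transport a (Num.sqrt (dotR a a) *: e i).
  by rewrite dotRZZ dotR_eb mulr1 sqr_sqrtr// dotR_ge0.
exists Q; split => // c ca ci; apply: fQ => //.
by rewrite dotRC dotRZl dotRC dotR_ebasis ci mulr0.
Qed.

Lemma orthm_flip_axis i : exists Q, [/\ orthm Q, e i *m Q = - e i, \det Q = -1 &
  forall c, c 0 i = 0 -> c *m Q = c].
Proof.
pose D : 'rV[R]_d := \row_j (if j == i then -1 else 1).
exists (diag_mx D); have mulD c : c *m diag_mx D = \row_j (c 0 j * D 0 j).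
  by rewrite mul_mx_diag; apply/rowP => j; rewrite !mxE.
split.
- rewrite /orthm tr_diag_mx mulmx_diag -diag_const_mx; congr diag_mx.
  by apply/rowP => j; rewrite !mxE; case: eqP; rewrite ?mulrNN mulr1.
- rewrite mulD; apply/rowP => j; rewrite !mxE eqxx /=.
  by case: eqP; rewrite /= ?mul0r ?oppr0// mul1r.
- rewrite det_diag (bigD1 i)//= mxE eqxx big1 ?mulr1// => j ji.
  by rewrite mxE (negbTE ji).
- move=> c ci; rewrite mulD; apply/rowP => j; rewrite !mxE.
  by case: eqP => [->|_]; rewrite ?ci ?mul0r ?mulr1.
Qed.

Lemma orthm_det Q : orthm Q -> \det Q = 1 \/ \det Q = -1.
Proof.
move=> oQ; have := congr1 determinant oQ; rewrite det_mulmx det_tr det1 => /eqP.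
by rewrite -expr2 sqrf_eq1 => /orP[|] /eqP; [left|right].
Qed.

(** Gram-Schmidt by reflections: first [a] goes to the axis [i], then the part of [b] orthogonal to
    that axis goes to the axis [j] without moving [e i]. *)
Lemma orthm_pair a b i j : i != j -> exists Q rho, [/\ orthm Q,
  a *m Q = Num.sqrt (dotR a a) *: e i &
  exists beta, b *m Q = beta *: e i + rho *: e j].
Proof.
move=> ij; have [Q [oQ aQ _]] := orthm_to_axis a i.
pose b1 := b *m Q; pose b2 := b1 - b1 0 i *: e i.
have b2i : b2 0 i = 0 by rewrite !mxE !eqxx mulr1 subrr.
have [Q' [oQ' bQ' fQ']] := orthm_to_axis b2 j.
have eQ' : e i *m Q' = e i.
  by apply: fQ'; [rewrite dotRC dotR_ebasis|rewrite mxE eq_sym (negbTE ij) andbF].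
exists (Q *m Q'), (Num.sqrt (dotR b2 b2)); split.
- exact: orthmM.
- by rewrite mulmxA aQ -scalemxAl eQ'.
- exists (b1 0 i); rewrite mulmxA -/b1 -{1}(subrK (b1 0 i *: e i) b1) -/b2.
  by rewrite mulmxDl bQ' -scalemxAl eQ' addrC.
Qed.

(** A reflection in a third axis [l] corrects the determinant and leaves the plane of [i] and [j]
    alone. *)
Lemma orthm_pair_det1 a b i j l : i != j -> i != l -> j != l ->
  exists Q rho, [/\ orthm Q, \det Q = 1,
  a *m Q = Num.sqrt (dotR a a) *: e i &
  exists beta, b *m Q = beta *: e i + rho *: e j].
Proof.
move=> ij il jl; have [Q [rho [oQ aQ [beta bQ]]]] := orthm_pair a b ij.
have [dQ|dQ] := orthm_det oQ; first by exists Q, rho; split=> //; exists beta.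
have [F [oF _ dF fF]] := orthm_flip_axis l.
have eF i' : i' != l -> e i' *m F = e i'.
  by move=> il'; apply: fF; rewrite mxE eq_sym (negbTE il') andbF.
exists (Q *m F), rho; split.
- exact: orthmM.
- by rewrite det_mulmx dQ dF mulrNN mulr1.
- by rewrite mulmxA aQ -scalemxAl eF.
- by exists beta; rewrite mulmxA bQ mulmxDl -!scalemxAl !eF.
Qed.

End RealOrthogonal.

(** * Complex rows as real vectors, and unitary matrices *)

Section ComplexRows.
Variable R : realType.
Local Notation C := (R[i]).

Lemma cconjE : @cconj R = @conjc R.
Proof. by apply/funext; case. Qed.

Lemma cReD (z w : C) : cRe (z + w) = cRe z + cRe w. Proof. by case: z; case: w. Qed.
Lemma cImD (z w : C) : cIm (z + w) = cIm z + cIm w. Proof. by case: z; case: w. Qed.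
Lemma cReM (z w : C) : cRe (z * w) = cRe z * cRe w - cIm z * cIm w.
Proof. by case: z; case: w. Qed.
Lemma cImM (z w : C) : cIm (z * w) = cRe z * cIm w + cIm z * cRe w.
Proof. by case: z; case: w. Qed.
Lemma cReJ (z : C) : cRe (conjc z) = cRe z. Proof. by case: z. Qed.
Lemma cImJ (z : C) : cIm (conjc z) = - cIm z. Proof. by case: z. Qed.

Lemma cRe_sum (I : finType) (F : I -> C) : cRe (\sum_i F i) = \sum_i cRe (F i).
Proof. exact: (big_morph (@cRe R) cReD). Qed.

Lemma cIm_sum (I : finType) (F : I -> C) : cIm (\sum_i F i) = \sum_i cIm (F i).
Proof. exact: (big_morph (@cIm R) cImD). Qed.

Lemma complex_eq (z w : C) : cRe z = cRe w -> cIm z = cIm w -> z = w.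
Proof. by case: z => a b; case: w => c d /= -> ->. Qed.

Lemma mulcJ (z : C) : z * conjc z = real_complex R (cRe z ^+ 2 + cIm z ^+ 2).
Proof. by case: z => a b; apply: complex_eq => /=; ring. Qed.

Definition toC m n (Q : 'M[R]_(m, n)) : 'M[C]_(m, n) := map_mx (real_complex R) Q.

Lemma toC_conj m n (Q : 'M[R]_(m, n)) : map_mx (@conjc R) (toC Q) = toC Q.
Proof. by apply/matrixP => i j; rewrite !mxE conjc_real. Qed.

Section Rows.
Variable d : nat.
Implicit Types (z w : 'rV[C]_d) (a b : 'rV[R]_d) (A : 'M[C]_d).

Definition re z : 'rV[R]_d := map_mx (@cRe R) z.
Definition im z : 'rV[R]_d := map_mx (@cIm R) z.
Definition cx a b : 'rV[C]_d := \row_j Complex (a 0 j) (b 0 j).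

Lemma cx_reim z : cx (re z) (im z) = z.
Proof. by apply/rowP => j; rewrite !mxE; case: (z 0 j). Qed.

Lemma re_cx a b : re (cx a b) = a.
Proof. by apply/rowP => j; rewrite !mxE. Qed.

Lemma im_cx a b : im (cx a b) = b.
Proof. by apply/rowP => j; rewrite !mxE. Qed.

Lemma cx_toC a b (Q : 'M[R]_d) : cx a b *m toC Q = cx (a *m Q) (b *m Q).
Proof.
apply/rowP => j; rewrite !mxE; apply: complex_eq => /=.
  rewrite cRe_sum; apply: eq_bigr => i _; rewrite !mxE cReM /=; ring.
rewrite cIm_sum; apply: eq_bigr => i _; rewrite !mxE cImM /=; ring.
Qed.

Lemma realifyE z : realify z = row_mx (re z) (im z).
Proof. by congr row_mx; apply/rowP => j; rewrite !mxE. Qed.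

Lemma cplxK (x : 'rV[R]_(d + d)) : realify (cplx x) = x.
Proof.
rewrite realifyE -[RHS]hsubmxK; congr row_mx; apply/rowP => j; rewrite !mxE //.
Qed.

Lemma realifyK z : cplx (realify z) = z.
Proof.
apply/rowP => j; rewrite mxE realifyE row_mxEl row_mxEr !mxE.
by case: (z 0 j).
Qed.

Lemma realify_lin (c : R) z w :
  realify (real_complex R c *: z + w) = c *: realify z + realify w.
Proof.
rewrite !realifyE scale_row_mx add_row_mx; congr row_mx; apply/rowP => j.
  by rewrite !mxE cReD cReM /= mul0r subr0.
by rewrite !mxE cImD cImM /= mul0r addr0.
Qed.

Lemma act_realify A z : act A (realify z) = realify (z *m A^T).
Proof. by rewrite /act realifyK. Qed.

Definition nsq z : R := \sum_j (cRe (z 0 j) ^+ 2 + cIm (z 0 j) ^+ 2).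

Lemma nsqE z : nsq z = dotR (re z) (re z) + dotR (im z) (im z).
Proof.
by rewrite /nsq -big_split; apply: eq_bigr => j _; rewrite !mxE !expr2.
Qed.

Lemma nsq_ge0 z : 0 <= nsq z.
Proof. by rewrite nsqE addr_ge0// dotR_ge0. Qed.

Lemma dotR_realify z w :
  dotR (realify z) (realify w) = cRe ((z *m (map_mx (@conjc R) w)^T) 0 0).
Proof.
rewrite /dotR big_split_ord /= mxE cRe_sum -big_split; apply: eq_bigr => j _ /=.
rewrite realifyE realifyE !row_mxEl !row_mxEr !mxE cReM cReJ cImJ; ring.
Qed.

Lemma nsq_realify z : dotR (realify z) (realify z) = nsq z.
Proof.
rewrite dotR_realify mxE cRe_sum; apply: eq_bigr => j _.
by rewrite !mxE mulcJ.
Qed.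

Lemma unitary_conj_tr A : unitary A -> map_mx (@conjc R) A^T *m A = 1%:M.
Proof.
rewrite /unitary /= cconjE => /mulmx1C; rewrite map_trmx; exact.
Qed.

Lemma unitary_tr A : unitary A -> unitary A^T.
Proof.
move=> uA; have := unitary_conj_tr uA; rewrite /unitary /= cconjE.
by move=> /(congr1 trmx); rewrite trmx_mul trmx1.
Qed.

Lemma map_conjK m n (A : 'M[C]_(m, n)) : map_mx (@conjc R) (map_mx (@conjc R) A) = A.
Proof. by apply/matrixP => i j; rewrite !mxE conjcK. Qed.

Lemma unitary_conj A : unitary A -> unitary (map_mx (@conjc R) A).
Proof.
rewrite /unitary /= cconjE => uA; rewrite map_trmx -map_mxM /= uA.
by rewrite map_scalar_mx rmorph1.
Qed.

Lemma unitary_toC (Q : 'M[R]_d) : orthm Q -> unitary (toC Q).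
Proof.
rewrite /orthm /unitary /= cconjE toC_conj => oQ.
by rewrite /toC map_trmx -map_mxM oQ map_scalar_mx rmorph1.
Qed.

Lemma unitary_diag z : (forall j, cRe (z 0 j) ^+ 2 + cIm (z 0 j) ^+ 2 = 1) ->
  unitary (diag_mx z).
Proof.
move=> z1; rewrite /unitary /= cconjE map_diag_mx tr_diag_mx mulmx_diag.
rewrite -diag_const_mx; congr diag_mx; apply/rowP => j.
by rewrite !mxE mulcJ z1.
Qed.

Lemma unitaryM A B : unitary A -> unitary B -> unitary (A *m B).
Proof.
rewrite /unitary /= cconjE => uA uB.
by rewrite map_mxM trmx_mul mulmxA -(mulmxA A) uB mulmx1.
Qed.

Lemma unitary_form A z w : unitary A ->
  (z *m A) *m (map_mx (@conjc R) (w *m A))^T = z *m (map_mx (@conjc R) w)^T.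
Proof.
rewrite /unitary /= cconjE => uA.
by rewrite map_mxM trmx_mul mulmxA -(mulmxA z) uA mulmx1.
Qed.

Lemma act_orth A : unitary A -> orth_map (act A).
Proof.
move=> uA; split=> [c x y|x y].
  rewrite -[x]cplxK -[y]cplxK -realify_lin !act_realify.
  by rewrite mulmxDl -scalemxAl realify_lin.
rewrite -[x]cplxK -[y]cplxK !act_realify dotR_realify unitary_form ?dotR_realify//.
exact: unitary_tr.
Qed.

Lemma nsq_unitary A z : unitary A -> nsq (z *m A) = nsq z.
Proof.
by move=> uA; rewrite -!nsq_realify !dotR_realify unitary_form.
Qed.

Lemma phase (w : C) : exists t : C, cRe t ^+ 2 + cIm t ^+ 2 = 1 /\ cIm (w * t) = 0.
Proof.
pose s := Num.sqrt (cRe w ^+ 2 + cIm w ^+ 2).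
have [w0|w0] := eqVneq s 0.
  exists 1; split; first by rewrite /= expr0n /= addr0 expr1n.
  have : cRe w ^+ 2 + cIm w ^+ 2 = 0.
    by rewrite -(@sqr_sqrtr _ (_ + _)) ?addr_ge0 ?sqr_ge0// -/s w0 expr0n.
  move/eqP; rewrite paddr_eq0 ?sqr_ge0// !sqrf_eq0 => /andP[_ /eqP iw].
  by rewrite mulr1.
have s2 : s ^+ 2 = cRe w ^+ 2 + cIm w ^+ 2 by rewrite sqr_sqrtr// addr_ge0// sqr_ge0.
(* This is the conjugate of [w] divided by its modulus. *)
exists (Complex (cRe w / s) (- cIm w / s)); split => /=.
  rewrite !expr_div_n sqrrN -mulrDl -s2 divff// sqrf_eq0//.
by rewrite cImM /=; field.
Qed.

Lemma phases w : exists t : 'rV[C]_d, unitary (diag_mx t) /\ im (w *m diag_mx t) = 0.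
Proof.
have /choice[f fP] : forall j, exists t : C,
    cRe t ^+ 2 + cIm t ^+ 2 = 1 /\ cIm (w 0 j * t) = 0 by move=> j; exact: phase.
exists (\row_j f j); split.
  by apply: unitary_diag => j; rewrite mxE; case: (fP j).
apply/rowP => j; rewrite mul_mx_diag !mxE; exact: (fP j).2.
Qed.

End Rows.
End ComplexRows.

(** * Polynomials under linear maps *)

Section LinearCoordinates.
Variable R : realType.

Lemma linear_family (J : finType) (T : lmodType R) (f : (J -> R) -> T) :
  (forall c v w, f (fun j => c * v j + w j) = c *: f v + f w) ->
  forall v, f v = \sum_j v j *: f (fun j' => (j' == j)%:R).
Proof.
move=> linf v.
have f0 : f (fun=> 0) = 0.
  have := linf 1 (fun=> 0) (fun=> 0); rewrite scale1r mul1r addr0 => /eqP.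
  by rewrite -subr_eq subrr eq_sym => /eqP.
have fsum (r : seq J) : f (fun j' => \sum_(j <- r) v j * (j' == j)%:R) =
    \sum_(j <- r) v j *: f (fun j' => (j' == j)%:R).
  elim: r => [|j r IH].
    by rewrite big_nil -f0; congr f; apply/funext => j; rewrite big_nil.
  rewrite big_cons -IH -linf; congr f; apply/funext => j'.
  by rewrite big_cons.
rewrite -fsum; congr f; apply/funext => j'; rewrite (bigD1 j')//= eqxx mulr1.
by rewrite big1 ?addr0// => j jj'; rewrite eq_sym (negbTE jj') mulr0.
Qed.

Lemma linear_gpoly (J : finType) (f : (J -> R) -> R) :
  (forall c v w, f (fun j => c * v j + w j) = c * f v + f w) ->
  gpoly (fun j (v : J -> R) => v j) (fun=> 1%N) 1 f.
Proof.
move=> linf; apply: gpoly_eq (erefl 1%N) (fun v => esym (@linear_family J R^o f linf v)) _.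
apply: gpoly_sum => j _.
apply: gpoly_eq (gpolyZ (f (fun j' => (j' == j)%:R))
  (gpoly_gen (fun j (v : J -> R) => v j) (fun=> 1%N) j)) => // v.
by rewrite mulrC.
Qed.

Lemma linear_hpoly N (f : 'rV[R]_N -> R) :
  (forall c x y, f (c *: x + y) = c * f x + f y) -> hpoly 1 f.
Proof.
move=> linf; pose g (v : 'I_N -> R) := f (\row_j v j).
have glin c v w : g (fun j => c * v j + w j) = c * g v + g w.
  by rewrite /g -linf; congr f; apply/rowP => j; rewrite !mxE.
apply: gpoly_eq (gpoly_comp (fun (x : 'rV[R]_N) j => x 0 j) (linear_gpoly glin)) => // x.
by congr f; apply/rowP => j; rewrite mxE.
Qed.

Lemma hpoly_linear_comp N (f : 'rV[R]_N -> 'rV[R]_N) d P :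
  (forall c x y, f (c *: x + y) = c *: f x + f y) ->
  hpoly d P -> hpoly d (fun x => P (f x)).
Proof.
move=> linf gP; apply: gpoly_subst (gpoly_comp f gP) => i.
by apply: linear_hpoly => c x y; rewrite linf !mxE.
Qed.

Lemma hpoly_section (J : finType) N (sec : (J -> R) -> 'rV[R]_N) d P :
  (forall c v w, sec (fun j => c * v j + w j) = c *: sec v + sec w) ->
  hpoly d P -> gpoly (fun j (v : J -> R) => v j) (fun=> 1%N) d (fun v => P (sec v)).
Proof.
move=> linf gP; apply: gpoly_subst (gpoly_comp sec gP) => i.
by apply: linear_gpoly => c v w; rewrite linf !mxE.
Qed.

Lemma section_scale (J : finType) N (sec : (J -> R) -> 'rV[R]_N) :
  (forall c v w, sec (fun j => c * v j + w j) = c *: sec v + sec w) ->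
  forall c v, sec (fun j => c * v j) = c *: sec v.
Proof.
move=> linf c v; rewrite (linear_family linf) [in RHS](linear_family linf) scaler_sumr.
by apply: eq_bigr => j _; rewrite scalerA.
Qed.

End LinearCoordinates.

Section Points.
Variables (R : realType) (p q : nat).
Local Notation C := (R[i]).
Implicit Types (z : 'rV[C]_p) (w : 'rV[C]_q) (x y : 'rV[R]_((p + q) + (p + q))).

Definition pt z w : 'rV[R]_((p + q) + (p + q)) := realify (row_mx z w).
Definition ptl x : 'rV[C]_p := lsubmx (cplx x).
Definition ptr x : 'rV[C]_q := rsubmx (cplx x).

Lemma ptK x : pt (ptl x) (ptr x) = x.
Proof. by rewrite /pt hsubmxK cplxK. Qed.

Lemma ptl_pt z w : ptl (pt z w) = z.
Proof. by rewrite /ptl realifyK row_mxKl. Qed.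

Lemma ptr_pt z w : ptr (pt z w) = w.
Proof. by rewrite /ptr realifyK row_mxKr. Qed.

Lemma pt_lin (c : R) z z' w w' :
  pt (real_complex R c *: z + z') (real_complex R c *: w + w') = c *: pt z w + pt z' w'.
Proof. by rewrite /pt -realify_lin scale_row_mx add_row_mx. Qed.

Lemma ptl_lin c x y : ptl (c *: x + y) = real_complex R c *: ptl x + ptl y.
Proof. by rewrite -[x]ptK -[y]ptK -pt_lin !ptl_pt. Qed.

Lemma ptr_lin c x y : ptr (c *: x + y) = real_complex R c *: ptr x + ptr y.
Proof. by rewrite -[x]ptK -[y]ptK -pt_lin !ptr_pt. Qed.

Lemma nsq_pt z w : dotR (pt z w) (pt z w) = nsq z + nsq w.
Proof.
rewrite nsq_realify /nsq big_split_ord /=; congr (_ + _); apply: eq_bigr => j _.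
  by rewrite row_mxEl.
by rewrite row_mxEr.
Qed.

Lemma act_block A B z w : act (block_mx A 0 0 B) (pt z w) = pt (z *m A^T) (w *m B^T).
Proof.
by rewrite act_realify tr_block_mx !trmx0 mul_row_block !mulmx0 addr0 add0r.
Qed.

Lemma unitary_block (A : 'M[C]_p) (B : 'M[C]_q) :
  unitary A -> unitary B -> unitary (block_mx A 0 0 B).
Proof.
rewrite /unitary /= cconjE => uA uB.
rewrite map_block_mx tr_block_mx mulmx_block !map_mx0 !trmx0.
by rewrite !mulmx0 !mul0mx !addr0 !add0r uA uB -scalar_mx_block.
Qed.

Lemma hpoly_cRe_ptl j : hpoly 1 (fun x => cRe (ptl x 0 j)).
Proof.
by apply: linear_hpoly => c x y; rewrite ptl_lin !mxE cReD cReM /= mul0r subr0.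
Qed.

Lemma hpoly_cIm_ptl j : hpoly 1 (fun x => cIm (ptl x 0 j)).
Proof.
by apply: linear_hpoly => c x y; rewrite ptl_lin !mxE cImD cImM /= mul0r addr0.
Qed.

Lemma hpoly_cRe_ptr j : hpoly 1 (fun x => cRe (ptr x 0 j)).
Proof.
by apply: linear_hpoly => c x y; rewrite ptr_lin !mxE cReD cReM /= mul0r subr0.
Qed.

Lemma hpoly_cIm_ptr j : hpoly 1 (fun x => cIm (ptr x 0 j)).
Proof.
by apply: linear_hpoly => c x y; rewrite ptr_lin !mxE cImD cImM /= mul0r addr0.
Qed.

End Points.

Lemma cx_lin (R : realType) d (c : R) (a a' b b' : 'rV[R]_d) :
  cx (c *: a + a') (c *: b + b') = real_complex R c *: cx a b + cx a' b'.
Proof.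
by apply/rowP => j; rewrite !mxE; apply: complex_eq; rewrite ?cReD ?cImD ?cReM ?cImM /=; ring.
Qed.

Section RealPairs.
Variables (R : realType) (d : nat) (i0 i1 : 'I_d).
Hypothesis i01 : i0 != i1.
Local Notation e0 := (ebasis R i0).
Local Notation e1 := (ebasis R i1).

Lemma dotR0l (a : 'rV[R]_d) : dotR 0 a = 0.
Proof. by rewrite /dotR big1// => j _; rewrite mxE mul0r. Qed.

Lemma dotR0r (a : 'rV[R]_d) : dotR a 0 = 0.
Proof. by rewrite dotRC dotR0l. Qed.

Lemma dotRZr (c : R) (a b : 'rV[R]_d) : dotR a (c *: b) = c * dotR a b.
Proof. by rewrite dotRC dotRZl dotRC. Qed.

Lemma dotR_linr (c : R) (a b b' : 'rV[R]_d) :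
  dotR a (c *: b + b') = c * dotR a b + dotR a b'.
Proof. by rewrite dotRC dotR_linl !(dotRC a). Qed.

Lemma dotR_axis_plane (r c s : R) : dotR (r *: e0) (c *: e0 + s *: e1) = r * c.
Proof.
by rewrite dotRZl dotRC dotR_linl dotRZl dotR_eb dotR_ebb ?(eq_sym i1)//; ring.
Qed.

Lemma dotR_plane (c s : R) : dotR (c *: e0 + s *: e1) (c *: e0 + s *: e1) = c ^+ 2 + s ^+ 2.
Proof.
rewrite dotR_linl dotRZl !dotR_linr !dotRZr !dotR_eb (dotR_ebb _ i01).
by rewrite dotR_ebb 1?eq_sym//; ring.
Qed.

Lemma cx_form (a b a' b' : 'rV[R]_d) :
  (cx a b *m (cx a' b')^T) 0 0 = Complex (dotR a a' - dotR b b') (dotR a b' + dotR b a').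
Proof.
apply: complex_eq; rewrite mxE ?cRe_sum ?cIm_sum /=.
  rewrite /dotR -sumrN -big_split; apply: eq_bigr => j _.
  by rewrite !mxE cReM /=.
rewrite /dotR -big_split; apply: eq_bigr => j _.
by rewrite !mxE cImM /=.
Qed.

Lemma nsq_cx (a b : 'rV[R]_d) : nsq (cx a b) = dotR a a + dotR b b.
Proof. by rewrite nsqE re_cx im_cx. Qed.

End RealPairs.

(** * Invariants of U(n) *)

Section UnitaryModel.
Variables (R : realType) (n : nat) (i0 i1 : 'I_n).
Hypothesis i01 : i0 != i1.
Local Notation C := (R[i]).
Local Notation V := 'rV[R]_((n + n) + (n + n)).
Local Notation e0 := (ebasis R i0).
Local Notation e1 := (ebasis R i1).
Local Notation G := (actions (@H1 R n)).
Implicit Types (x : V) (z w : 'rV[C]_n) (P : V -> R).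

(* The entries of the Gram matrix of [z] and [conj w]. *)
Definition y1 (j : bool * bool) x : R :=
  match j with
  | (false, false) => nsq (ptl x)
  | (false, true) => nsq (ptr x)
  | (true, false) => cRe ((ptl x *m (ptr x)^T) 0 0)
  | (true, true) => cIm ((ptl x *m (ptr x)^T) 0 0)
  end.

Arguments y1 : simpl never.

Lemma y1_hpoly j : hpoly 2 (y1 j).
Proof.
case: j => -[] [] /=.
- rewrite (_ : y1 _ = fun x => \sum_j (cRe (ptl x 0 j) * cIm (ptr x 0 j) +
      cIm (ptl x 0 j) * cRe (ptr x 0 j))); last first.
    by apply/funext => x; rewrite /y1 mxE cIm_sum; apply: eq_bigr => j _; rewrite cImM ![(ptr x)^T _ _]mxE.
  apply: gpoly_sum => j _; apply: gpolyD; apply: (gpolyM (d := 1) (d' := 1)).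
  + exact: hpoly_cRe_ptl.
  + exact: hpoly_cIm_ptr.
  + exact: hpoly_cIm_ptl.
  + exact: hpoly_cRe_ptr.
- rewrite (_ : y1 _ = fun x => \sum_j (cRe (ptl x 0 j) * cRe (ptr x 0 j) -
      cIm (ptl x 0 j) * cIm (ptr x 0 j))); last first.
    by apply/funext => x; rewrite /y1 mxE cRe_sum; apply: eq_bigr => j _; rewrite cReM ![(ptr x)^T _ _]mxE.
  apply: gpoly_sum => j _; apply: gpolyB; apply: (gpolyM (d := 1) (d' := 1)).
  + exact: hpoly_cRe_ptl.
  + exact: hpoly_cRe_ptr.
  + exact: hpoly_cIm_ptl.
  + exact: hpoly_cIm_ptr.
- apply: gpoly_sum => j _; apply: gpolyD; apply: (gpolyX (d := 1) 2).
  + exact: hpoly_cRe_ptr.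
  + exact: hpoly_cIm_ptr.
- apply: gpoly_sum => j _; apply: gpolyD; apply: (gpolyX (d := 1) 2).
  + exact: hpoly_cRe_ptl.
  + exact: hpoly_cIm_ptl.
Qed.

Lemma H1_unitary A : @H1 R n A -> unitary A.
Proof.
move=> [B uB <-]; apply: unitary_block => //; rewrite cconjE; exact: unitary_conj.
Qed.

Lemma H1_orth L : G L -> orth_map L.
Proof. by move=> [A /H1_unitary uA <-]; exact: act_orth. Qed.

(** Points are rows, so a matrix acts by right multiplication with its transpose [B], and the
    contragredient factor by the conjugate of [B]. *)
Lemma H1_action L : G L -> exists2 B : 'M[C]_n, unitary B &
  forall z w, L (pt z w) = pt (z *m B) (w *m map_mx (@conjc R) B).
Proof.
move=> [A [B uB <-] <-]; exists B^T; first exact: unitary_tr.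
by move=> z w; rewrite act_block cconjE map_trmx.
Qed.

Lemma H1_orbit (B : 'M[C]_n) z w : unitary B ->
  same_orbit G (pt z w) (pt (z *m B) (w *m map_mx (@conjc R) B)).
Proof.
move=> uB P iP; have GB : G (act (block_mx B^T 0 0 (map_mx (@cconj R) B^T))).
  by exists (block_mx B^T 0 0 (map_mx (@cconj R) B^T)) => //; exists B^T => //; exact: unitary_tr.
have := iP _ (pt z w) GB; rewrite act_block cconjE trmxK.
by rewrite map_trmx trmxK => ->.
Qed.

Lemma y1_inv j : invariant G (y1 j).
Proof.
move=> L x /H1_action[B uB LB]; rewrite -[x]ptK LB.
have uB' : unitary (map_mx (@conjc R) B) by exact: unitary_conj.
have zw : ptl x *m B *m (ptr x *m map_mx (@conjc R) B)^T = ptl x *m (ptr x)^T.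
  rewrite trmx_mul mulmxA -(mulmxA (ptl x)).
  by move: uB; rewrite /unitary /= cconjE => ->; rewrite mulmx1.
by case: j => -[] []; rewrite /y1 ?ptl_pt ?ptr_pt ?zw// nsq_unitary.
Qed.

Lemma orbit_trans x x' x'' : same_orbit G x x' -> same_orbit G x' x'' -> same_orbit G x x''.
Proof. by move=> xx' xx'' P iP; rewrite (xx' P iP) xx''. Qed.

(** The slice: [z] is real on the axis [i0], and [w] is supported on [i0] and [i1] with a real
    coordinate at [i1]. *)
Definition sec1 (v : bool * bool -> R) : V :=
  pt (cx (v (false, false) *: e0) 0)
     (cx (v (true, false) *: e0 + v (false, true) *: e1) (v (true, true) *: e0)).

Lemma sec1_lin (c : R) (v w : bool * bool -> R) :
  sec1 (fun j => c * v j + w j) = c *: sec1 v + sec1 w.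
Proof.
rewrite /sec1 -pt_lin -!cx_lin; congr (pt (cx _ _) (cx _ _)).
- by rewrite scalerDl scalerA.
- by rewrite scaler0 addr0.
- by rewrite !scalerDl scalerDr !scalerA addrACA.
- by rewrite scalerDl scalerA.
Qed.

Lemma y1_sec v : (y1 (false, false) (sec1 v) = v (false, false) ^+ 2) *
  (y1 (false, true) (sec1 v) = v (true, false) ^+ 2 + v (false, true) ^+ 2 + v (true, true) ^+ 2) *
  (y1 (true, false) (sec1 v) = v (false, false) * v (true, false)) *
  (y1 (true, true) (sec1 v) = v (false, false) * v (true, true)).
Proof.
rewrite /y1 /sec1 !ptl_pt !ptr_pt !nsq_cx cx_form /= (dotR_axis_plane i01) (dotR_plane i01).
rewrite !dotR0l !dotRZZ !dotR_eb !mulr1 !addr0 subr0.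
split; first by split; first split.
by rewrite dotRZl dotRC dotRZl dotR_eb mulr1.
Qed.

Lemma sec1_cover x : exists v, same_orbit G x (sec1 v).
Proof.
rewrite -[x]ptK; move: (ptl x) (ptr x) => z w {x}.
have [t [ut imz]] := phases z.
set z1 := z *m diag_mx t in imz; set w1 := w *m map_mx (@conjc R) (diag_mx t).
have o1 : same_orbit G (pt z w) (pt z1 w1) by exact: H1_orbit.
have [Q [oQ zQ _]] := orthm_to_axis (re z1) i0.
set r := Num.sqrt _ in zQ; set w2 := w1 *m toC Q.
have o2 : same_orbit G (pt z1 w1) (pt (cx (r *: e0) 0) w2).
  have := H1_orbit z1 w1 (unitary_toC oQ).
  by rewrite toC_conj -{2}(cx_reim z1) imz cx_toC mul0mx zQ.
clearbody w2; have [s [us imw]] := phases w2.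
(* [w] is multiplied by conjugates, hence the conjugation here. The coordinate [i0] is left alone to
   keep [z] real, so there [w] retains an imaginary part. *)
pose s' : 'rV[C]_n := \row_j if j == i0 then 1 else conjc (s 0 j).
have us' : unitary (diag_mx s').
  apply: unitary_diag => j; rewrite mxE; case: eqP => _; first by rewrite /= expr0n addr0 expr1n.
  move: us; rewrite /unitary /= cconjE map_diag_mx tr_diag_mx mulmx_diag => /matrixP/(_ j j).
  rewrite !mxE eqxx !mulr1n mulcJ => /(congr1 (@cRe R)) /= <-.
  by rewrite cReJ cImJ sqrrN.
set w3 := w2 *m map_mx (@conjc R) (diag_mx s').
have o3 : same_orbit G (pt (cx (r *: e0) 0) w2) (pt (cx (r *: e0) 0) w3).
  have := H1_orbit (cx (r *: e0) 0) w2 us'.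
  suff -> : cx (r *: e0) 0 *m diag_mx s' = cx (r *: e0) 0 by [].
  apply/rowP => j; rewrite mul_mx_diag !mxE; have [_|ji] := eqVneq j i0; first by rewrite mulr1.
  by rewrite mulr0; apply: complex_eq; rewrite ?cReM ?cImM /=; ring.
pose d0 := im w3 0 i0.
have imw3 : im w3 = d0 *: e0.
  apply/rowP => j; rewrite /d0; have [->|ji] := eqVneq j i0; first by rewrite !mxE !eqxx mulr1.
  rewrite [RHS]mxE [X in _ = _ * X]mxE (negbTE ji) andbF mulr0.
  have := congr1 (fun a : 'rV[R]_n => a 0 j) imw.
  by rewrite /w3 map_diag_mx !mul_mx_diag !mxE (negbTE ji) /= conjcK.
pose c0 := re w3 0 i0; pose c4 := re w3 - c0 *: e0.
(* [c4] is orthogonal to [e0], so this matrix fixes [e0], and with it [z] and the imaginary part of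
   [w3]. *)
have [Q' [oQ' cQ' fQ']] := orthm_to_axis c4 i1.
have e0Q' : e0 *m Q' = e0.
  apply: fQ'; last by rewrite mxE eq_sym (negbTE i01) andbF.
  by rewrite /c4 addrC -scaleNr dotR_linr dotR_eb [dotR _ (re w3)]dotRC dotR_ebasis mulr1 addNr.
pose rho := Num.sqrt (dotR c4 c4).
have o4 : same_orbit G (pt (cx (r *: e0) 0) w3)
    (pt (cx (r *: e0) 0) (cx (c0 *: e0 + rho *: e1) (d0 *: e0))).
  have := H1_orbit (cx (r *: e0) 0) w3 (unitary_toC oQ').
  rewrite toC_conj -{2}(cx_reim w3) !cx_toC mul0mx imw3 -!scalemxAl e0Q'.
  by rewrite -[re w3](subrK (c0 *: e0)) -/c4 mulmxDl cQ' -scalemxAl e0Q' -/rho [rho *: _ + _]addrC.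
exists (fun j => match j with (false, false) => r | (true, false) => c0
  | (false, true) => rho | (true, true) => d0 end).
exact: orbit_trans (orbit_trans (orbit_trans o1 o2) o3) o4.
Qed.

(** The reflection in the axis [i1] is unitary and changes the sign of the coordinate
    [(false, true)] of the slice and of no other. *)
Lemma sec1_even d P : hpoly d P -> invariant G P ->
  gpoly (fun j (v : bool * bool -> R) => if j == (false, true) then v (false, true) ^+ 2 else v j)
    (fun j => if j == (false, true) then 2 else 1%N) d (fun v => P (sec1 v)).
Proof.
move=> gP iP; pose flip (v : bool * bool -> R) j := if j == (false, true) then - v j else v j.
apply: (@gpoly_even R _ _ _ _ (false, true) _ flip) => //.
- by move=> j v; rewrite /flip => /negbTE ->.
- exact: hpoly_section sec1_lin gP.
- move=> v; have [Q [oQ eQ _ fQ]] := orthm_flip_axis R i1.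
  have e0Q : e0 *m Q = e0 by apply: fQ; rewrite mxE eq_sym (negbTE i01) andbF.
  have := H1_orbit (cx (v (false, false) *: e0) 0)
    (cx (v (true, false) *: e0 + v (false, true) *: e1) (v (true, true) *: e0))
    (unitary_toC oQ) iP.
  rewrite toC_conj !cx_toC mul0mx mulmxDl -!scalemxAl !e0Q eQ scalerN -scaleNr.
  by move=> ->.
Qed.

(** Cauchy-Schwarz, read off the slice, where the difference of the two sides is a square. *)
Lemma y1_gram x : y1 (true, false) x ^+ 2 + y1 (true, true) x ^+ 2 <=
  y1 (false, false) x * y1 (false, true) x.
Proof.
have [v xv] := sec1_cover x; rewrite !(xv _ (@y1_inv _)) !y1_sec.
move: (v (false, false)) (v (true, false)) (v (false, true)) (v (true, true)) => a b c f.
rewrite -subr_ge0; have -> : a ^+ 2 * (b ^+ 2 + c ^+ 2 + f ^+ 2) - ((a * b) ^+ 2 + (a * f) ^+ 2)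
  = (a * c) ^+ 2 by ring.
exact: sqr_ge0.
Qed.

Lemma y1_realize (A B b c : R) : 0 < A -> b ^+ 2 + c ^+ 2 <= A * B ->
  exists x, [/\ y1 (false, false) x = A, y1 (false, true) x = B,
    y1 (true, false) x = b & y1 (true, true) x = c].
Proof.
move=> A0 AB; pose r := Num.sqrt A; have r0 : r != 0 by rewrite gt_eqF// sqrtr_gt0.
have r2 : r ^+ 2 = A by rewrite sqr_sqrtr// ltW.
(* What is left of [|w|^2] for the coordinate at [i1], once the coordinate at [i0] is prescribed by
   [b] and [c]. *)
pose D := B - (b ^+ 2 + c ^+ 2) / A.
have D0 : 0 <= D by rewrite subr_ge0 ler_pdivrMr// mulrC.
exists (sec1 (fun j => match j with (false, false) => r | (true, false) => b / r
  | (false, true) => Num.sqrt D | (true, true) => c / r end)).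
rewrite !y1_sec r2; split => //.
- rewrite sqr_sqrtr// /D -r2; field; exact: r0.
- by rewrite mulrCA divff// mulr1.
- by rewrite mulrCA divff// mulr1.
Qed.

Definition swap1 x : V := pt (ptr x) (ptl x).

Lemma y1_fft l P : hpoly (2 * l) P -> invariant G P -> gpoly y1 (fun=> 1%N) l P.
Proof.
have den0 : has_denominator G y1 (false, false).
  (* With [r = v (false, false)] the squared coordinate becomes the Gram determinant; the other
     products are Gram entries themselves. *)
  apply: (@section_denominator R _ G _ y1 _ sec1 _ _
    (fun j x => if j == (false, true) then y1 (false, false) x * y1 (false, true) x
       - (y1 (true, false) x ^+ 2 + y1 (true, true) x ^+ 2)
     else y1 j x) _ (section_scale sec1_lin) sec1_even).
    move=> j; case: eqP => _; last exact: (gpoly_gen y1 (fun=> 1%N)).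
    have gg := gpoly_gen y1 (fun=> 1%N).
    apply: gpolyB; first exact: (gpolyM (gg _) (gg _)).
    by apply: gpolyD; apply: (gpolyX (d := 1) 2); exact: gg.
  move=> x x0; have [v xv] := sec1_cover x.
  exists (v (false, false)), v; split => //; first by rewrite (xv _ (@y1_inv _)) y1_sec.
  move=> j; rewrite !(xv _ (@y1_inv _)) !y1_sec; case: j => -[] [] /=; rewrite ?y1_sec; ring.
have den1 : has_denominator G y1 (false, true).
  apply: (swap_denominator (iota := swap1) _ _ _ _ _ den0).
  - by move=> x; rewrite /swap1 ptl_pt ptr_pt ptK.
  - move=> d Q gQ; apply: hpoly_linear_comp gQ => c x x'.
    by rewrite /swap1 ptl_lin ptr_lin pt_lin.
  - move=> Q iQ L x /H1_action[B uB LB]; rewrite /swap1 -{1 2}[x]ptK LB ptl_pt ptr_pt.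
    (* Exchanging [z] and [w] replaces [B] by its conjugate, which is again unitary. *)
    have := H1_orbit (ptr x) (ptl x) (unitary_conj uB) iQ.
    by rewrite map_conjK => ->.
  - by move=> x; rewrite /y1 /swap1 ptr_pt.
  - have yT x : ptr x *m (ptl x)^T = ptl x *m (ptr x)^T.
      apply: trmx_inj; rewrite trmx_mul trmxK [LHS]mx11_scalar [RHS]mx11_scalar.
      by rewrite [in RHS]mxE.
    case=> -[] [].
    + by exists (true, true) => x; rewrite /y1 /swap1 ptl_pt ptr_pt yT.
    + by exists (true, false) => x; rewrite /y1 /swap1 ptl_pt ptr_pt yT.
    + by exists (false, false) => x; rewrite /y1 /swap1 ptr_pt.
    + by exists (false, true) => x; rewrite /y1 /swap1 ptl_pt.
apply: (fft y1_hpoly _ den0 den1) => //.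
- by move=> x; exact: nsq_ge0.
- by move=> x; exact: nsq_ge0.
- have [|x [x0 x1 _ _]] := @y1_realize 1 1 0 0 ltr01.
    by rewrite expr0n addr0 mulr1 ler01.
  by exists x; rewrite x0 x1 ltr01.
- move=> x a x0 x1 xa; have a0 := lt_le_trans x0 xa.
  have [|x' [xa' xB xb xc]] := @y1_realize a (y1 (false, true) x) (y1 (true, false) x)
    (y1 (true, true) x) a0.
    by rewrite (le_trans (y1_gram x))// ler_wpM2r// ltW.
  by exists x' => // -[[] []].
Qed.

Definition p1 (o : option bool) x : R :=
  match o with
  | None => y1 (false, false) x - y1 (false, true) x
  | Some b => y1 (true, b) x
  end.

Lemma unitary_opp1 k : unitary ((-1)%:M : 'M[C]_k).
Proof.
rewrite -diag_const_mx; apply: unitary_diag => j.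
by rewrite mxE /= oppr0 expr0n addr0 sqrrN expr1n.
Qed.

Lemma conj_opp1 k : map_mx (@conjc R) ((-1)%:M : 'M[C]_k) = (-1)%:M.
Proof. by rewrite map_scalar_mx rmorphN1. Qed.

Lemma sqr_y1 x : dotR x x = y1 (false, false) x + y1 (false, true) x.
Proof. by rewrite -{1 2}[x]ptK nsq_pt. Qed.

Lemma H1_model : invariant_model (@H1 R n) p1.
Proof.
split.
- exact: H1_orth.
- by case=> [b|]; [exact: (y1_hpoly (true, b))|apply: gpolyB; exact: y1_hpoly].
- by case=> [b|] L x GL /=; rewrite !(@y1_inv _ L x GL).
- move=> d P od gP iP x; rewrite -[x]ptK.
  (* The scalar matrix -1 acts as the antipodal map, under which a polynomial of odd degree changes
     sign. *)
  have := H1_orbit (ptl x) (ptr x) (unitary_opp1 n) iP.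
  rewrite conj_opp1 !mul_mx_scalar.
  have -> : pt (-1 *: ptl x) (-1 *: ptr x) = -1 *: x.
    rewrite -[in RHS](ptK x) -[RHS]addr0.
    have <- : pt 0 0 = 0 :> V.
      by rewrite /pt row_mx0 realifyE -[RHS]row_mx0; congr row_mx; apply/rowP => j; rewrite !mxE.
    by rewrite -pt_lin !addr0 rmorphN1.
  rewrite (hpolyZ _ _ gP) ptK -signr_odd od expr1 mulN1r => /eqP.
  by rewrite -subr_eq0 opprK -mulr2n mulrn_eq0 => /eqP.
- move=> l P gP iP; apply: gpoly_subst (y1_fft gP iP).
  have gg := gpoly_gen (with_norm p1) (fun=> 1%N).
  case=> -[] []; [exact: (gg (Some (Some true)))|exact: (gg (Some (Some false)))| |].
    apply: gpoly_eq (gpolyZ 2^-1 (gpolyB (gg None) (gg (Some None)))) => // x.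
    by rewrite /with_norm /p1 sqr_y1; field.
  apply: gpoly_eq (gpolyZ 2^-1 (gpolyD (gg None) (gg (Some None)))) => // x.
  by rewrite /with_norm /p1 sqr_y1; field.
- move=> v; pose b := v (Some false); pose c := v (Some true).
  pose Q := b ^+ 2 + c ^+ 2; have Q0 : 0 <= Q by rewrite addr_ge0 ?sqr_ge0.
  (* Makes [A] and [B] at least [1 + Q / 2], hence [A B >= Q], the condition for realising the Gram
     matrix. *)
  exists (`|v None| + 2 + Q) => t Tt.
  have /andP[v1 v2] : - `|v None| <= v None <= `|v None| by rewrite -ler_norml.
  pose A := (t + v None) / 2; pose B := (t - v None) / 2.
  have A1 : 1 + Q / 2 <= A by rewrite /A; lra.
  have B1 : 1 + Q / 2 <= B by rewrite /B; lra.
  have [||x [xA xB xb xc]] := @y1_realize A B b c; first by lra.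
    rewrite -/Q; apply: (@le_trans _ _ ((1 + Q / 2) * (1 + Q / 2))); first by nra.
    by apply: ler_pM => //; lra.
  exists x; first by rewrite sqr_y1 xA xB /A /B; field.
  by case=> [[]|] /=; rewrite ?xb ?xc// xA xB /A /B; field.
Qed.

End UnitaryModel.

(** * Invariants of Sp(m) x SO(q) *)

Section SymplecticModel.
Variables (R : realType) (m q : nat) (k0 : 'I_m) (i0 i1 i2 : 'I_q).
Hypotheses (i01 : i0 != i1) (i02 : i0 != i2) (i12 : i1 != i2) (q_even : ~~ odd q).
Local Notation C := (R[i]).
Local Notation V := 'rV[R]_((m + m + q) + (m + m + q)).
Local Notation e0 := (ebasis R i0).
Local Notation e1 := (ebasis R i1).
Local Notation f0 := (ebasis R (lshift m k0)).
Local Notation G := (actions (@H2 R m q)).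
Implicit Types (x : V) (u : 'rV[C]_(m + m)) (v : 'rV[C]_q) (P : V -> R).

Definition y2 (j : bool * bool) x : R :=
  match j with
  | (false, false) => dotR (re (ptr x)) (re (ptr x))
  | (false, true) => dotR (im (ptr x)) (im (ptr x))
  | (true, false) => dotR (re (ptr x)) (im (ptr x))
  | (true, true) => nsq (ptl x)
  end.

Arguments y2 : simpl never.

Lemma y2_hpoly j : hpoly 2 (y2 j).
Proof.
have hre l : hpoly 1 (fun x => re (ptr x) 0 l).
  rewrite (_ : (fun x => _) = fun x => cRe (ptr x 0 l)); first exact: hpoly_cRe_ptr.
  by apply/funext => x; rewrite [LHS]mxE.
have him l : hpoly 1 (fun x => im (ptr x) 0 l).
  rewrite (_ : (fun x => _) = fun x => cIm (ptr x 0 l)); first exact: hpoly_cIm_ptr.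
  by apply/funext => x; rewrite [LHS]mxE.
case: j => -[] [].
- apply: gpoly_sum => j _; apply: gpolyD; apply: (gpolyX (d := 1) 2).
  + exact: hpoly_cRe_ptl.
  + exact: hpoly_cIm_ptl.
- by apply: gpoly_sum => j _; exact: (gpolyM (hre j) (him j)).
- by apply: gpoly_sum => j _; exact: (gpolyM (him j) (him j)).
- by apply: gpoly_sum => j _; exact: (gpolyM (hre j) (hre j)).
Qed.

Lemma special_orthogonal_real (A : 'M[C]_q) : special_orthogonal A ->
  exists Q : 'M[R]_q, [/\ orthm Q, \det Q = 1 & A = toC Q].
Proof.
move=> [imA [oA dA]]; pose Q := map_mx (@cRe R) A.
have AQ : A = toC Q.
  by apply/matrixP => i j; rewrite !mxE; apply: complex_eq => //=; exact: imA.
exists Q; split => //.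
- rewrite AQ in oA; apply/matrixP => i j.
  have /matrixP/(_ i j) := oA; rewrite /toC map_trmx -map_mxM /= !mxE.
  by move=> /(congr1 (@cRe R)) /= ->; case: eqP.
- by move: dA; rewrite AQ /toC det_map_mx => /(congr1 (@cRe R)).
Qed.

Lemma toC_special_orthogonal (Q : 'M[R]_q) : orthm Q -> \det Q = 1 ->
  special_orthogonal (toC Q).
Proof.
move=> oQ dQ; split=> [i j|]; first by rewrite mxE.
split; first by rewrite /toC map_trmx -map_mxM oQ map_scalar_mx rmorph1.
by rewrite /toC det_map_mx dQ rmorph1.
Qed.

Lemma H2_action L : G L -> exists B (Q : 'M[R]_q), [/\ unitary B, orthm Q &
  forall u v, L (pt u v) = pt (u *m B) (v *m toC Q)].
Proof.
move=> [A [B [D [[uB _] [/special_orthogonal_real[Q [oQ dQ ->]] ->]]]] <-].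
exists B^T, Q^T; split; [exact: unitary_tr|exact: orthm_tr|].
by move=> u v; rewrite act_block /toC map_trmx.
Qed.

Lemma H2_orth L : G L -> orth_map L.
Proof.
move=> [A [B [D [[uB _] [/special_orthogonal_real[Q [oQ _ ->]] ->]]]] <-].
by apply: act_orth; apply: unitary_block => //; exact: unitary_toC.
Qed.

Lemma H2_orbit (B : 'M[C]_(m + m)) (Q : 'M[R]_q) u v : symplectic B -> orthm Q ->
  \det Q = 1 -> same_orbit G (pt u v) (pt (u *m B^T) (v *m toC Q)).
Proof.
move=> sB oQ dQ P iP; have GL : G (act (block_mx B 0 0 (toC Q^T))).
  exists (block_mx B 0 0 (toC Q^T)) => //; exists B, (toC Q^T); split => //; split => //.
  by apply: toC_special_orthogonal; [exact: orthm_tr|rewrite det_tr].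
by have := iP _ (pt u v) GL; rewrite act_block /toC map_trmx trmxK => ->.
Qed.

Lemma y2_inv j : invariant G (y2 j).
Proof.
move=> L x /H2_action[B [Q [uB oQ LB]]]; rewrite -[x]ptK LB.
rewrite -(cx_reim (ptr x)) cx_toC; case: j => -[] [].
- by rewrite /y2 !ptl_pt nsq_unitary.
- by rewrite /y2 !ptr_pt !re_cx !im_cx dotR_orthm.
- by rewrite /y2 !ptr_pt !im_cx dotR_orthm.
- by rewrite /y2 !ptr_pt !re_cx dotR_orthm.
Qed.

(** The slice: [u] is real on one axis, its norm being its only invariant; [v] has its real part on
    the axis [i0] and its imaginary part in the plane of [i0] and [i1]. *)
Definition sec2 (s : bool * bool -> R) : V :=
  pt (cx (s (true, true) *: f0) 0)
     (cx (s (false, false) *: e0) (s (true, false) *: e0 + s (false, true) *: e1)).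

Lemma sec2_lin (c : R) (s t : bool * bool -> R) :
  sec2 (fun j => c * s j + t j) = c *: sec2 s + sec2 t.
Proof.
rewrite /sec2 -pt_lin -!cx_lin; congr (pt (cx _ _) (cx _ _)).
- by rewrite scalerDl scalerA.
- by rewrite scaler0 addr0.
- by rewrite scalerDl scalerA.
- by rewrite !scalerDl scalerDr !scalerA addrACA.
Qed.

Lemma y2_sec s : (y2 (false, false) (sec2 s) = s (false, false) ^+ 2) *
  (y2 (false, true) (sec2 s) = s (true, false) ^+ 2 + s (false, true) ^+ 2) *
  (y2 (true, false) (sec2 s) = s (false, false) * s (true, false)) *
  (y2 (true, true) (sec2 s) = s (true, true) ^+ 2).
Proof.
rewrite /y2 /sec2 !ptl_pt !ptr_pt !re_cx !im_cx nsq_cx (dotR_axis_plane i01) (dotR_plane i01).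
by rewrite dotR0l !dotRZZ !dotR_eb !mulr1 addr0.
Qed.

Lemma symplectic1 : symplectic (1%:M : 'M[C]_(m + m)).
Proof.
split; last by rewrite trmx1 mul1mx mulmx1.
by rewrite -diag_const_mx; apply: unitary_diag => j; rewrite mxE /= expr0n addr0 expr1n.
Qed.

Lemma symplectic_opp1 : symplectic ((-1)%:M : 'M[C]_(m + m)).
Proof.
split; first exact: unitary_opp1.
by rewrite tr_scalar_mx mul_scalar_mx mul_mx_scalar scalerA mulrNN mulr1 scale1r.
Qed.

(** A real orthogonal matrix applied to both halves commutes with [Jmx]. Once the second half of [u]
    is zero and the first is real, it moves [u] to an axis. *)
Lemma symplectic_toC (Q : 'M[R]_m) : orthm Q ->
  symplectic (block_mx (toC Q) 0 0 (toC Q)).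
Proof.
move=> oQ; have uQ := unitary_toC oQ; split; first exact: unitary_block.
have tQ : (toC Q)^T *m toC Q = 1%:M.
  have := mulmx1C oQ => /(congr1 (map_mx (real_complex R))).
  by rewrite map_mxM map_scalar_mx rmorph1 -map_trmx.
rewrite /Jmx tr_block_mx !trmx0; move: (toC Q) tQ => T tT.
rewrite 2!mulmx_block !mulmx0 !mul0mx !addr0 !add0r.
by rewrite mulmxN !mulmx1 mulNmx tT !mul0mx.
Qed.

(** One copy of SU(2) for each pair of coordinates [j] and [m + j], all acting at once. *)
Lemma symplectic_diag (a c : 'rV[C]_m) :
  (forall j, a 0 j * conjc (a 0 j) + c 0 j * conjc (c 0 j) = 1) ->
  symplectic (block_mx (diag_mx a) (diag_mx c)
    (diag_mx (- map_mx (@conjc R) c)) (diag_mx (map_mx (@conjc R) a))).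
Proof.
move=> ac1.
have d1 (r : 'rV[C]_m) : (forall j, r 0 j = 1) -> diag_mx r = 1%:M.
  by move=> r1; rewrite -diag_const_mx; congr diag_mx; apply/rowP => j; rewrite r1 mxE.
have d0 (r : 'rV[C]_m) : (forall j, r 0 j = 0) -> diag_mx r = 0.
  by move=> r0; rewrite -(raddf0 (@diag_mx C m)); congr diag_mx; apply/rowP => j; rewrite r0 mxE.
split.
  rewrite /unitary /= cconjE map_block_mx tr_block_mx !map_diag_mx !tr_diag_mx.
  rewrite mulmx_block !mulmx_diag -!raddfD /= scalar_mx_block; congr block_mx.
  - by apply: d1 => j; rewrite !mxE.
  - by apply: d0 => j; rewrite !mxE rmorphN /= !conjcK; ring.
  - by apply: d0 => j; rewrite !mxE; ring.
  - by apply: d1 => j; rewrite !mxE rmorphN /= !conjcK -(ac1 j); ring.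
rewrite /Jmx tr_block_mx !tr_diag_mx !mulmx_block !mulmx0 !mulmxN !mulmx1.
rewrite !addr0 !add0r !mulNmx !mulmx_diag -!raddfN -!raddfD /=; congr block_mx.
- by apply: d0 => j; rewrite !mxE; ring.
- by apply: d1 => j; rewrite !mxE -(ac1 j); ring.
- rewrite -diag_const_mx; congr diag_mx; apply/rowP => j.
  by rewrite !mxE rmorphN1 -(ac1 j) ?rmorphN /=; ring.
- by apply: d0 => j; rewrite !mxE; ring.
Qed.

(** If the pair has norm [s > 0], take the conjugates of [z] and [w] divided by [s]: they send the
    pair to [(s, 0)]. *)
Lemma su2_align (z w : C) : exists a c : C, [/\ a * conjc a + c * conjc c = 1,
  cIm (z * a + w * c) = 0 & z * - conjc c + w * conjc a = 0].
Proof.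
pose n2 := cRe z ^+ 2 + cIm z ^+ 2 + (cRe w ^+ 2 + cIm w ^+ 2).
have n20 : 0 <= n2 by rewrite !addr_ge0 ?sqr_ge0.
pose s := Num.sqrt n2; have s2 : s ^+ 2 = n2 by rewrite sqr_sqrtr.
have [s0|s0] := eqVneq s 0.
  have : n2 == 0 by rewrite -s2 s0 expr0n.
  rewrite /n2 paddr_eq0 ?addr_ge0 ?sqr_ge0// !paddr_eq0 ?sqr_ge0// !sqrf_eq0.
  move=> /andP[/andP[/eqP a1 /eqP a2] /andP[/eqP a3 /eqP a4]].
  have -> : z = 0 by exact: complex_eq.
  have -> : w = 0 by exact: complex_eq.
  exists 1, 0; rewrite !mul0r !addr0; split => //.
  by rewrite rmorph1 mulr1.
pose T := real_complex R s.
have TJ : conjc T^-1 = T^-1 by rewrite conjc_inv conjc_real.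
have T0 : T != 0 by rewrite -(rmorph0 (real_complex R)) (inj_eq (@complexI R)).
have TT : z * conjc z + w * conjc w = T * T.
  by rewrite !mulcJ -rmorphD /= -/n2 -s2 expr2 rmorphM.
have Ti : cIm T = 0 by [].
clearbody T; exists (conjc z / T), (conjc w / T).
rewrite !rmorphM /= !TJ !conjcK; split.
- transitivity ((z * conjc z + w * conjc w) / (T * T)); first by field; exact: T0.
  by rewrite TT divff// mulf_neq0.
- by rewrite !mulrA -mulrDl TT mulfK.
- by ring.
Qed.

Lemma sec2_cover x : exists s, same_orbit G x (sec2 s).
Proof.
rewrite -[x]ptK; move: (ptl x) (ptr x) => u v {x}.
have trans x x' x'' : same_orbit G x x' -> same_orbit G x' x'' -> same_orbit G x x''.
  by move=> xx' xx'' P iP; rewrite (xx' P iP) xx''.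
have o1mx d : orthm (1%:M : 'M[R]_d) by rewrite /orthm trmx1 mulmx1.
have toC1 : toC (1%:M : 'M[R]_q) = 1%:M by rewrite /toC map_scalar_mx rmorph1.
have [r o1] : exists r : 'rV[R]_m, same_orbit G (pt u v) (pt (row_mx (cx r 0) 0) v).
  move: (lsubmx u) (rsubmx u) (hsubmxK u) => z w <-.
  have /choice[f fP] : forall j, exists ac : C * C,
      [/\ ac.1 * conjc ac.1 + ac.2 * conjc ac.2 = 1,
      cIm (z 0 j * ac.1 + w 0 j * ac.2) = 0 &
      z 0 j * - conjc ac.2 + w 0 j * conjc ac.1 = 0].
    by move=> j; have [a [c H]] := su2_align (z 0 j) (w 0 j); exists (a, c).
  pose a : 'rV[C]_m := \row_j (f j).1; pose c : 'rV[C]_m := \row_j (f j).2.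
  have sB := @symplectic_diag a c.
  exists (re (z *m diag_mx a + w *m diag_mx c)).
  have := H2_orbit (row_mx z w) v (sB _) (o1mx q) (det1 R q).
  rewrite toC1 mulmx1 tr_block_mx !tr_diag_mx mul_row_block.
  have -> : z *m diag_mx a + w *m diag_mx c = cx (re (z *m diag_mx a + w *m diag_mx c)) 0.
    rewrite -{1}(cx_reim (z *m diag_mx a + w *m diag_mx c)); congr cx.
    apply/rowP => j; rewrite mxE !mul_mx_diag !mxE; exact: (let: And3 _ h _ := fP j in h).
  have -> : z *m diag_mx (- map_mx (@conjc R) c) + w *m diag_mx (map_mx (@conjc R) a) = 0.
    apply/rowP => j; rewrite !mul_mx_diag !mxE; exact: (let: And3 _ _ h := fP j in h).
  rewrite re_cx; apply => j; rewrite !mxE; exact: (let: And3 h _ _ := fP j in h).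
have [Q [oQ rQ _]] := orthm_to_axis r k0; set s := Num.sqrt _ in rQ.
have o2 : same_orbit G (pt (row_mx (cx r 0) 0) v) (pt (cx (s *: f0) 0) v).
  have := H2_orbit (row_mx (cx r 0) 0) v (symplectic_toC (orthm_tr oQ)) (o1mx q) (det1 R q).
  rewrite toC1 mulmx1 tr_block_mx !trmx0 mul_row_block !mulmx0 !mul0mx !addr0.
  have -> : (toC Q^T)^T = toC Q by rewrite /toC map_trmx trmxK.
  rewrite cx_toC mul0mx rQ.
  suff -> : row_mx (cx (s *: ebasis R k0) 0) 0 = cx (s *: f0) 0 by [].
  apply/rowP => j; rewrite mxE; case: splitP => l jl; rewrite !mxE -!val_eqE /= jl //=.
  by rewrite (gtn_eqF (leq_trans (ltn_ord k0) (leq_addr _ _))) mulr0.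
have [Q' [rho [oQ' dQ' aQ' [beta bQ']]]] := orthm_pair_det1 (re v) (im v) i01 i02 i12.
have o3 := H2_orbit (cx (s *: f0) 0) v symplectic1 oQ' dQ'.
rewrite trmx1 mulmx1 -{2}(cx_reim v) cx_toC aQ' bQ' in o3.
exists (fun j => match j with (false, false) => Num.sqrt (dotR (re v) (re v))
  | (true, false) => beta | (false, true) => rho | (true, true) => s end).
exact: trans (trans _ _ _ o1 o2) o3.
Qed.

Lemma sec2_flip P s : invariant G P ->
  P (sec2 (fun j => if j == (false, true) then - s j else s j)) = P (sec2 s) /\
  P (sec2 (fun j => if j == (true, true) then - s j else s j)) = P (sec2 s).
Proof.
move=> iP; split.
  have [Q [oQ eQ dQ fQ]] := orthm_flip_axis R i1.
  (* A second reflection, in an axis that the slice does not use, restores determinant 1. *)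
  have [Q' [oQ' _ dQ' fQ']] := orthm_flip_axis R i2.
  have dd : \det (Q *m Q') = 1 by rewrite det_mulmx dQ dQ' mulrNN mulr1.
  have ez (j l : 'I_q) : j != l -> ebasis R j 0 l = 0.
    by move=> jl; rewrite mxE eq_sym (negbTE jl) andbF.
  have := H2_orbit (cx (s (true, true) *: f0) 0) (cx (s (false, false) *: e0)
    (s (true, false) *: e0 + s (false, true) *: e1)) symplectic1 (orthmM oQ oQ') dd iP.
  rewrite trmx1 mulmx1 cx_toC mulmxDl -!scalemxAl !mulmxA.
  rewrite (fQ e0 (ez _ _ i01)) (fQ' e0 (ez _ _ i02)) eQ mulNmx (fQ' e1 (ez _ _ i12)).
  by rewrite scalerN -scaleNr => ->.
have o1 : orthm (1%:M : 'M[R]_q) by rewrite /orthm trmx1 mulmx1.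
have := H2_orbit (cx (s (true, true) *: f0) 0) (cx (s (false, false) *: e0)
    (s (true, false) *: e0 + s (false, true) *: e1)) symplectic_opp1 o1 (det1 R q) iP.
rewrite tr_scalar_mx mul_mx_scalar /toC map_scalar_mx rmorph1 mulmx1.
have -> : -1 *: cx (s (true, true) *: f0) 0 = cx (- s (true, true) *: f0) 0.
  apply/rowP => j; rewrite !mxE; apply: complex_eq; rewrite ?cReM ?cImM /=; ring.
by move=> ->.
Qed.

Lemma y2_gram x : y2 (true, false) x ^+ 2 <= y2 (false, false) x * y2 (false, true) x.
Proof.
have [s xs] := sec2_cover x; rewrite !(xs _ (@y2_inv _)) !y2_sec.
move: (s (false, false)) (s (true, false)) (s (false, true)) => a b c.
rewrite -subr_ge0; have -> : a ^+ 2 * (b ^+ 2 + c ^+ 2) - (a * b) ^+ 2 = (a * c) ^+ 2 by ring.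
exact: sqr_ge0.
Qed.

Lemma y2_realize (A B b D : R) : 0 < A -> b ^+ 2 <= A * B -> 0 <= D ->
  exists x, [/\ y2 (false, false) x = A, y2 (false, true) x = B,
    y2 (true, false) x = b & y2 (true, true) x = D].
Proof.
move=> A0 AB D0; pose r := Num.sqrt A; have r0 : r != 0 by rewrite gt_eqF// sqrtr_gt0.
have r2 : r ^+ 2 = A by rewrite sqr_sqrtr// ltW.
pose E := B - b ^+ 2 / A.
have E0 : 0 <= E by rewrite subr_ge0 ler_pdivrMr// mulrC.
exists (sec2 (fun j => match j with (false, false) => r | (true, false) => b / r
  | (false, true) => Num.sqrt E | (true, true) => Num.sqrt D end)).
rewrite !y2_sec r2 (sqr_sqrtr D0) (sqr_sqrtr E0); split => //.
- by rewrite /E -r2; field; exact: r0.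
- by rewrite mulrCA divff// mulr1.
Qed.

(** Real matrices treat the two parts of [v] alike, so this exchange commutes with the action
    although it is not complex linear. *)
Definition swap2 x : V := pt (ptl x) (cx (im (ptr x)) (re (ptr x))).

Lemma y2_fft l P : hpoly (2 * l) P -> invariant G P -> gpoly y2 (fun=> 1%N) l P.
Proof.
pose e1 (j : bool * bool) (s : bool * bool -> R) :=
  if j == (false, true) then s (false, true) ^+ 2 else s j.
pose w1 (j : bool * bool) := if j == (false, true) then 2 else 1%N.
(* Two slice coordinates occur to even powers only, [(false, true)] because of reflections and
   [(true, true)] because of -1 in Sp(m); [gpoly_even] is applied once for each. *)
pose e2 (j : bool * bool) (s : bool * bool -> R) :=
  if j == (true, true) then e1 (true, true) s ^+ 2 else e1 j s.
pose w2 (j : bool * bool) := if j == (true, true) then 2 else w1 j.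
have even d Q : hpoly d Q -> invariant G Q -> gpoly e2 w2 d (fun s => Q (sec2 s)).
  move=> gQ iQ.
  pose flip j' (s : bool * bool -> R) (j : bool * bool) := if j == j' then - s j else s j.
  apply: (@gpoly_even R _ _ e1 w1 (true, true) _ (flip (true, true))) => //.
  - by case=> -[] [].
  - apply: (@gpoly_even R _ _ (fun j s => s j) (fun=> 1%N) (false, true) _ (flip (false, true))) => //.
    + by case=> -[] [].
    + exact: hpoly_section sec2_lin gQ.
    + by move=> s; rewrite (sec2_flip s iQ).1.
  - by move=> s; rewrite (sec2_flip s iQ).2.
have gg := gpoly_gen y2 (fun=> 1%N).
have den0 : has_denominator G y2 (false, false).
  (* With [r = s (false, false)] the two squared coordinates become [r^2 |u|^2] and the Gram
     determinant of the real and imaginary parts of [v]. *)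
  apply: (@section_denominator R _ G _ y2 _ sec2 e2 w2 (fun j x =>
     if j == (true, true) then y2 (false, false) x * y2 (true, true) x else
     if j == (false, true) then y2 (false, false) x * y2 (false, true) x - y2 (true, false) x ^+ 2
     else y2 j x) _ (section_scale sec2_lin) even).
    case=> -[] [] /=.
    + exact: (gpolyM (gg _) (gg _)).
    + exact: (gg (true, false)).
    + apply: gpolyB; first exact: (gpolyM (gg _) (gg _)).
      by apply: (gpolyX (d := 1) 2); exact: gg.
    + exact: (gg (false, false)).
  move=> x x0; have [s xs] := sec2_cover x.
  exists (s (false, false)), s; split => //; first by rewrite (xs _ (@y2_inv _)) y2_sec.
  by case=> -[] []; rewrite /e2 /e1 /= !(xs _ (@y2_inv _)) !y2_sec; ring.
have den1 : has_denominator G y2 (false, true).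
  apply: (swap_denominator (iota := swap2) _ _ _ _ _ den0).
  - by move=> x; rewrite /swap2 ptl_pt ptr_pt re_cx im_cx cx_reim ptK.
  - move=> d Q gQ; apply: hpoly_linear_comp gQ => c x x'.
    rewrite /swap2 -pt_lin -ptl_lin -cx_lin; congr (pt _ (cx _ _)).
      by rewrite ptr_lin; apply/rowP => j; rewrite !mxE cImD cImM /= mul0r addr0.
    by rewrite ptr_lin; apply/rowP => j; rewrite !mxE cReD cReM /= mul0r subr0.
  - move=> Q iQ L x GL; have := GL => /H2_action[B [D [uB oD LB]]].
    have lL : ptl (L x) = ptl x *m B by rewrite -{1}[x]ptK LB ptl_pt.
    have rL : ptr (L x) = ptr x *m toC D by rewrite -{1}[x]ptK LB ptr_pt.
    rewrite -(iQ L (swap2 x) GL) /swap2 LB lL rL.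
    have E : ptr x *m toC D = cx (re (ptr x) *m D) (im (ptr x) *m D).
      by rewrite -cx_toC cx_reim.
    by rewrite E re_cx im_cx cx_toC.
  - by move=> x; rewrite /y2 /swap2 ptr_pt im_cx.
  - case=> -[] [].
    + by exists (true, true) => x; rewrite /y2 /swap2 ptl_pt.
    + by exists (true, false) => x; rewrite /y2 /swap2 ptr_pt re_cx im_cx dotRC.
    + by exists (false, false) => x; rewrite /y2 /swap2 ptr_pt im_cx.
    + by exists (false, true) => x; rewrite /y2 /swap2 ptr_pt re_cx.
apply: (fft y2_hpoly _ den0 den1) => //.
- by move=> x; exact: dotR_ge0.
- by move=> x; exact: dotR_ge0.
- have [||x [x0 x1 _ _]] := @y2_realize 1 1 0 0 ltr01 => //.
    by rewrite expr0n mulr1 ler01.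
  by exists x; rewrite x0 x1 ltr01.
- move=> x a x0 x1 xa; have a0 := lt_le_trans x0 xa.
  have [||x' [xa' xB xb xc]] := @y2_realize a (y2 (false, true) x) (y2 (true, false) x)
    (y2 (true, true) x) a0.
  + by rewrite (le_trans (y2_gram x))// ler_wpM2r// ltW.
  + exact: nsq_ge0.
  + by exists x' => // -[[] []].
Qed.

(** The entry [None] equals [(|v|^2 - |u|^2) / 2]; with [|x|^2] the three span the same quadratics
    as the [y2]. *)
Definition p2 (o : option bool) x : R :=
  match o with
  | None => y2 (false, false) x + y2 (false, true) x - dotR x x / 2
  | Some false => y2 (false, false) x - y2 (false, true) x
  | Some true => y2 (true, false) x
  end.

Lemma sqr_y2 x : dotR x x = y2 (false, false) x + y2 (false, true) x + y2 (true, true) x.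
Proof. by rewrite -{1 2}[x]ptK nsq_pt (nsqE (ptr x)) addrC. Qed.

Lemma H2_model : invariant_model (@H2 R m q) p2.
Proof.
split.
- exact: H2_orth.
- case=> [[]|].
  + exact: (y2_hpoly (true, false)).
  + by apply: gpolyB; exact: y2_hpoly.
  + apply: gpolyB; first by apply: gpolyD; exact: y2_hpoly.
    by apply: gpoly_eq (gpolyZ 2^-1 (hpoly_sqr R _)) => // x; rewrite mulrC.
- by case=> [[]|] L x GL /=; rewrite !(@y2_inv _ L x GL)// (H2_orth GL).2.
- move=> d P od gP iP x.
  have oN : orthm ((-1)%:M : 'M[R]_q).
    by rewrite /orthm tr_scalar_mx -scalar_mxM mulrNN mulr1.
  (* The parity of [q] enters here: -1 has determinant 1 for even [q], so the antipodal map comes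
     from the group. *)
  have dN : \det ((-1)%:M : 'M[R]_q) = 1.
    by rewrite det_scalar -signr_odd (negbTE q_even) expr0.
  have := H2_orbit (ptl x) (ptr x) symplectic_opp1 oN dN iP.
  rewrite tr_scalar_mx /toC map_scalar_mx !mul_mx_scalar (rmorphN1 (real_complex R)) ptK.
  have -> : pt (-1 *: ptl x) (-1 *: ptr x) = -1 *: x.
    rewrite -[in RHS](ptK x) -[RHS]addr0.
    have <- : pt 0 0 = 0 :> V.
      by rewrite /pt row_mx0 realifyE -[RHS]row_mx0; congr row_mx; apply/rowP => j; rewrite !mxE.
    by rewrite -pt_lin !addr0 (rmorphN1 (real_complex R)).
  rewrite (hpolyZ _ _ gP) -signr_odd od expr1 mulN1r => /eqP.
  by rewrite -subr_eq0 opprK -mulr2n mulrn_eq0 => /eqP.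
- move=> l P gP iP; apply: gpoly_subst (y2_fft gP iP).
  have gg := gpoly_gen (with_norm p2) (fun=> 1%N).
  have gs := gpolyD (gg (Some None)) (gpolyZ 2^-1 (gg None)).
  case=> -[] [].
  + apply: gpoly_eq (gpolyB (gpolyZ 2^-1 (gg None)) (gg (Some None))) => // x.
    by rewrite /with_norm /p2 sqr_y2; field.
  + exact: (gg (Some (Some true))).
  + apply: gpoly_eq (gpolyZ 2^-1 (gpolyB gs (gg (Some (Some false))))) => // x.
    by rewrite /with_norm /p2; field.
  + apply: gpoly_eq (gpolyZ 2^-1 (gpolyD gs (gg (Some (Some false))))) => // x.
    by rewrite /with_norm /p2; field.
- move=> v; pose b := v (Some true); pose c := v (Some false); pose a := v None.
  pose Q := b ^+ 2; have Q0 : 0 <= Q by rewrite sqr_ge0.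
  (* Makes [A] and [B] at least [1 + Q / 2], hence [A B >= Q], and keeps [|u|^2 = t / 2 - a]
     nonnegative. *)
  exists (2 * (`|a| + `|c| + 2 + Q)) => t Tt.
  have /andP[a1 a2] : - `|a| <= a <= `|a| by rewrite -ler_norml.
  have /andP[c1 c2] : - `|c| <= c <= `|c| by rewrite -ler_norml.
  pose A := (a + t / 2 + c) / 2; pose B := (a + t / 2 - c) / 2.
  have A1 : 1 + Q / 2 <= A by rewrite /A; lra.
  have B1 : 1 + Q / 2 <= B by rewrite /B; lra.
  have [|||x [xA xB xb xD]] := @y2_realize A B b (t / 2 - a); first by lra.
  + rewrite -/Q; apply: (@le_trans _ _ ((1 + Q / 2) * (1 + Q / 2))); first by nra.
    by apply: ler_pM => //; lra.
  + by lra.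
  have xt : dotR x x = t by rewrite sqr_y2 xA xB xD /A /B; field.
  exists x => //; case=> [[]|] /=; rewrite ?xb// xA xB ?xt /A /B; [rewrite -/c|rewrite -/a]; by field.
Qed.

End SymplecticModel.

(** * Orbit distances *)

Section OrbitDistance.
Variable R : realType.
Local Notation C := (R[i]).

Lemma sphere_dotR_le1 N (x y : 'rV[R]_N) : sphere x -> sphere y -> -1 <= dotR x y <= 1.
Proof.
rewrite /sphere /= => x1 y1.
have h (c : R) : 0 <= c ^+ 2 * 1 + 2 * c * dotR x y + 1.
  have := dotR_ge0 (c *: x + y).
  rewrite dotR_linl dotRC dotR_linl [dotR y (_ + _)]dotRC dotR_linl x1 y1 (dotRC y x).
  by congr (0 <= _); ring.
by apply/andP; split; [have := h 1|have := h (-1)]; lra.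
Qed.

Lemma acos_anti (a b : R) : -1 <= a -> b <= 1 -> a <= b -> acos b <= acos a.
Proof.
move=> a1 b1 ab; have A : -1 <= a <= 1 by rewrite a1 (le_trans ab).
have B : -1 <= b <= 1 by rewrite (le_trans a1 ab).
rewrite leNgt; apply/negP => lt_ab.
have ia (c : R) : -1 <= c <= 1 -> acos c \in `[0, pi].
  by move=> c1; rewrite in_itv/= acos_ge0// acos_lepi.
have := ltr_cos (ia _ A) (ia _ B); rewrite lt_ab => /esym.
by rewrite !acosK ?in_itv//= ltNge ab.
Qed.

Section Distance.
Variables (k : nat) (H : set 'M[C]_k).
Hypothesis H_orth : forall A, H A -> orth_map (act A).
Implicit Types (x y : 'rV[R]_(k + k)) (A : 'M[C]_k).

Lemma act_sphere A y : H A -> sphere y -> sphere (act A y).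
Proof. by move=> /H_orth[_ oA]; rewrite /sphere /= oA. Qed.

Lemma odist_const x y (c : R) : H !=set0 -> (forall A, H A -> dotR x (act A y) = c) ->
  odist H x y = acos c.
Proof.
move=> [A0 HA0] xc; rewrite -[RHS]inf1 /odist; congr inf; apply/seteqP; split=> r /=.
  by move=> [A HA <-]; rewrite /gdist xc.
by move=> ->; exists A0 => //; rewrite /gdist xc.
Qed.

Lemma odist_dotR_le x y (c : R) A : sphere x -> sphere y -> H A ->
  odist H x y = acos c -> -1 <= c <= 1 -> dotR x (act A y) <= c.
Proof.
move=> Sx Sy HA xyc c1; rewrite leNgt; apply/negP => lt_c.
have d1 := sphere_dotR_le1 Sx (act_sphere HA Sy).
have : acos c <= acos (dotR x (act A y)).
  rewrite -xyc /odist; apply: ge_inf; last by exists A.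
  exists 0 => _ [B HB <-]; apply: acos_ge0.
  exact: sphere_dotR_le1 Sx (act_sphere HB Sy).
move=> le_ac; have/andP[_ d1'] := d1; have/andP[c1' _] := c1.
have eq_ac : acos c = acos (dotR x (act A y)).
  by apply/eqP; rewrite eq_le le_ac acos_anti// ltW.
have := congr1 cos eq_ac; rewrite !acosK ?in_itv//= => ec.
by rewrite -ec ltxx in lt_c.
Qed.

(* [x'] plays the projection of [x] to a subspace containing the orbit of [y]. *)
Lemma odist0_project x x' y : H !=set0 -> sphere x -> sphere y -> odist H x y = 0 ->
  dotR x' (x - x') = 0 -> (forall A, H A -> dotR (x - x') (act A y) = 0) -> x = x'.
Proof.
move=> H0 Sx Sy xy0 px orth.
(* [c] bounds the product of [x'] with every [act A y], since [|x' - act A y|^2 >= 0]. If [|x'| < 1]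
   then [c < 1], and the distance would be at least [acos c > 0]; the infimum is not assumed to be
   attained. *)
pose c := (dotR x' x' + 1) / 2.
have dB (a b z : 'rV[R]_(k + k)) : dotR (a - b) z = dotR a z - dotR b z.
  by rewrite addrC -scaleN1r dotR_linl addrC mulN1r.
have xx : dotR x x = dotR x' x' + dotR (x - x') (x - x').
  have e : dotR x' x = dotR x' x'.
    by move/eqP: px; rewrite dotRC dB subr_eq0 dotRC => /eqP.
  by rewrite dB (dotRC x (_ - _)) (dotRC x' (_ - _)) !dB (dotRC x x') e; ring.
have bound A : H A -> dotR x (act A y) <= c.
  move=> HA; have := orth A HA; rewrite dB => /eqP; rewrite subr_eq0 => /eqP ->.
  have := dotR_ge0 (x' - act A y); have SA := act_sphere HA Sy; move: SA.
  rewrite /sphere /= => SA; rewrite dB !(dotRC _ (_ - _)) !dB SA (dotRC (act A y) x') /c.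
  by lra.
have [c1|c1] := leP 1 c; last first.
  have c0 : -1 <= c < 1.
    by rewrite c1 andbT /c; have := dotR_ge0 x'; lra.
  have : acos c <= odist H x y.
    apply: lb_le_inf; first by have [A HA] := H0; exists (gdist x (act A y)); exists A.
    move=> _ [A HA <-]; apply: acos_anti => //; last exact: bound.
      by have /andP[] := sphere_dotR_le1 Sx (act_sphere HA Sy).
    exact: ltW.
  by rewrite xy0 leNgt acos_gt0.
have xx0 : dotR (x - x') (x - x') = 0.
  apply/eqP; rewrite eq_le dotR_ge0 andbT; move: Sx xx; rewrite /sphere /= /c in c1 *.
  by move=> -> e; lra.
by move/eqP: xx0; rewrite dotR_eq0 subr_eq0 => /eqP.
Qed.

End Distance.

Section Parts.
Variables p q : nat.
Implicit Types (u : 'rV[C]_p) (v : 'rV[C]_q).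

Lemma dotR_row_mx (a a' : 'rV[R]_p) (b b' : 'rV[R]_q) :
  dotR (row_mx a b) (row_mx a' b') = dotR a a' + dotR b b'.
Proof.
rewrite /dotR big_split_ord /=; congr (_ + _); apply: eq_bigr => j _.
  by rewrite !row_mxEl.
by rewrite !row_mxEr.
Qed.

End Parts.

Lemma dotR_row_mx2 p (a a' b b' : 'rV[R]_p) :
  dotR (row_mx a b) (row_mx a' b') = dotR a a' + dotR b b'.
Proof. exact: dotR_row_mx. Qed.

Lemma dotR_pt p q (u u' : 'rV[C]_p) (v v' : 'rV[C]_q) :
  dotR (pt u v) (pt u' v') = (dotR (re u) (re u') + dotR (im u) (im u')) +
    (dotR (re v) (re v') + dotR (im v) (im v')).
Proof.
rewrite /pt !realifyE /re /im !map_row_mx dotR_row_mx2 !dotR_row_mx.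
exact: addrACA.
Qed.

(** By Cauchy-Binet [det(a, b)] times the conjugate of [det(a, c)] is a combination of the three
    Hermitian products, so one determinant vanishes. Lagrange's identity then makes the product of
    two squared norms zero. *)
Lemma orth3 (a1 a2 b1 b2 c1 c2 : C) :
  a1 * conjc b1 + a2 * conjc b2 = 0 -> a1 * conjc c1 + a2 * conjc c2 = 0 ->
  b1 * conjc c1 + b2 * conjc c2 = 0 ->
  [\/ a1 = 0 /\ a2 = 0, b1 = 0 /\ b2 = 0 | c1 = 0 /\ c2 = 0].
Proof.
move=> ab ac bc.
have nz (z w : C) : z * conjc z + w * conjc w = 0 -> z = 0 /\ w = 0.
  rewrite !mulcJ -rmorphD /= => /(congr1 (@cRe R)) /= /eqP.
  rewrite paddr_eq0 ?addr_ge0 ?sqr_ge0// !paddr_eq0 ?sqr_ge0// !sqrf_eq0.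
  by move=> /andP[/andP[/eqP? /eqP?] /andP[/eqP? /eqP?]]; split; exact: complex_eq.
have lagrange (x1 x2 y1 y2 : C) : x1 * conjc y1 + x2 * conjc y2 = 0 ->
    x1 * y2 - x2 * y1 = 0 ->
    (x1 * conjc x1 + x2 * conjc x2) * (y1 * conjc y1 + y2 * conjc y2) = 0.
  move=> xy dxy; transitivity ((x1 * conjc y1 + x2 * conjc y2) *
      conjc (x1 * conjc y1 + x2 * conjc y2) +
      (x1 * y2 - x2 * y1) * conjc (x1 * y2 - x2 * y1)).
    by rewrite rmorphB !rmorphD !rmorphM /= !conjcK; ring.
  by rewrite xy dxy !mul0r addr0.
have : (a1 * b2 - a2 * b1) * conjc (a1 * c2 - a2 * c1) = 0.
  transitivity ((a1 * conjc a1 + a2 * conjc a2) * (b1 * conjc c1 + b2 * conjc c2) -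
      conjc (a1 * conjc b1 + a2 * conjc b2) * (a1 * conjc c1 + a2 * conjc c2)).
    by rewrite rmorphB !rmorphD !rmorphM /= !conjcK; ring.
  by rewrite ac bc !mulr0 subrr.
move/eqP; rewrite mulf_eq0 conjc_eq0 => /orP[] /eqP d0.
  have /eqP := lagrange _ _ _ _ ab d0; rewrite mulf_eq0 => /orP[] /eqP /nz.
    by constructor 1.
  by constructor 2.
have /eqP := lagrange _ _ _ _ ac d0; rewrite mulf_eq0 => /orP[] /eqP /nz.
  by constructor 1.
by constructor 3.
Qed.

End OrbitDistance.

(** * Orthogonality of U(n)-orbits *)

Section UnitaryOrbits.
Variables (R : realType) (n : nat).
Local Notation C := (R[i]).
Implicit Types (z w : 'rV[C]_n).

Lemma dotR_pt_sum z w z' w' : dotR (pt z w) (pt z' w') =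
  \sum_j cRe (conjc (z' 0 j) * z 0 j + w' 0 j * conjc (w 0 j)).
Proof.
rewrite dotR_pt /dotR -!big_split; apply: eq_bigr => j _ /=.
by rewrite !mxE cReD !cReM !cReJ !cImJ; ring.
Qed.

Lemma H1_perp_act z w z' w' (B : 'M[C]_n) : unitary B ->
  (forall A, @H1 R n A -> dotR (pt z w) (act A (pt z' w')) <= 0) ->
  dotR (pt z w) (pt (z' *m B) (w' *m map_mx (@conjc R) B)) <= 0.
Proof.
move=> uB h; have := h (block_mx B^T 0 0 (map_mx (@cconj R) B^T)).
rewrite act_block cconjE trmxK map_trmx trmxK; apply.
by exists B^T; [exact: unitary_tr|rewrite cconjE ?map_trmx].
Qed.

(* Test against the unitaries that swap [i] and [j] after multiplying the
   coordinate [i] by [tau]. *)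
Lemma H1_perp z w z' w' :
  (forall A, @H1 R n A -> dotR (pt z w) (act A (pt z' w')) <= 0) ->
  forall i j, z 0 j * conjc (z' 0 i) + conjc (w 0 j) * w' 0 i = 0.
Proof.
move=> h i j; pose s := tperm i j.
pose g l := z 0 l * conjc (z' 0 (s l)) + conjc (w 0 l) * w' 0 (s l).
pose D (e tau : C) : 'rV[C]_n := \row_l (if l == i then tau else e).
(* The phase [e] on the remaining coordinates allows the rest of the sum to change sign
   independently of the term at [j]. *)
have unit_sum (e tau : C) : cRe e ^+ 2 + cIm e ^+ 2 = 1 -> cRe tau ^+ 2 + cIm tau ^+ 2 = 1 ->
    cRe (conjc tau * g j) + \sum_(l | l != j) cRe (conjc e * g l) <= 0.
  move=> e1 tau1.
  have uD : unitary (diag_mx (D e tau)) by apply: unitary_diag => l; rewrite mxE; case: eqP.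
  have op : orthm (perm_mx s : 'M[R]_n).
    by rewrite /orthm tr_perm_mx -perm_mxM mulgV perm_mx1.
  have := H1_perp_act (unitaryM uD (unitary_toC op)) h.
  rewrite map_mxM toC_conj map_diag_mx !mulmxA dotR_pt_sum.
  have col (r : 'rV[C]_n) l : (r *m toC (perm_mx s)) 0 l = r 0 (s l).
    by rewrite /toC map_perm_mx -[s in perm_mx s]tpermV -col_permE mxE.
  have Ds l : D e tau 0 (s l) = if l == j then tau else e.
    have sj : s j = i by exact: tpermR.
    by rewrite mxE -{1}sj (inj_eq (@perm_inj _ s)).
  have zD l : (z' *m diag_mx (D e tau)) 0 (s l) = z' 0 (s l) * (if l == j then tau else e).
    by rewrite mul_mx_diag [LHS]mxE Ds.
  have wD l : (w' *m diag_mx (map_mx (@conjc R) (D e tau))) 0 (s l) =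
      w' 0 (s l) * conjc (if l == j then tau else e).
    by rewrite mul_mx_diag [LHS]mxE [X in _ * X]mxE Ds.
  rewrite (bigD1 j)//=; congr (_ + _ <= 0).
    rewrite !col zD wD eqxx; congr cRe; rewrite rmorphM /g /=; ring.
  apply: eq_bigr => l lj; rewrite !col zD wD (negbTE lj).
  by congr cRe; rewrite rmorphM /g /=; ring.
have n1 : cRe (1 : C) ^+ 2 + cIm (1 : C) ^+ 2 = 1 by rewrite /= expr0n addr0 expr1n.
have ni : cRe ('i%C : C) ^+ 2 + cIm ('i%C : C) ^+ 2 = 1.
  by rewrite /= expr0n add0r expr1n.
have neg (t : C) : cRe t ^+ 2 + cIm t ^+ 2 = 1 -> cRe (- t) ^+ 2 + cIm (- t) ^+ 2 = 1.
  by case: t => a b /=; rewrite !sqrrN.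
(* The inequalities for [e] and [- e] add up so that the rest cancels; [tau] and [- tau] then turn
   the bound into an equality. The values 1 and ['i] of [tau] give the real and imaginary parts of
   [g j]. *)
have zero (tau : C) : cRe tau ^+ 2 + cIm tau ^+ 2 = 1 -> cRe (conjc tau * g j) = 0.
  move=> t1; have h1 := unit_sum 1 tau n1 t1; have h2 := unit_sum 1 (- tau) n1 (neg _ t1).
  have h3 := unit_sum (-1) tau (neg _ n1) t1; have h4 := unit_sum (-1) (- tau) (neg _ n1) (neg _ t1).
  have eN (e : C) l : cRe (conjc (- e) * g l) = - cRe (conjc e * g l).
    by rewrite !cReM !cReJ !cImJ; case: e => a b /=; ring.
  have sN : \sum_(l | l != j) cRe (conjc (-1) * g l) = - \sum_(l | l != j) cRe (conjc 1 * g l).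
    by rewrite -sumrN; apply: eq_bigr => l _; exact: eN.
  by rewrite sN in h3 h4; rewrite eN in h2 h4; lra.
have gj : g j = 0.
  apply: complex_eq; have := zero _ n1; have := zero _ ni; rewrite !cReM !cReJ !cImJ /=; lra.
by move: gj; rewrite /g /s tpermR.
Qed.

(** A point is read as [n] vectors [(z_j, conj w_j)] of C^2. [H1_perp] makes each vector of one
    point orthogonal to each vector of another, so a nonzero one from each of the three points
    contradicts [orth3]. *)
Lemma H1_no_perp_triple (x1 x2 x3 : 'rV[R]_((n + n) + (n + n))) :
  sphere x1 -> sphere x2 -> sphere x3 ->
  ~ [/\ forall A, @H1 R n A -> dotR x1 (act A x2) <= 0,
        forall A, @H1 R n A -> dotR x1 (act A x3) <= 0 &
        forall A, @H1 R n A -> dotR x2 (act A x3) <= 0].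
Proof.
move=> S1 S2 S3 [].
have nonzero (x : 'rV[R]_((n + n) + (n + n))) : sphere x -> exists j, ~ (ptl x 0 j = 0 /\ conjc (ptr x 0 j) = 0).
  move=> Sx; apply: contrapT => /forallNP x0; have := sphere_neq0 Sx; case/eqP.
  have [zl zr] : ptl x = 0 /\ ptr x = 0.
    split; apply/rowP => j; have [l r] := contrapT (x0 j); rewrite [RHS]mxE//.
    by apply/eqP; rewrite -conjc_eq0 r.
  have nsq0 z : z = 0 -> nsq z = 0.
    by move=> ->; rewrite /nsq big1// => j _; rewrite mxE /= expr0n addr0.
  by apply/eqP; rewrite -dotR_eq0 -[x]ptK nsq_pt (nsq0 _ zl) (nsq0 _ zr) addr0.
have [j1 n1] := nonzero _ S1; have [j2 n2] := nonzero _ S2; have [j3 n3] := nonzero _ S3.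
rewrite -(ptK x1) -(ptK x2) -(ptK x3) => /H1_perp p12 /H1_perp p13 /H1_perp p23.
have e (a a' b b' : C) : a * conjc a' + conjc b * b' = 0 ->
    a * conjc a' + conjc b * conjc (conjc b') = 0 by rewrite conjcK.
by case: (orth3 (e _ _ _ _ (p12 j2 j1)) (e _ _ _ _ (p13 j3 j1)) (e _ _ _ _ (p23 j3 j2))).
Qed.

End UnitaryOrbits.

(** * The three orthogonal orbits of Sp(m) x SO(q) *)

Section NotIsometric.
Variables (R : realType) (n m q : nat) (k0 : 'I_m) (i0 : 'I_q).
Local Notation C := (R[i]).
Implicit Types (u : 'rV[C]_(m + m)) (a b : 'rV[R]_q).

Let tri u a b : 'rV[R]_((m + m + q) + (m + m + q)) := pt u (cx a b).

Let triK x : tri (ptl x) (re (ptr x)) (im (ptr x)) = x.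
Proof. by rewrite /tri cx_reim ptK. Qed.

Let dotC u u' := dotR (re u) (re u') + dotR (im u) (im u').

Let dotR_tri u a b u' a' b' :
  dotR (tri u a b) (tri u' a' b') = dotC u u' + dotR a a' + dotR b b'.
Proof. by rewrite /tri dotR_pt !re_cx !im_cx addrA. Qed.

Let tri_sub u a b u' a' b' : tri u a b - tri u' a' b' = tri (u - u') (a - a') (b - b').
Proof.
have := pt_lin (-1) u' u (cx a' b') (cx a b).
rewrite -cx_lin (rmorphN1 (real_complex R)) !scaleN1r /tri [RHS]addrC => <-.
by rewrite -![- _ + _]addrC.
Qed.

Let re0 : re (0 : 'rV[C]_(m + m)) = 0.
Proof. by apply/rowP => j; rewrite !mxE. Qed.

Let im0 : im (0 : 'rV[C]_(m + m)) = 0.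
Proof. by apply/rowP => j; rewrite !mxE. Qed.

Let dotC0l u : dotC 0 u = 0.
Proof. by rewrite /dotC re0 im0 !dotR0l addr0. Qed.

Let dotC0r u : dotC u 0 = 0.
Proof. by rewrite /dotC re0 im0 !dotR0r addr0. Qed.

Let H2_act A : @H2 R m q A -> exists B Q, forall u a b,
  act A (tri u a b) = tri (u *m B) (a *m Q) (b *m Q).
Proof.
move=> HA; have [|B [Q [_ _ LB]]] := @H2_action R m q (act A); first by exists A.
by exists B, Q => u a b; rewrite /tri LB cx_toC.
Qed.

Let H2_act_orth A : @H2 R m q A -> orth_map (act A).
Proof. by move=> HA; apply: (@H2_orth R m q); exists A. Qed.

Let H1_act_orth A : @H1 R n A -> orth_map (act A).
Proof. by move=> HA; apply: (@H1_orth R n); exists A. Qed.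

Let H2_nonempty : @H2 R m q !=set0.
Proof.
exists (block_mx 1%:M 0 0 (toC 1%:M)); exists 1%:M, (toC 1%:M); split.
  exact: symplectic1.
by split=> //; apply: toC_special_orthogonal; [rewrite /orthm trmx1 mulmx1|exact: det1].
Qed.

Lemma not_orbit_isometric : ~ orbit_isometric (@H1 R n) (@H2 R m q).
Proof.
move=> [f [Sf [df hit]]].
have sph u a b : dotC u u + dotR a a + dotR b b = 1 -> sphere (tri u a b).
  by rewrite /sphere /= dotR_tri.
have [x1 [S1 d1]] : exists x, sphere x /\
    odist (@H2 R m q) (f x) (tri (cx (ebasis R (lshift m k0)) 0) 0 0) = 0.
  by apply/hit/sph; rewrite /dotC re_cx im_cx !dotR0l dotR_eb !addr0.
have [x2 [S2 d2]] : exists x, sphere x /\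
    odist (@H2 R m q) (f x) (tri 0 (ebasis R i0) 0) = 0.
  by apply/hit/sph; rewrite dotC0l dotR0l dotR_eb add0r addr0.
have [x3 [S3 d3]] : exists x, sphere x /\
    odist (@H2 R m q) (f x) (tri 0 0 (ebasis R i0)) = 0.
  by apply/hit/sph; rewrite dotC0l dotR0l dotR_eb !add0r.
(* The lift reaches the orbit only up to distance 0. The orbit spans an invariant subspace, and
   projecting to it shows that [f x1] lies there as well; likewise for the next two points. *)
have [u E1] : exists u, f x1 = tri u 0 0.
  exists (ptl (f x1)); apply: (odist0_project H2_act_orth H2_nonempty (Sf _ S1) _ d1).
  - by apply: sph; rewrite /dotC re_cx im_cx !dotR0l dotR_eb !addr0.
  - by rewrite -{2}(triK (f x1)) tri_sub dotR_tri subrr dotC0r !dotR0l !addr0.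
  - move=> A /H2_act[B [Q AQ]]; rewrite AQ -{1}(triK (f x1)) tri_sub dotR_tri.
    by rewrite subrr dotC0l !mul0mx !dotR0r !addr0.
have [a E2] : exists a, f x2 = tri 0 a 0.
  exists (re (ptr (f x2))); apply: (odist0_project H2_act_orth H2_nonempty (Sf _ S2) _ d2).
  - by apply: sph; rewrite dotC0l dotR0l dotR_eb add0r addr0.
  - by rewrite -{2}(triK (f x2)) tri_sub dotR_tri subrr dotC0l dotR0r dotR0l !addr0.
  - move=> A /H2_act[B [Q AQ]]; rewrite AQ -{1}(triK (f x2)) tri_sub dotR_tri.
    by rewrite subrr !mul0mx dotC0r dotR0l dotR0r !addr0.
have [b E3] : exists b, f x3 = tri 0 0 b.
  exists (im (ptr (f x3))); apply: (odist0_project H2_act_orth H2_nonempty (Sf _ S3) _ d3).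
  - by apply: sph; rewrite dotC0l dotR0l dotR_eb !add0r.
  - by rewrite -{2}(triK (f x3)) tri_sub dotR_tri subrr dotC0l dotR0r dotR0l !addr0.
  - move=> A /H2_act[B [Q AQ]]; rewrite AQ -{1}(triK (f x3)) tri_sub dotR_tri.
    by rewrite subrr !mul0mx dotC0r dotR0l dotR0r !addr0.
(* Orthogonal orbits are at distance [acos 0]. The isometry carries this over to the first group,
   where a distance yields a one-sided bound on inner products. *)
have perp x y : sphere x -> sphere y ->
    (forall A, @H2 R m q A -> dotR (f x) (act A (f y)) = 0) ->
    forall A, @H1 R n A -> dotR x (act A y) <= 0.
  move=> Sx Sy fxy A HA; apply: (odist_dotR_le H1_act_orth Sx Sy HA).
    by rewrite -df//; exact: odist_const H2_nonempty fxy.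
  by rewrite lerN10 ler01.
apply: (H1_no_perp_triple S1 S2 S3); split; apply: perp => // A /H2_act[B [Q AQ]].
- by rewrite E1 E2 AQ dotR_tri !mul0mx dotC0r ?(dotR0l, dotR0r) !addr0.
- by rewrite E1 E3 AQ dotR_tri !mul0mx dotC0r ?(dotR0l, dotR0r) !addr0.
- by rewrite E2 E3 AQ dotR_tri !mul0mx dotC0r ?(dotR0l, dotR0r) !addr0.
Qed.

End NotIsometric.

Local Close Scope ring_scope.
Local Close Scope classical_set_scope.

Theorem theorem1p1 (R : realType) (n m : nat) :
  (3 <= n)%N -> odd n -> m = n.-1./2 ->
  isospectral (@H1 R n) (@H2 R m (n.*2 - m.*2)) /\
  ~ orbit_isometric (@H1 R n) (@H2 R m (n.*2 - m.*2)).
Proof.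
move=> n3 n_odd mE.
have nE : n = m.*2.+1.
  by rewrite mE; case: n n_odd {n3 mE} => //= k /even_halfK->.
(* So [q = 2 m + 2] is even, and at least 4 as [m > 0]: the antipodal map is available, and so are
   three axes for the slice. *)
have qE : n.*2 - m.*2 = m.*2.+2 by rewrite nE doubleS -addnn -!addSn addnK.
have m0 : 0 < m by case: m nE {mE qE} => // n1; rewrite n1 in n3.
have q2 : 2 < n.*2 - m.*2 by rewrite qE; case: m m0 {mE nE qE}.
split; last exact: not_orbit_isometric (Ordinal m0) (Ordinal (ltnW (ltnW q2))).
have M1 := @H1_model R n (Ordinal (ltnW (ltnW n3))) (Ordinal (ltnW n3)) isT.
have M2 := @H2_model R m _ (Ordinal m0) (Ordinal (ltnW (ltnW q2)))
  (Ordinal (ltnW q2)) (Ordinal q2) isT isT isT.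
apply: (isospectral_models M1 (M2 _)).
- by rewrite qE /= negbK odd_double.
- by rewrite !addnn addnC subnK// leq_double nE -addnn leqW// leq_addr.
- by rewrite (leq_trans (ltnW n3))// leq_addr.
Qed.
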